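(* Let $\psi\in W_0^{1,p}(\Omega)$ and $f\in L^{p'}(\Omega)$. Then there exists a solution $u$ to the variational inequality $$u\in K(\psi),\qquad \int_\Omega |\nabla u|^{p-2}\nabla u\cdot\nabla(v-u)\,dx\ \ge\ \int_\Omega f(v-u)\,dx\quad\text{for all } v\in K(\psi),$$ and it can be obtained as a minimizer of the minimization problem $$\inf_{v\in K(\psi)} I(v),\qquad I(v)=\frac1p\int_\Omega|\nabla v|^p\,dx-\int_\Omega f v\,dx .$$
   Context: $\Omega\subset\mathbb{R}^N$, $N\ge 2$, is a bounded domain whose boundary is piecewise $\mathcal C^1$; $1<p<\infty$ and $p'$ is the conjugate exponent of $p$. For $\psi\in W_0^{1,p}(\Omega)$ (the obstacle), $K(\psi)=\{v\in W_0^{1,p}(\Omega): v\ge\psi \text{ a.e. in }\Omega\}$. *)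

(* Defs.v *)
From HB Require Import structures.
From mathcomp Require Import all_boot all_order all_algebra.
From mathcomp Require Import all_classical all_reals all_analysis.

Set Implicit Arguments.
Unset Strict Implicit.
Unset Printing Implicit Defensive.

Import Order.TTheory GRing.Theory Num.Theory.
Import numFieldNormedType.Exports.

Local Open Scope classical_set_scope.
Local Open Scope ring_scope.

(* The sigma-algebra on R^n is the one generated by the coordinates, i.e. the
   Borel sigma-algebra; it is the analogue on row vectors of the library's
   instance on n.-tuple R. *)
Section measurable_rV.
Context {R : realType} (n : nat).

Let coord (i : 'I_n) (x : 'rV[R]_n) : R := x ord0 i.

Let rV_set0 : g_sigma_preimage coord set0.
Proof. exact: sigma_algebra0. Qed.

Let rV_setC A : g_sigma_preimage coord A -> g_sigma_preimage coord (~` A).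
Proof. exact: sigma_algebraC. Qed.

Let rV_bigcup (F : _^nat) : (forall i, g_sigma_preimage coord (F i)) ->
  g_sigma_preimage coord (\bigcup_i (F i)).
Proof. exact: sigma_algebra_bigcup. Qed.

HB.instance Definition _ := @isMeasurable.Build default_measure_display
  'rV[R]_n (g_sigma_preimage coord) rV_set0 rV_setC rV_bigcup.
End measurable_rV.

Section lebesgue_measure_rV.
Context {R : realType}.

Definition rV_cons n (p : measurableTypeR R * 'rV[R]_n) : 'rV[R]_n.+1 :=
  \row_i (if unlift ord0 i is Some j then p.2 ord0 j else p.1).

Definition rV_uncons n (x : 'rV[R]_n.+1) : measurableTypeR R * 'rV[R]_n :=
  (x ord0 ord0, \row_j x ord0 (lift ord0 j)).

Lemma rV_consK n : cancel (@rV_cons n) (@rV_uncons n).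
Proof.
move=> [a v]; rewrite /rV_uncons mxE unlift_none; congr pair.
by apply/rowP => j; rewrite !mxE liftK.
Qed.

Lemma measurable_rV_coord n (i : 'I_n) :
  measurable_fun [set: 'rV[R]_n] (fun x : 'rV[R]_n => x ord0 i).
Proof.
move=> _ Y mY; rewrite setTI; apply: sub_sigma_algebra => /=.
rewrite -bigcup_seq/=; exists i => /=; first by rewrite mem_index_enum.
by exists Y => //; rewrite setTI.
Qed.

Lemma measurable_fun_rVP d (T : measurableType d) n (f : T -> 'rV[R]_n) :
  (forall i, measurable_fun [set: T] (fun x => f x ord0 i)) ->
  measurable_fun [set: T] f.
Proof.
move=> mf _ A mA; rewrite setTI.
move: A mA; apply: smallest_sub.
  split=> [|A mA|F mF].
  - by rewrite /= preimage_set0.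
  - by rewrite /= setTD preimage_setC; exact: measurableC.
  - by rewrite /= preimage_bigcup; exact: bigcup_measurable.
rewrite -bigcup_seq; apply: bigcup_sub => i _ A [B mB <-] /=.
rewrite setTI -comp_preimage.
by have := mf i measurableT B mB; rewrite setTI.
Qed.

Lemma measurable_rV_cons n : measurable_fun [set: _] (@rV_cons n).
Proof.
apply: measurable_fun_rVP => i; rewrite /rV_cons.
under eq_fun do rewrite mxE.
case: unliftP => [j _|_].
  by apply: (measurableT_comp (measurable_rV_coord j)).
exact: measurable_fst.
Qed.

Lemma measurable_rV_uncons n : measurable_fun [set: _] (@rV_uncons n).
Proof.
apply/measurable_fun_pairP; split.
  exact: measurable_rV_coord.
apply: measurable_fun_rVP => i.
under eq_fun do rewrite mxE.
exact: measurable_rV_coord.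
Qed.

Section lebesgue_step.
Variables (n : nat) (m : {sigma_finite_measure set 'rV[R]_n -> \bar R}).

Definition lebesgue_step : set 'rV[R]_n.+1 -> \bar R :=
  pushforward (lebesgue_measure \x m)%E (@rV_cons n).

HB.instance Definition _ := Measure.copy lebesgue_step
  (measure_function_pushforward__canonical__measure_function_Measure
    (lebesgue_measure \x m)%E (@measurable_rV_cons n)).

Let lebesgue_step_sigma_finite : sigma_finite setT lebesgue_step.
Proof.
have /sigma_finiteP[F [TF ndF Foo]] :=
  sigma_finiteT (@lebesgue_measure R : {sigma_finite_measure set (measurableTypeR R) -> \bar R}).
have /sigma_finiteP[G [TG ndG Goo]] := sigma_finiteT m.
exists (fun k => @rV_uncons n @^-1` (F k `*` G k)).
  rewrite -preimage_bigcup; apply/esym/seteqP; split => // x _ /=.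
  have [k _ Fk] : (\bigcup_k F k) (rV_uncons x).1 by rewrite -TF.
  have [l _ Gl] : (\bigcup_k G k) (rV_uncons x).2 by rewrite -TG.
  exists (maxn k l) => //; split => /=.
    by move: Fk; exact/subsetPset/ndF/leq_maxl.
  by move: Gl; exact/subsetPset/ndG/leq_maxr.
move=> k; have [mF Fk] := Foo k; have [mG Gk] := Goo k.
split.
  rewrite -[X in measurable X]setTI.
  by apply: measurable_rV_uncons => //; exact: measurableX.
rewrite /lebesgue_step /pushforward -comp_preimage.
rewrite (_ : _ \o _ = id) ?preimage_id; last first.
  by apply/funext => x; exact: rV_consK.
by rewrite product_measure1E// lte_mul_pinfty// ge0_fin_numE.
Qed.

HB.instance Definition _ := Measure_isSigmaFinite.Build _ _ _ lebesgue_step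
  lebesgue_step_sigma_finite.
End lebesgue_step.

Fixpoint lebesgue_measure_rV n : {sigma_finite_measure set 'rV[R]_n -> \bar R} :=
  match n with
  | 0%N => \d_(0 : 'rV[R]_0)
  | k.+1 => lebesgue_step (lebesgue_measure_rV k)
  end.

End lebesgue_measure_rV.
Arguments lebesgue_measure_rV {R n}.

Section piecewise_C1.
Context {R : realType}.

Definition C1_map m n (phi : 'rV[R]_m -> 'rV[R]_n) :=
  (forall x, differentiable phi x) /\
  continuous (fun x => 'J phi x : 'M[R]_(m, n)).

Definition closed_cube m : set 'rV[R]_m :=
  [set x | forall i, 0 <= x ord0 i <= 1].

Definition open_cube m : set 'rV[R]_m :=
  [set x | forall i, 0 < x ord0 i < 1].

(* The boundary is a finite union of C^1 hypersurface patches, each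
   parametrized over the unit cube of R^(N-1): the parametrizations are C^1 up
   to the faces of the cube, are injective immersions of its interior (the
   derivative at x is v |-> v *m 'J phi x), and two patches may only meet along
   images of faces. Degeneracies on the faces (vertices of cones, cusps) are
   allowed. *)
Definition piecewise_C1_boundary N (Omega : set 'rV[R]_N) :=
  exists (k : nat) (phi : 'I_k -> 'rV[R]_N.-1 -> 'rV[R]_N),
  [/\ forall j, C1_map (phi j),
      forall j x, open_cube x -> row_free ('J (phi j) x),
      forall i j x y, open_cube x -> closed_cube y ->
        phi i x = phi j y -> i = j /\ x = y
    & closure Omega `\` interior Omega =
        \bigcup_j (phi j @` @closed_cube N.-1)].

End piecewise_C1.

Section sobolev.
Context {R : realType} {N : nat}.
Implicit Types (Omega : set 'rV[R]_N) (p : R) (u v f g psi : 'rV[R]_N -> R).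
Local Notation mu := (@lebesgue_measure_rV R N).

Definition partial (i : 'I_N) f : 'rV[R]_N -> R := 'D_(delta_mx ord0 i) f.

Definition smooth f :=
  forall (s : seq 'I_N) x, differentiable (foldr partial f s) x.

(* C_c^oo(Omega), its elements being extended by 0 outside of Omega *)
Definition test_function Omega f :=
  let K := closure [set x | f x != 0] in
  [/\ smooth f, compact K & K `<=` Omega].

(* Only the values on Omega matter; the functions are not quotiented by
   almost-everywhere equality. *)
Definition Lp Omega p : set ('rV[R]_N -> R) :=
  [set f | f \_ Omega \in Lfun mu p%:E].

Definition locally_integrable_on Omega f := measurable_fun Omega f /\
  forall K, K `<=` Omega -> compact K ->
    (\int[mu]_(x in K) `|f x|%:E < +oo)%E.

Definition is_weak_partial Omega (i : 'I_N) u g :=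
  [/\ locally_integrable_on Omega u, locally_integrable_on Omega g
    & forall phi, test_function Omega phi ->
      \int[mu]_(x in Omega) (u x * partial i phi x) =
      - \int[mu]_(x in Omega) (g x * phi x)].

(* A chosen weak derivative (unique up to a.e. equality), with a default value
   if there is none. *)
Definition weak_partial Omega (i : 'I_N) u : 'rV[R]_N -> R :=
  get (is_weak_partial Omega i u).

Definition grad Omega u (x : 'rV[R]_N) : 'rV[R]_N :=
  \row_i weak_partial Omega i u x.

Definition W1p Omega p : set ('rV[R]_N -> R) :=
  [set u | Lp Omega p u /\
    forall i, exists2 g, Lp Omega p g & is_weak_partial Omega i u g].

Definition W1p_norm Omega p u : \bar R :=
  ('N[mu]_p%:E [EFin \o u \_ Omega] +
   \sum_(i < N) 'N[mu]_p%:E [EFin \o weak_partial Omega i u \_ Omega])%E.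

Definition W1p0 Omega p : set ('rV[R]_N -> R) :=
  [set u | W1p Omega p u /\
    forall e : R, 0 < e -> exists2 phi, test_function Omega phi &
      (W1p_norm Omega p (u \- phi)%R < e%:E)%E].

Definition obstacle_set Omega p psi : set ('rV[R]_N -> R) :=
  [set v | W1p0 Omega p v /\ {ae mu, forall x, Omega x -> psi x <= v x}].

Definition dotrV (a b : 'rV[R]_N) : R := \sum_(i < N) a ord0 i * b ord0 i.

(* The library's norm on row vectors is the sup norm. *)
Definition euclid_norm (a : 'rV[R]_N) : R := Num.sqrt (dotrV a a).

(* |a|^(p-2) a . b; at a = 0 it is 0, whatever the value of 0 `^ (p - 2). *)
Definition plaplace_form p (a b : 'rV[R]_N) : R :=
  euclid_norm a `^ (p - 2) * dotrV a b.

Definition solves_obstacle_inequality Omega p psi f u :=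
  obstacle_set Omega p psi u /\
  forall v, obstacle_set Omega p psi v ->
    \int[mu]_(x in Omega)
       plaplace_form p (grad Omega u x) (grad Omega (v \- u) x) >=
    \int[mu]_(x in Omega) (f x * (v x - u x)).

Definition obstacle_energy Omega p f v : R :=
  p^-1 * \int[mu]_(x in Omega) (euclid_norm (grad Omega v x) `^ p) -
  \int[mu]_(x in Omega) (f x * v x).

Definition minimizes_on (A : set ('rV[R]_N -> R)) (I : ('rV[R]_N -> R) -> R) u :=
  A u /\ forall v, A v -> I u <= I v.

End sobolev.

(* Main.v *)
Require Import Defs.
From HB Require Import structures.
From mathcomp Require Import all_boot all_order all_algebra.
From mathcomp Require Import all_classical all_reals all_analysis.
From mathcomp Require Import measurable_realfun ring lra.
Import Order.TTheory GRing.Theory Num.Theory.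
Import numFieldNormedType.Exports.
Set Implicit Arguments.
Unset Strict Implicit.
Unset Printing Implicit Defensive.
Local Open Scope classical_set_scope.
Local Open Scope ring_scope.

(** The proof is the direct method of the calculus of variations, carried out
with strongly convergent minimizing sequences.

Sobolev functions are handled as pairs (u, g), where g plays the role of the
gradient of u: [sobolev0] is the closure in L^p of the pairs formed by a test
function and its partial derivatives. This is a closed linear space of pairs,
and it is equivalent to [W1p0] because g must agree almost everywhere with
the weak gradient of u; that uniqueness rests on the fundamental lemma of the
calculus of variations ([fundamental_lemma]).

Write I(u, g) = (1/p) int |g|^p - int f u.

Coercivity. The Poincare inequality ([poincare]), proved by integrating the
i-th partial derivative of x_i |phi|^p, bounds the p-energy of u by that of g.
With Young's inequality it follows that I(u, g) controls int |g|^p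
([coercive]), so I has a finite infimum m over the obstacle set.

Compactness. The function |.|^p on R^N is uniformly convex for every p > 1
([uniform_convexity]). The midpoint of two members of the convex obstacle set
belongs to it, so if both almost minimize I their gradients are close in L^p
([almost_minimizers_close]). A minimizing sequence is thus a Cauchy sequence,
and converges in L^p together with its gradients ([p_complete]), at a rate
that also gives convergence almost everywhere. The limit is therefore still
in the obstacle set, and it attains m by the tangent inequality for |.|^p
([functional_lsc]).

Variational inequality. For v in the obstacle set and 0 < t <= 1, the
function u_t = (1 - t) u + t v is in the obstacle set, and I(u) <= I(u_t).
The tangent inequality at the gradient of u_t gives
   int f (v - u) <= int |grad u_t|^(p-2) grad u_t . grad (v - u),
and t tends to 0 by dominated convergence
([minimizer_variational_inequality]). *)

(** * Powers of nonnegative reals *)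

Section powR_facts.
Context {R : realType}.
Implicit Types (p q s t x y e : R).

(** With t = exp s the claim follows from exp x > 1 + x at x = (p - 1) s and
from exp (- s) >= 1 - s. *)
Lemma bernoulli_powR_lt p t : 1 < p -> 0 <= t -> t != 1 ->
  1 + p * (t - 1) < t `^ p.
Proof.
move=> p1; rewrite le_eqVlt => /predU1P[<- _|t0 t1].
  by rewrite powR0; [lra|apply/eqP; lra].
have [s st] : exists s, expR s = t by exists (ln t); rewrite lnK ?posrE.
have s0 : s != 0 by apply: contra t1 => /eqP s0; rewrite -st s0 expR0.
have -> : t `^ p = expR s * expR ((p - 1) * s).
  by rewrite -expRD -st /powR gt_eqF ?expR_gt0// expRK; congr expR; ring.
rewrite -st; have es := expR_gt0 s.
have h1 : 1 + (p - 1) * s < expR ((p - 1) * s).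
  by apply: expR_gt1Dx; rewrite mulf_neq0// subr_eq0 gt_eqF.
have h2 : 1 - s <= expR (- s) by exact: expR_ge1Dx.
have h3 : expR s * expR (- s) = 1 by rewrite -expRD subrr expR0.
have h4 : expR s * (1 - s) <= 1 by rewrite -[leRHS]h3 ler_pM2l.
have h5 : expR s * (1 + (p - 1) * s) < expR s * expR ((p - 1) * s).
  by rewrite ltr_pM2l.
apply: le_lt_trans h5; nra.
Qed.

(** The strict Bernoulli inequality at x / m and y / m, where m is the midpoint,
places both values above the tangent line at m; the two slopes cancel. *)
Lemma powR_midpoint_lt p x y : 1 < p -> 0 <= x -> 0 <= y -> x != y ->
  ((x + y) / 2) `^ p < (x `^ p + y `^ p) / 2.
Proof.
move=> p1 x0 y0 xy; set m := (x + y) / 2.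
have m0 : 0 < m.
  rewrite /m divr_gt0//; move: x0; rewrite le_eqVlt => /predU1P[x0|x0]; last lra.
  by move: xy; rewrite -x0 add0r lt0r y0 andbT eq_sym.
have key z : 0 <= z -> z != m -> m `^ p * (1 + p * (z / m - 1)) < z `^ p.
  move=> z0 zm; have -> : z `^ p = m `^ p * (z / m) `^ p.
    rewrite -powRM ?(ltW m0)//; last by rewrite divr_ge0// ltW.
    by rewrite mulrCA divff ?mulr1// gt_eqF.
  rewrite ltr_pM2l ?powR_gt0//; apply: bernoulli_powR_lt => //.
    by rewrite divr_ge0// ltW.
  by rewrite -(divff (lt0r_neq0 m0)) (inj_eq (divIf (lt0r_neq0 m0))).
have xm : x != m by apply: contra xy => /eqP; rewrite /m => h; apply/eqP; lra.
have ym : y != m by apply: contra xy => /eqP; rewrite /m => h; apply/eqP; lra.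
have := ltrD (key x x0 xm) (key y y0 ym).
have -> : m `^ p * (1 + p * (x / m - 1)) + m `^ p * (1 + p * (y / m - 1)) =
  m `^ p * 2 + p * m `^ p * ((x + y) / m - 2) by ring.
have -> : (x + y) / m = 2.
  by rewrite (_ : x + y = 2 * m) ?mulfK ?gt_eqF// /m; field.
by rewrite subrr mulr0 addr0; lra.
Qed.

Lemma powRD_le p x y : 0 <= p -> 0 <= x -> 0 <= y ->
  (x + y) `^ p <= 2 `^ p * (x `^ p + y `^ p).
Proof.
move=> p0; wlog xy : x y / x <= y => [hw x0 y0|x0 y0].
  have [xy|/ltW yx] := leP x y; first exact: hw.
  by rewrite addrC [X in _ * X]addrC; exact: hw.
apply: (@le_trans _ _ ((2 * y) `^ p)).
  by rewrite ge0_ler_powR// ?nnegrE; [lra|lra|lra].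
by rewrite powRM// ler_wpM2l ?powR_ge0// lerDr powR_ge0.
Qed.

(** The weight e is obtained by multiplying the first factor by
l = (p e)^(1/p), and dividing the second one by it, before applying Young's
inequality. *)
Lemma young_epsilon p q e : 0 < p -> 0 < q -> p^-1 + q^-1 = 1 -> 0 < e ->
  exists2 C, 0 <= C & forall a b, 0 <= a -> 0 <= b ->
    a * b <= e * a `^ p + C * b `^ q.
Proof.
move=> p0 q0 pq e0; pose l := (p * e) `^ p^-1.
have pe0 : 0 < p * e by rewrite mulr_gt0.
have l0 : 0 < l by rewrite powR_gt0.
exists (l^-1 `^ q / q); first by rewrite divr_ge0 ?powR_ge0// ltW.
move=> a b a0 b0.
have -> : a * b = (l * a) * (l^-1 * b) by field; rewrite gt_eqF.
apply: le_trans (conjugate_powR _ _ p0 q0 pq) _.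
- by rewrite mulr_ge0// ltW.
- by rewrite mulr_ge0// invr_ge0 ltW.
rewrite !powRM ?invr_ge0 ?(ltW l0)//.
rewrite /l -powRrM mulVf ?gt_eqF// powRr1 ?(ltW pe0)//.
rewrite -/l le_eqVlt; apply/orP; left; apply/eqP; field.
by rewrite !gt_eqF.
Qed.

Lemma continuous_norm_powR p : 0 < p -> continuous (fun t : R => `|t| `^ p).
Proof.
(* At 0 the power need not be differentiable, so its continuity is proved
directly; elsewhere it follows from differentiability. *)
move=> p0 t; have [->|t0] := eqVneq t 0.
  rewrite /continuous_at normr0 powR0 ?gt_eqF//; apply/cvgrPdist_lt => e e0.
  near=> s; rewrite sub0r normrN ger0_norm ?powR_ge0//.
  rewrite -[ltRHS](@powRr1 _ e) ?(ltW e0)// -(mulVf (lt0r_neq0 p0)) powRrM.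
  rewrite gt0_ltr_powR// ?nnegrE ?powR_ge0//.
  by near: s; apply: (@nbhs0_lt _ R^o); rewrite powR_gt0.
have nt0 : 0 < `|t| by rewrite normr_gt0.
apply: (@continuous_comp _ _ _ (fun t : R => `|t|) (fun s => s `^ p)).
  exact: norm_continuous.
apply: differentiable_continuous; apply/derivable1_diffP.
by apply: derivable_powR => //; rewrite in_itv/= nt0.
Unshelve. all: by end_near. Qed.

Lemma cvg_norm_dominated0 (T : topologicalType) (f g : T -> R) (a : T) :
  (forall c, `|f c| <= g c) -> g c @[c --> a] --> (0 : R) ->
  f c @[c --> a] --> (0 : R).
Proof.
move=> fg g0; apply: (@squeeze_cvgr _ _ _ _ (fun c => - g c) g) => //.
  by apply: nearW => c; rewrite -ler_norml.
by rewrite -oppr0; exact: cvgN.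
Qed.

End powR_facts.

(** * Euclidean norm and the form of the p-Laplacian *)

Section euclidean.
Context {R : realType} {N : nat}.
Implicit Types (a b c : 'rV[R]_N) (p t : R).

Lemma dotrVC a b : dotrV a b = dotrV b a.
Proof. by apply: eq_bigr => i _; rewrite mulrC. Qed.

Lemma dotrVDl a b c : dotrV (a + b) c = dotrV a c + dotrV b c.
Proof. by rewrite -big_split; apply: eq_bigr => i _; rewrite mxE mulrDl. Qed.

Lemma dotrVZl t a b : dotrV (t *: a) b = t * dotrV a b.
Proof. by rewrite mulr_sumr; apply: eq_bigr => i _; rewrite mxE mulrA. Qed.

Lemma dotrVDr a b c : dotrV a (b + c) = dotrV a b + dotrV a c.
Proof. by rewrite dotrVC dotrVDl dotrVC (dotrVC c). Qed.

Lemma dotrVZr t a b : dotrV a (t *: b) = t * dotrV a b.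
Proof. by rewrite dotrVC dotrVZl dotrVC. Qed.

Lemma dotrVBr a b c : dotrV a (b - c) = dotrV a b - dotrV a c.
Proof. by rewrite dotrVDr -scaleN1r dotrVZr mulN1r. Qed.

Lemma dotrVBl a b c : dotrV (a - b) c = dotrV a c - dotrV b c.
Proof. by rewrite dotrVC dotrVBr dotrVC (dotrVC c). Qed.

Lemma dotrV_ge0 a : 0 <= dotrV a a.
Proof. by apply: sumr_ge0 => i _; rewrite -expr2 sqr_ge0. Qed.

Lemma euclid_norm_ge0 a : 0 <= euclid_norm a.
Proof. exact: sqrtr_ge0. Qed.

Lemma euclid_norm_sqr a : euclid_norm a ^+ 2 = dotrV a a.
Proof. by rewrite sqr_sqrtr// dotrV_ge0. Qed.

Lemma le_coord_euclid_norm a i : `|a ord0 i| <= euclid_norm a.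
Proof.
rewrite -(@ler_pXn2r _ 2)// ?nnegrE ?euclid_norm_ge0//.
rewrite euclid_norm_sqr real_normK ?num_real// /dotrV (bigD1 i)//= -expr2 lerDl.
by apply: sumr_ge0 => j _; rewrite -expr2 sqr_ge0.
Qed.

Lemma euclid_norm_eq0 a : euclid_norm a = 0 -> a = 0.
Proof.
move=> a0; apply/rowP => i; apply/eqP; rewrite mxE -normr_le0 -a0.
exact: le_coord_euclid_norm.
Qed.

Lemma euclid_norm0 : euclid_norm (0 : 'rV[R]_N) = 0.
Proof.
by rewrite /euclid_norm /dotrV big1 ?sqrtr0// => i _; rewrite mxE mul0r.
Qed.

Lemma euclid_normZ t a : euclid_norm (t *: a) = `|t| * euclid_norm a.
Proof.
rewrite /euclid_norm dotrVZl dotrVZr mulrA -expr2 sqrtrM ?sqr_ge0//.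
by rewrite sqrtr_sqr.
Qed.

(** The expansion of the square of |b| a - |a| b is twice |a| |b| times the
difference of the two sides; when |a| |b| = 0 both sides are 0. *)
Lemma cauchy_schwarz a b : dotrV a b <= euclid_norm a * euclid_norm b.
Proof.
set A := euclid_norm a; set B := euclid_norm b.
have : 0 <= dotrV (B *: a - A *: b) (B *: a - A *: b) by exact: dotrV_ge0.
rewrite dotrVBl !dotrVBr !dotrVZl !dotrVZr (dotrVC b a) -!euclid_norm_sqr -/A -/B.
have A0 : 0 <= A := euclid_norm_ge0 a.
have B0 : 0 <= B := euclid_norm_ge0 b.
have [a0|aN0] := eqVneq A 0.
  by rewrite (euclid_norm_eq0 a0) /dotrV big1 ?mulr_ge0// => i _; rewrite mxE mul0r.
have [b0|bN0] := eqVneq B 0.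
  by rewrite (euclid_norm_eq0 b0) /dotrV big1 ?mulr_ge0// => i _; rewrite mxE mulr0.
have AB : 0 < A * B by rewrite mulr_gt0// lt0r ?aN0 ?bN0.
rewrite (_ : _ - _ = 2 * (A * B) * (A * B - dotrV a b)); last by ring.
by rewrite pmulr_rge0 ?subr_ge0// mulr_gt0.
Qed.

Lemma cauchy_schwarz_norm a b : `|dotrV a b| <= euclid_norm a * euclid_norm b.
Proof.
rewrite ler_norml cauchy_schwarz andbT lerNl.
by rewrite -mulN1r -dotrVZl (le_trans (cauchy_schwarz _ _))// euclid_normZ normrN1 mul1r.
Qed.

Lemma euclid_normD a b : euclid_norm (a + b) <= euclid_norm a + euclid_norm b.
Proof.
rewrite -(@ler_pXn2r _ 2)// ?nnegrE ?addr_ge0 ?euclid_norm_ge0//.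
rewrite sqrrD !euclid_norm_sqr dotrVDl !dotrVDr (dotrVC b a).
have := cauchy_schwarz a b; lra.
Qed.

Lemma euclid_normB a b : euclid_norm (a - b) <= euclid_norm a + euclid_norm b.
Proof.
by rewrite (le_trans (euclid_normD _ _))// -scaleN1r euclid_normZ normrN1 mul1r.
Qed.

Lemma continuous_dotrV (T : topologicalType) (f g : T -> 'rV[R]_N) :
  continuous f -> continuous g -> continuous (fun x => dotrV (f x) (g x)).
Proof.
move=> cf cg; rewrite /dotrV.
apply: continuous_big => [|i _ x]; first exact: add_continuous.
by apply: cvgM;
  [apply: (@continuous_comp _ _ _ f (fun v : 'rV[R]_N => v ord0 i))
  |apply: (@continuous_comp _ _ _ g (fun v : 'rV[R]_N => v ord0 i))];
  do ?[exact: cf|exact: cg]; exact: coord_continuous.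
Qed.

Lemma continuous_euclid_norm : continuous (@euclid_norm R N).
Proof.
move=> x; apply: (@continuous_comp _ _ _ (fun a => dotrV a a)).
  by apply: continuous_dotrV => y; exact: cvg_id.
exact: sqrt_continuous.
Qed.

Lemma continuous_euclid_norm_powR p : 0 < p ->
  continuous (fun a => euclid_norm a `^ p).
Proof.
move=> p0 x; rewrite (_ : (fun a => _) = (fun t => `|t| `^ p) \o (@euclid_norm R N)).
  by apply: continuous_comp; [exact: continuous_euclid_norm|exact: continuous_norm_powR].
by apply/funext => a /=; rewrite ger0_norm ?euclid_norm_ge0.
Qed.

Lemma plaplace_form_diag p a : 1 < p -> plaplace_form p a a = euclid_norm a `^ p.
Proof.
move=> p1; rewrite /plaplace_form -euclid_norm_sqr.
have [->|a0] := eqVneq (euclid_norm a) 0.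
  by rewrite expr0n/= mulr0 powR0//; apply/eqP; lra.
rewrite -powR_mulrn ?euclid_norm_ge0// -powRD ?a0 ?implybT//.
by congr (_ `^ _); lra.
Qed.

(** Cauchy-Schwarz, the powers |a|^(p-2) and |a| being merged. At a = 0 the
powers do not merge, but the form vanishes. *)
Lemma plaplace_form_le p a b : 1 < p ->
  `|plaplace_form p a b| <= euclid_norm a `^ (p - 1) * euclid_norm b.
Proof.
move=> p1; rewrite /plaplace_form normrM ger0_norm ?powR_ge0//.
have [a0|a0] := eqVneq (euclid_norm a) 0.
  have ab : dotrV a b = 0.
    by rewrite (euclid_norm_eq0 a0) /dotrV big1// => i _; rewrite mxE mul0r.
  by rewrite ab normr0 mulr0 mulr_ge0 ?powR_ge0 ?euclid_norm_ge0.
rewrite (_ : p - 1 = (p - 2) + 1); last by lra.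
rewrite [_ `^ (_ + 1)]powRD ?a0 ?implybT//.
rewrite powRr1 ?euclid_norm_ge0// -mulrA.
by rewrite ler_wpM2l ?powR_ge0 ?cauchy_schwarz_norm.
Qed.

Lemma plaplace_formBr p a b c :
  plaplace_form p a (b - c) = plaplace_form p a b - plaplace_form p a c.
Proof. by rewrite /plaplace_form dotrVBr mulrBr. Qed.

Lemma plaplace_formZr p t a b :
  plaplace_form p a (t *: b) = t * plaplace_form p a b.
Proof. by rewrite /plaplace_form dotrVZr mulrCA. Qed.

(** As a function of b, the form is the differential of |.|^p / p at a, so this
is the tangent inequality of a convex function. It is Young's inequality for
the product |a|^(p-1) |b|, and it is the only differential information on the
energy used below. *)
Lemma plaplace_form_convex p a b : 1 < p ->
  p * plaplace_form p a (b - a) <= euclid_norm b `^ p - euclid_norm a `^ p.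
Proof.
move=> p1; have p0 : 0 < p by lra.
rewrite plaplace_formBr plaplace_form_diag//.
have := le_trans (ler_norm _) (plaplace_form_le a b p1).
set A := euclid_norm a; set B := euclid_norm b.
have q0 : 0 < p / (p - 1) by rewrite divr_gt0//; lra.
have pq : (p / (p - 1))^-1 + p^-1 = 1.
  by field; rewrite lt0r_neq0//= subr_eq0 gt_eqF.
have := conjugate_powR (powR_ge0 A (p - 1)) (euclid_norm_ge0 b) q0 p0 pq.
rewrite -powRrM mulrCA divff ?mulr1; last by apply/eqP; lra.
rewrite -/B => h1 h2.
have : p * plaplace_form p a b <= p * (A `^ p / (p / (p - 1)) + B `^ p / p).
  by rewrite ler_pM2l//; exact: le_trans h1.
rewrite (_ : p * (_ + _) = A `^ p * (p - 1) + B `^ p); first by rewrite mulrBr mulrBr mulr1 => h3; lra.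
by field; rewrite lt0r_neq0//= subr_eq0 gt_eqF.
Qed.

(** When p < 2 the factor |a|^(p-2) is unbounded near 0; continuity at 0 comes
from the bound |a|^(p-1) |b|. *)
Lemma continuous_plaplace_form p b : 1 < p ->
  continuous (fun a => plaplace_form p a b).
Proof.
move=> p1 a; rewrite /continuous_at.
have [a0|a0] := eqVneq (euclid_norm a) 0; last first.
  have h1 : euclid_norm c `^ (p - 2) @[c --> a] --> euclid_norm a `^ (p - 2).
    apply: (@continuous_comp _ _ _ (@euclid_norm R N) (fun s => s `^ (p - 2))).
      exact: continuous_euclid_norm.
    apply: differentiable_continuous; apply/derivable1_diffP.
    by apply: derivable_powR => //; rewrite in_itv/= lt0r a0 euclid_norm_ge0.
  have h2 : dotrV c b @[c --> a] --> dotrV a b.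
    by apply: (@continuous_dotrV _ id (fun=> b)) => y;
      [exact: cvg_id|exact: cst_continuous].
  exact: cvgM h1 h2.
have p10 : 0 < p - 1 by lra.
have h : euclid_norm c `^ (p - 1) * euclid_norm b @[c --> a] --> (0 : R).
  rewrite -[X in _ --> X](mul0r (euclid_norm b)) -(powR0 (lt0r_neq0 p10)) -a0.
  have h1 : euclid_norm c `^ (p - 1) @[c --> a] --> euclid_norm a `^ (p - 1).
    exact: (continuous_euclid_norm_powR p10).
  exact: (cvgM h1 (cvg_cst _)).
rewrite (_ : plaplace_form p a b = 0); last first.
  by rewrite (euclid_norm_eq0 a0) /plaplace_form /dotrV big1 ?mulr0// => i _; rewrite mxE mul0r.
by apply: cvg_norm_dominated0 h => c; exact: plaplace_form_le.
Qed.

(** Either the norms of a and b differ, and the power is strictly convex, or they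
are equal, and the parallelogram identity makes the midpoint strictly
shorter. *)
Lemma euclid_norm_powR_midpoint_lt p a b : 1 < p -> a != b ->
  euclid_norm (2^-1 *: (a + b)) `^ p <
  (euclid_norm a `^ p + euclid_norm b `^ p) / 2.
Proof.
move=> p1 ab; rewrite euclid_normZ ger0_norm//.
have p0 : 0 < p by lra.
have := euclid_normD a b.
have [/eqP eab|nab] := eqVneq (euclid_norm a) (euclid_norm b); last first.
  move=> h; apply: le_lt_trans (powR_midpoint_lt p1 _ _ nab); rewrite ?euclid_norm_ge0//.
  rewrite ge0_ler_powR ?(ltW p0)// ?nnegrE ?divr_ge0 ?mulr_ge0 ?addr_ge0 ?euclid_norm_ge0//.
  by rewrite mulrC ler_pM2r// invr_gt0.
move=> _; rewrite (eqP eab) -mulr2n -(mulr_natr (_ `^ _)) mulfK//.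
have dab : 0 < dotrV (a - b) (a - b).
  rewrite -euclid_norm_sqr exprn_gt0// lt0r euclid_norm_ge0 andbT.
  by apply: contra ab => /eqP/euclid_norm_eq0/eqP; rewrite subr_eq0.
have sab : euclid_norm a ^+ 2 = euclid_norm b ^+ 2 by rewrite (eqP eab).
rewrite gt0_ltr_powR ?nnegrE ?mulr_ge0 ?euclid_norm_ge0//.
rewrite -(@ltr_pXn2r _ 2)// ?nnegrE ?mulr_ge0 ?euclid_norm_ge0//.
move: dab sab.
rewrite exprMn !euclid_norm_sqr dotrVBl !dotrVBr dotrVDl !dotrVDr (dotrVC b a); lra.
Qed.

Lemma euclid_norm_powR_midpoint p a b : 1 < p ->
  euclid_norm (2^-1 *: (a + b)) `^ p <=
  (euclid_norm a `^ p + euclid_norm b `^ p) / 2.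
Proof.
move=> p1; have [->|ab] := eqVneq a b; last exact/ltW/euclid_norm_powR_midpoint_lt.
rewrite (_ : 2^-1 *: (b + b) = b); last first.
  by rewrite scalerDr -scalerDl -[RHS]scale1r; congr (_ *: _); lra.
by rewrite -mulr2n -(mulr_natr (_ `^ _)) mulfK.
Qed.
End euclidean.

(** * Uniform convexity of the p-th power of the norm *)

Section uniform_convexity.
Context {R : realType} {N : nat}.
Implicit Types (a b c : 'rV[R]_N) (p t : R).

Let convexity_gap p a b := (euclid_norm a `^ p + euclid_norm b `^ p) / 2 -
  euclid_norm (2^-1 *: (a + b)) `^ p.

Let continuous_enorm (f : 'rV[R]_N * 'rV[R]_N -> 'rV[R]_N) p : 0 < p ->
  continuous f -> continuous (fun z => euclid_norm (f z) `^ p).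
Proof.
move=> p0 cf z; apply: (@continuous_comp _ _ _ f (fun a => euclid_norm a `^ p)).
  exact: cf.
exact: continuous_euclid_norm_powR.
Qed.

Let cfst : continuous (fun z : 'rV[R]_N * 'rV[R]_N => z.1).
Proof. by move=> z; exact: cvg_fst. Qed.
Let csnd : continuous (fun z : 'rV[R]_N * 'rV[R]_N => z.2).
Proof. by move=> z; exact: cvg_snd. Qed.

Let continuous_gap p : 0 < p -> continuous (fun z => convexity_gap p z.1 z.2).
Proof.
move=> p0 z; apply: cvgB; last first.
  apply: (continuous_enorm p0) => {}z; apply: cvgZl_tmp; apply: cvgD.
    exact: cfst.
  exact: csnd.
apply: cvgM; last exact: cvg_cst.
by apply: cvgD; [exact: (continuous_enorm p0 cfst)|exact: (continuous_enorm p0 csnd)].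
Qed.

(** The pairs with |a|^p + |b|^p = 1 and |a - b|^p >= e form a compact set, on
which the convexity gap has a minimum d > 0; then C = 2^p / d works, since
|a - b|^p <= 2^p. *)
Let unit_case p e : 1 < p -> 0 < e -> exists2 C, 0 <= C & forall a b,
  euclid_norm a `^ p + euclid_norm b `^ p = 1 ->
  euclid_norm (a - b) `^ p <= e + C * convexity_gap p a b.
Proof.
move=> p1 e0; have p0 : 0 < p by lra.
pose K := [set z : 'rV[R]_N * 'rV[R]_N |
  euclid_norm z.1 `^ p + euclid_norm z.2 `^ p = 1 /\
  e <= euclid_norm (z.1 - z.2) `^ p].
have gap0 a b : 0 <= convexity_gap p a b by rewrite subr_ge0 euclid_norm_powR_midpoint.
have [[z0 Kz0]|K0] := pselect (K !=set0); last first.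
  exists 0 => // a b ab1; rewrite mul0r addr0 leNgt; apply/negP => h.
  by apply: K0; exists (a, b); split => //; exact: ltW.
have cK : compact K.
  pose Q := [set v : 'rV[R]_N | forall i, v ord0 i \in `[-1, 1]].
  have cQ : compact Q.
    apply: (@rV_compact R N (fun=> `[-1, 1]%classic)) => _.
    exact: segment_compact.
  apply: subclosed_compact (compact_setX cQ cQ) _.
    apply: closedI.
      apply: (@preimage_closed _ _ (fun z : 'rV[R]_N * 'rV[R]_N =>
        euclid_norm z.1 `^ p + euclid_norm z.2 `^ p) [set 1]).
        move=> z _; apply: cvgD; first exact: (continuous_enorm p0 cfst).
        exact: (continuous_enorm p0 csnd).
      exact: closed_eq.
    apply: (@preimage_closed _ _ (fun z : 'rV[R]_N * 'rV[R]_N =>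
        euclid_norm (z.1 - z.2) `^ p) [set x | e <= x]).
      move=> z _; apply: (continuous_enorm p0) => {}z; apply: cvgB.
        exact: cfst.
      exact: csnd.
    exact: closed_ge.
  have aux a : euclid_norm a `^ p <= 1 -> Q a.
    move=> a1 i; rewrite in_itv/= -ler_norml.
    rewrite (le_trans (le_coord_euclid_norm _ _))// leNgt; apply/negP => h.
    move: a1; rewrite leNgt => /negP; apply.
    have -> : (1 : R) = 1 `^ p by rewrite powR1.
    by rewrite gt0_ltr_powR// ?nnegrE ?euclid_norm_ge0.
  move=> [a b] [/= ab _]; split; apply: aux => /=;
  have := powR_ge0 (euclid_norm a) p; have := powR_ge0 (euclid_norm b) p; lra.
have [[a0 b0]] := @compact_EVT_min _ R (fun z => convexity_gap p z.1 z.2) K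
  (ex_intro _ z0 Kz0) cK (continuous_subspaceT (continuous_gap p0)).
move=> /set_mem[/= ab1 ab2] minK.
have {}minK a b : euclid_norm a `^ p + euclid_norm b `^ p = 1 ->
    e <= euclid_norm (a - b) `^ p -> convexity_gap p a0 b0 <= convexity_gap p a b.
  by move=> ab h; exact: (minK (a, b) (mem_set (conj ab h))).
have d0 : 0 < convexity_gap p a0 b0.
  rewrite subr_gt0; apply: euclid_norm_powR_midpoint_lt => //.
  apply/eqP => ab; move: ab2; rewrite ab subrr euclid_norm0 powR0 ?gt_eqF//; lra.
have bnd a b : euclid_norm a `^ p + euclid_norm b `^ p = 1 ->
    euclid_norm (a - b) `^ p <= 2 `^ p.
  move=> ab; apply: (@le_trans _ _ ((euclid_norm a + euclid_norm b) `^ p)).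
    by rewrite ge0_ler_powR ?(ltW p0)// ?nnegrE ?addr_ge0 ?euclid_norm_ge0 ?euclid_normB.
  apply: le_trans (powRD_le _ _ _) _; rewrite ?(ltW p0) ?euclid_norm_ge0//.
  by rewrite ab mulr1.
move: (convexity_gap p a0 b0) d0 minK => d d0 gapd.
have Cd0 : 0 <= 2 `^ p / d by rewrite divr_ge0 ?powR_ge0// ltW.
exists (2 `^ p / d) => // a b ab.
have [h|h] := leP e (euclid_norm (a - b) `^ p); last first.
  apply: le_trans (ltW h) _; rewrite lerDl.
  exact: mulr_ge0 Cd0 (gap0 a b).
apply: le_trans (bnd _ _ ab) _.
apply: (@le_trans _ _ (2 `^ p / d * convexity_gap p a b)); last first.
  by rewrite lerDr ltW.
rewrite -mulrA ler_peMr ?powR_ge0// mulrC ler_pdivlMr// mul1r.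
exact: gapd.
Qed.

(** The inequality extends to all pairs by homogeneity. It is stated with a free
e and without roots so that it can be integrated term by term. Compactness
treats all p > 1 alike, whereas Clarkson's inequalities take different forms
for p < 2 and p >= 2. *)
Lemma uniform_convexity p e : 1 < p -> 0 < e -> exists2 C, 0 <= C & forall a b,
  euclid_norm (a - b) `^ p <=
  e * (euclid_norm a `^ p + euclid_norm b `^ p) +
  C * ((euclid_norm a `^ p + euclid_norm b `^ p) / 2 -
       euclid_norm (2^-1 *: (a + b)) `^ p).
Proof.
move=> p1 e0; have p0 : 0 < p by lra.
have [C C0 hC] := unit_case p1 e0; exists C => // a b.
set S := euclid_norm a `^ p + euclid_norm b `^ p.
have S0 : 0 <= S by rewrite addr_ge0 ?powR_ge0.
have [S00|SN0] := eqVneq S 0.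
  have [a0 b0] : a = 0 /\ b = 0.
    move: S00 => /eqP; rewrite paddr_eq0 ?powR_ge0// !powR_eq0 (lt0r_neq0 p0) !andbT.
    by move=> /andP[/eqP a0 /eqP b0]; split; exact: euclid_norm_eq0.
  by rewrite S00 a0 b0 subr0 addr0 scaler0 euclid_norm0 powR0 ?gt_eqF// mulr0 mul0r subrr mulr0 addr0.
(* Both vectors are divided by s, so that the sum of the p-th powers is 1. *)
pose s := S `^ p^-1.
have Sgt0 : 0 < S by rewrite lt0r SN0.
have s0 : 0 < s by rewrite powR_gt0.
have sp : s `^ p = S by rewrite -powRrM mulVf ?gt_eqF// powRr1.
have scal c : euclid_norm (s^-1 *: c) `^ p = S^-1 * euclid_norm c `^ p.
  rewrite euclid_normZ gtr0_norm ?invr_gt0// powRM ?invr_ge0 ?(ltW s0) ?euclid_norm_ge0//.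
  by rewrite -{1}(powR_inv1 (ltW s0)) -powRrM mulN1r powRN sp.
have := hC (s^-1 *: a) (s^-1 *: b).
rewrite /convexity_gap -scalerBr -scalerDr [2^-1 *: (_ *: _)]scalerA [2^-1 * _]mulrC -scalerA !scal.
rewrite -mulrDr mulVf// => /(_ erefl).
rewrite -(ler_pM2l Sgt0) mulrA divff// mul1r => /le_trans; apply.
by rewrite le_eqVlt; apply/orP; left; apply/eqP; rewrite -/S; field.
Qed.
End uniform_convexity.

(** * Boxes and Borel sets *)

Section boxes.
Context {R : realType} {n : nat}.
Implicit Types (a b c d x : 'rV[R]_n) (A : set 'rV[R]_n).

Definition open_box a b :=
  [set x : 'rV[R]_n | forall i, a ord0 i < x ord0 i < b ord0 i].

Definition closed_box a b :=
  [set x : 'rV[R]_n | forall i, a ord0 i <= x ord0 i <= b ord0 i].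

Definition box_set := [set B | exists a b, B = open_box a b].

Lemma open_boxI a b c d : open_box a b `&` open_box c d =
  open_box (\row_i Num.max (a ord0 i) (c ord0 i)) (\row_i Num.min (b ord0 i) (d ord0 i)).
Proof.
apply/seteqP; split => [x [h1 h2] i|x h].
  by rewrite !mxE gt_max lt_min; move: (h1 i) (h2 i) => /andP[-> ->] /andP[-> ->].
by split => i; have := h i; rewrite !mxE gt_max lt_min => /andP[/andP[? ?]/andP[? ?]]; apply/andP.
Qed.

Lemma box_setI : setI_closed box_set.
Proof. by move=> _ _ [a [b ->]] [c [d ->]]; rewrite open_boxI; do 2 eexists. Qed.

Lemma sub_open_closed_box a b : open_box a b `<=` closed_box a b.
Proof. by move=> x h i; have /andP[/ltW -> /ltW ->] := h i. Qed.

(** Countably many boxes, with rational centre and half-width 1/(k+1): they show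
that open sets are measurable, and they reduce almost everywhere statements
on an open set to boxes whose closure it contains. *)
Definition rat_lo (z : 'rV[rat]_n * nat) : 'rV[R]_n :=
  \row_i (ratr (z.1 ord0 i) - z.2.+1%:R^-1).
Definition rat_hi (z : 'rV[rat]_n * nat) : 'rV[R]_n :=
  \row_i (ratr (z.1 ord0 i) + z.2.+1%:R^-1).

Lemma open_rational_box A x : open A -> A x ->
  exists2 z, open_box (rat_lo z) (rat_hi z) x &
    closed_box (rat_lo z) (rat_hi z) `<=` A.
Proof.
move=> oA Ax; have /nbhs_ballP[e /= e0 xeA] : nbhs x A by exact: open_nbhs_nbhs.
have /ltr_add_invr[k] : 0 < e / 2 by rewrite divr_gt0.
rewrite add0r => ke; set d := k.+1%:R^-1 in ke.
have d0 : 0 < d by rewrite invr_gt0.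
have /choice[q hq] (i : 'I_n) : exists q : rat, x ord0 i - d < ratr q < x ord0 i + d.
  have /rat_in_itvoo[q] : x ord0 i - d < x ord0 i + d by lra.
  by rewrite in_itv/=; exists q.
exists (\row_i q i, k) => [i|y hy]; first by rewrite !mxE/= -/d; have := hq i; lra.
apply: xeA; split => // i j; rewrite ord1 /ball/= ltr_norml.
by have := hq j; have := hy j; rewrite !mxE/= -/d; lra.
Qed.

Lemma countable_rat_box : countable [set: 'rV[rat]_n * nat].
Proof. exact: countableP. Qed.

Lemma open_bigcup_box A : open A -> A =
  \bigcup_z (if `[< closed_box (rat_lo z) (rat_hi z) `<=` A >]
             then open_box (rat_lo z) (rat_hi z) else set0).
Proof.
move=> oA; apply/seteqP; split => [x Ax|x [z _]].
  have [z zx zA] := open_rational_box oA Ax.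
  by exists z => //; case: asboolP.
case: asboolP => // zA /sub_open_closed_box; exact: zA.
Qed.

Lemma open_g_sigma_box A : open A -> <<s box_set >> A.
Proof.
move=> oA; rewrite (open_bigcup_box oA).
apply: (@countable_bigcupT_measurable _ (g_sigma_algebraType box_set)).
  exact: countable_rat_box.
move=> z; case: asboolP => _; last exact: measurable0.
by apply: sub_sigma_algebra; exists (rat_lo z), (rat_hi z).
Qed.

(** The open boxes generate the coordinate sigma-algebra; being stable under
intersection, they are the starting point of arguments by Dynkin's theorem. *)
Lemma measurable_rV_box : @measurable _ 'rV[R]_n = <<s box_set >>.
Proof.
apply/seteqP; split => [A mA|].
  have : measurable_fun setT (id : g_sigma_algebraType box_set -> 'rV[R]_n).
    apply: measurable_fun_rVP => i.
    apply: (measurability _ (RGenOpens.measurableE R)).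
    move=> _ [_ [c [d ->]] <-]; rewrite setTI; apply: open_g_sigma_box.
    apply: (@open_comp _ _ (fun x : 'rV[R]_n => x ord0 i)); last exact: interval_open.
    by move=> x _; exact: coord_continuous.
  by move=> /(_ measurableT A mA); rewrite setTI.
apply: smallest_sub; first exact: sigma_algebra_measurable.
move=> _ [a [b ->]].
rewrite (_ : open_box a b = \bigcap_(i in [set: 'I_n])
   (fun x : 'rV[R]_n => x ord0 i) @^-1` `]a ord0 i, b ord0 i[%classic).
  apply: fin_bigcap_measurable; first exact: finite_finset.
  move=> i _; rewrite -[X in measurable X]setTI.
  by apply: measurable_rV_coord => //; exact: measurable_itv.
apply/seteqP; split => x /= h i; last by have := h i I; rewrite /= in_itv.
by move=> _; rewrite /= in_itv/=; exact: h.
Qed.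

Lemma open_measurable_rV A : open A -> measurable A.
Proof. by move=> oA; rewrite measurable_rV_box; exact: open_g_sigma_box. Qed.

Lemma closed_measurable_rV A : closed A -> measurable A.
Proof.
by move=> cA; rewrite -(setCK A); apply: measurableC; apply: open_measurable_rV; exact: closed_openC.
Qed.

Lemma compact_measurable_rV A : compact A -> measurable A.
Proof.
move=> cA; apply: closed_measurable_rV; apply: compact_closed => //.
Qed.

Lemma continuous_measurable_rV (f : 'rV[R]_n -> R) : continuous f -> measurable_fun setT f.
Proof.
move=> cf; apply: (measurability _ (RGenOpens.measurableE R)).
move=> _ [_ [c [d ->]] <-]; rewrite setTI; apply: open_measurable_rV.
by apply: open_comp; [move=> x _; exact: cf|exact: interval_open].
Qed.

Lemma closed_closed_box a b : closed (closed_box a b).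
Proof.
rewrite (_ : closed_box a b = \bigcap_(i in [set: 'I_n])
  ((fun x : 'rV[R]_n => x ord0 i) @^-1` [set y | a ord0 i <= y] `&`
   (fun x : 'rV[R]_n => x ord0 i) @^-1` [set y | y <= b ord0 i])).
  apply: closed_bigI => i _; apply: closedI; apply: preimage_closed.
  - by move=> x _; exact: coord_continuous.
  - exact: closed_ge.
  - by move=> x _; exact: coord_continuous.
  - exact: closed_le.
apply/seteqP; split => x h i; first by move=> _; apply/andP; exact: h.
by apply/andP; exact: (h i I).
Qed.

Lemma compact_closed_box a b : compact (closed_box a b).
Proof.
rewrite (_ : closed_box a b = [set v : 'rV[R]_n | forall i, [set` `[a ord0 i, b ord0 i]] (v ord0 i)]).
  by apply: (@rV_compact R n (fun i => [set` `[a ord0 i, b ord0 i]])) => i; exact: segment_compact.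
by apply/seteqP; split => x h i; have := h i; rewrite /= in_itv/=.
Qed.

Lemma bounded_sub_box A : bounded_set A ->
  exists2 M : R, 0 < M & A `<=` open_box (const_mx (- M)) (const_mx M).
Proof.
move=> [M [_ hM]]; exists (`|M| + 2); first by rewrite ltr_wpDl.
move=> x Ax i; rewrite !mxE -ltr_norml.
have : `|x| <= `|M| + 1 by apply: hM Ax; have := ler_norm M; lra.
move=> hx; apply: le_lt_trans (_ : _ <= `|M| + 1) _; last by lra.
apply: le_trans hx; rewrite [leRHS]/Num.norm/= mx_normrE.
by apply/bigmax_geP; right => /=; exists (ord0, i).
Qed.

Lemma compact_sub_box A : compact A ->
  exists2 M : R, 0 < M & A `<=` open_box (const_mx (- M)) (const_mx M).
Proof. by move=> /compact_bounded; exact: bounded_sub_box. Qed.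

End boxes.

(** * Bounded sets have finite Lebesgue measure *)

Section finite_measure.
Context {R : realType}.

Lemma closed_box_finite n (a b : 'rV[R]_n) :
  (lebesgue_measure_rV (closed_box a b) < +oo)%E.
Proof.
elim: n a b => [|n IH] a b; first by rewrite /= diracE ltry.
rewrite /= /lebesgue_step/= /pushforward.
rewrite (_ : _ @^-1` _ = `[a ord0 ord0, b ord0 ord0]%classic `*`
   closed_box (\row_j a ord0 (lift ord0 j)) (\row_j b ord0 (lift ord0 j))).
  rewrite product_measure1E; [|exact: measurable_itv|].
    have := lebesgue_measure_itv `[a ord0 ord0, b ord0 ord0]; rewrite /= => ->.
    case: ifP => [ab|_]; last by rewrite mul0e ltry.
    by rewrite lte_mul_pinfty// -EFinB lee_fin subr_ge0 ltW.
  apply: closed_measurable_rV; exact: closed_closed_box.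
apply/seteqP; split=> -[t v] /=.
  move=> h; split => [|j]; first by have := h ord0; rewrite mxE unlift_none in_itv.
  by have := h (lift ord0 j); rewrite !mxE liftK.
rewrite in_itv/= => -[h1 h2] i; rewrite mxE.
by case: unliftP => [j ->|->//]; have := h2 j; rewrite !mxE.
Qed.

Lemma bounded_finite_measure n (A : set 'rV[R]_n) : measurable A -> bounded_set A ->
  (lebesgue_measure_rV A < +oo)%E.
Proof.
move=> mA /bounded_sub_box[M M0 AM].
apply: (@le_lt_trans _ _ (lebesgue_measure_rV (closed_box (const_mx (- M)) (const_mx M)))); last first.
  exact: closed_box_finite.
apply: le_measure; rewrite ?inE//=.
  apply: closed_measurable_rV; exact: closed_closed_box.
by apply: subset_trans AM _; exact: sub_open_closed_box.
Qed.
End finite_measure.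

(** * Integrals of partial derivatives *)

Section derive_along_line.
Context {R : numFieldType} {U V W : normedModType R}.

(** A directional derivative only depends on the restriction of the function to a
line, so it is shared by functions that agree along affine parametrizations
of lines, in spaces of different dimensions. *)
Lemma is_derive_reparam (F : U -> W) (g : V -> W) (x u : U) (s w : V) (d : W) :
  (forall h : R, g (h *: w + s) = F (h *: u + x)) ->
  is_derive x u F d -> is_derive s w g d.
Proof.
move=> gF [dF DF]; have g0 : g s = F x.
  by have := gF 0; rewrite !scale0r !add0r.
have e : (fun h : R => h^-1 *: ((g \o shift s) (h *: w) - g s)) =
         (fun h : R => h^-1 *: ((F \o shift x) (h *: u) - F x)).
  by apply/funext => h /=; rewrite gF g0.
by apply: DeriveDef; [rewrite /derivable e|rewrite /derive e].
Qed.
End derive_along_line.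

Section divergence.
Context {R : realType}.

Lemma rV_cons_shift0 n (h t : R) (v : 'rV[R]_n) :
  rV_cons (h *: (1 : R) + t : R, v) = h *: delta_mx ord0 ord0 + rV_cons (t, v).
Proof.
apply/rowP => i; rewrite !mxE eqxx/=; case: unliftP => [j|] ->.
  by rewrite eq_sym (negbTE (neq_lift _ _)) mulr0 add0r.
by rewrite eqxx.
Qed.

Lemma rV_cons_shiftS n (h t : R) (j : 'I_n) (v : 'rV[R]_n) :
  rV_cons (t, h *: delta_mx ord0 j + v) =
  h *: delta_mx ord0 (lift ord0 j) + rV_cons (t, v).
Proof.
apply/rowP => i; rewrite !mxE eqxx/=; case: unliftP => [k|] -> /=.
  by rewrite !mxE eqxx/= (inj_eq lift_inj).
by rewrite mulr0 add0r.
Qed.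

Lemma continuous_rV_consr n (t : R) :
  continuous (fun v : 'rV[R]_n => rV_cons (t : measurableTypeR R, v)).
Proof.
move=> v; have FF := @nbhs_filter _ v; apply/cvg_ballP => e e0.
have : nbhs v (ball v e) by exact: nbhsx_ballx.
apply: filterS => w [_ vw]; split => // i j; rewrite !mxE.
by case: unliftP => [k _|_] /=; [exact: vw|exact: ballxx].
Qed.

Lemma continuous_rV_consl n (v : 'rV[R]_n) :
  continuous (fun t : R => rV_cons (t : measurableTypeR R, v)).
Proof.
move=> t; apply/cvg_ballP => e e0.
have : nbhs t (ball t e) by exact: nbhsx_ballx.
apply: filterS => s ts; split => // i j; rewrite !mxE.
by case: unliftP => [k _|_] //=; exact: ballxx.
Qed.

Lemma integrable_continuous_box n (G : 'rV[R]_n -> R) (M : R) : continuous G ->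
  (forall x, ~ open_box (const_mx (- M)) (const_mx M) x -> G x = 0) ->
  lebesgue_measure_rV.-integrable setT (EFin \o G).
Proof.
move=> cG G0; pose B : set 'rV[R]_n := closed_box (const_mx (- M)) (const_mx M).
have mB : measurable B by apply: closed_measurable_rV; exact: closed_closed_box.
rewrite (_ : EFin \o G = (EFin \o G) \_ B); last first.
  apply/funext => x; rewrite patchE; case: ifPn => // /negP xB /=; rewrite G0// => h.
  by apply: xB; apply/mem_set/sub_open_closed_box.
apply/(integrable_mkcond _ mB); apply: measurable_bounded_integrable => //.
- exact: closed_box_finite.
- by apply: measurable_funTS; exact: continuous_measurable_rV.
- have /compact_bounded : compact (G @` B).
    by apply: continuous_compact; [exact: continuous_subspaceT|exact: compact_closed_box].
  by move=> [m [mr h]]; exists m; split => // c mc x Bx; apply: (h c mc); exists x.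
Qed.

(** Fubini's theorem in both orders, for the first coordinate against the others. *)
Lemma integral_rV_cons n (G : 'rV[R]_n.+1 -> R) :
  lebesgue_measure_rV.-integrable setT (EFin \o G) ->
  (\int[lebesgue_measure_rV]_x (G x)%:E =
   \int[lebesgue_measure]_t \int[lebesgue_measure_rV]_v (G (rV_cons (t, v)))%:E)%E /\
  (\int[lebesgue_measure_rV]_x (G x)%:E =
   \int[lebesgue_measure_rV]_v \int[lebesgue_measure]_t (G (rV_cons (t, v)))%:E)%E.
Proof.
move=> iG; have /measurable_EFinP mG := measurable_int _ iG.
have iG' : (lebesgue_measure \x lebesgue_measure_rV)%E.-integrable setT
   ((EFin \o G) \o @rV_cons R n).
  apply/integrableP; split.
  apply/(measurable_EFinP _ (G \o @rV_cons R n)).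
  exact: measurableT_comp mG (@measurable_rV_cons R n).
  move/integrableP : iG => [_]; apply: le_lt_trans.
  rewrite /= /lebesgue_step ge0_integral_pushforward//=.
    exact: measurable_rV_cons.
  by apply/measurable_EFinP; exact: measurableT_comp.
have -> : (\int[lebesgue_measure_rV]_x (G x)%:E =
   \int[lebesgue_measure \x lebesgue_measure_rV]_z (G (rV_cons z))%:E)%E.
  rewrite /= /lebesgue_step integral_pushforward//=.
    exact: measurable_rV_cons.
  exact/measurable_EFinP.
by split; [rewrite -(integral12_prod_meas1 iG')|rewrite -(integral21_prod_meas1 iG')].
Qed.

Lemma integral_derive1_eq0 (F G : R -> R) (M : R) : 0 < M ->
  (forall x : R, is_derive x (1 : R) F (G x)) -> continuous G ->
  (forall x, M <= `|x| -> F x = 0) -> (forall x, M <= `|x| -> G x = 0) ->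
  (\int[lebesgue_measure]_x (G x)%:E = 0)%E.
Proof.
move=> M0 dF cG F0 G0.
have -> : (\int[lebesgue_measure]_x (G x)%:E =
           \int[lebesgue_measure]_(x in `[(- M)%R, M]) (G x)%:E)%E.
  rewrite [RHS]integral_mkcond; apply: eq_integral => x _; rewrite patchE.
  case: ifPn => // /negP; rewrite inE/= in_itv/= -ler_norml => /negP.
  by rewrite -ltNge => /ltW/G0 ->.
rewrite (@continuous_FTC2 _ G F).
- by rewrite !F0 ?subee// ?normrN gtr0_norm.
- lra.
- exact: continuous_subspaceT.
- have cF : continuous F.
    by move=> x; apply/differentiable_continuous/derivable1_diffP; have [] := dF x.
  split=> [x _| |]; first by have [] := dF x.
    exact/cvg_at_right_filter/cF.
  exact/cvg_at_left_filter/cF.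
- by move=> x _; rewrite derive1E; have [] := dF x.
Qed.

(** Induction on the dimension through Fubini's theorem: the derivative either
falls on the remaining coordinates, which is the induction hypothesis, or on
the first one, which is integrated first by the fundamental theorem of
calculus. *)
Lemma integral_partial_eq0 n (i : 'I_n) (F G : 'rV[R]_n -> R) (M : R) : 0 < M ->
  (forall x, is_derive x (delta_mx ord0 i) F (G x)) -> continuous G ->
  (forall x, ~ open_box (const_mx (- M)) (const_mx M) x -> F x = 0) ->
  (forall x, ~ open_box (const_mx (- M)) (const_mx M) x -> G x = 0) ->
  (\int[lebesgue_measure_rV]_x (G x)%:E = 0)%E.
Proof.
move=> M0; elim: n i F G => [[]//|n IH] i F G dF cG F0 G0.
have iG := integrable_continuous_box cG G0.
have [E1 E2] := integral_rV_cons iG.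
have outl t (v : 'rV[R]_n) : M <= `|t| ->
    ~ open_box (const_mx (- M)) (const_mx M) (rV_cons (t, v)).
  by move=> tM /(_ ord0); rewrite !mxE unlift_none/= -ltr_norml ltNge tM.
have outr t (v : 'rV[R]_n) : ~ open_box (const_mx (- M)) (const_mx M) v ->
    ~ open_box (const_mx (- M)) (const_mx M) (rV_cons (t, v)).
  by move=> vM h; apply: vM => j; have := h (lift ord0 j); rewrite !mxE liftK.
case: (unliftP ord0 i) dF => [j ->|->] dF.
- rewrite E1 integral0_eq// => t _; apply: (IH j (fun v => F (rV_cons (t, v)))).
  + move=> v; apply: is_derive_reparam (dF (rV_cons (t, v))) => h.
    by rewrite rV_cons_shiftS.
  + move=> v; apply: (@continuous_comp _ _ _ (fun v : 'rV[R]_n => rV_cons (t, v)) G); last exact: cG.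
    exact: continuous_rV_consr.
  + by move=> v /(outr t)/F0.
  + by move=> v /(outr t)/G0.
- rewrite E2 integral0_eq// => v _.
  apply: (@integral_derive1_eq0 (fun t => F (rV_cons (t, v))) _ M) => //.
  + move=> t; apply: is_derive_reparam (dF (rV_cons (t, v))) => h.
    by rewrite rV_cons_shift0.
  + move=> t; apply: (@continuous_comp _ _ _ (fun t : R => rV_cons (t, v)) G); last exact: cG.
    exact: continuous_rV_consl.
  + by move=> t /(outl _ v)/F0.
  + by move=> t /(outl _ v)/G0.
Qed.
End divergence.

(** * The flat functions built on exp(-1/t) *)

Section derive_estimate.
Context {R : realType} {V : normedModType R}.

(** A derivative read off an explicit bound on the first-order remainder. It
serves at the points where a function is not given by a formula stable under
the differentiation rules. *)
Lemma is_derive_dominated (f : V -> R) (x v : V) (d : R) (r : R -> R) :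
  (forall h : R, `|f (h *: v + x) - f x - h * d| <= `|h| * r h) ->
  r h @[h --> 0] --> 0 -> is_derive x v f d.
Proof.
move=> fr r0.
have c : h^-1 *: (f (h *: v + x) - f x) @[h --> 0^'] --> d.
  apply/cvgrPdist_lt => e e0; near=> h.
  have h0 : h != 0 by near: h; exact: nbhs_dnbhs_neq.
  have rh : `|r h| < e.
    near: h; apply: nbhs_dnbhs.
    by have /cvgrPdist_lt/(_ _ e0) := r0; apply: filterS => h; rewrite sub0r normrN.
  have nh : 0 < `|h| by rewrite normr_gt0.
  rewrite distrC -[X in X - d]/(h^-1 * _).
  have -> : h^-1 * (f (h *: v + x) - f x) - d =
            h^-1 * (f (h *: v + x) - f x - h * d) by field.
  rewrite normrM normfV mulrC ltr_pdivrMr// mulrC.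
  rewrite [_ * h]mulrC; apply: le_lt_trans (fr h) _; rewrite mulrC ltr_pM2r//.
  exact: le_lt_trans (ler_norm _) rh.
apply: DeriveDef; first by apply/cvg_ex; exists d.
exact: cvg_lim c.
Unshelve. all: by end_near. Qed.
End derive_estimate.

Section flat_function.
Context {R : realType}.
Implicit Types (t : R) (k : nat).

(** The functions t^(-k) exp(-1/t), extended by 0 to t <= 0. Differentiating one
gives a combination of the next two, so exp(-1/t) is smooth at 0 as well. *)
Definition flat k t : R := if 0 < t then t^-1 ^+ k * expR (- t^-1) else 0.

Lemma flat_ge0 k t : 0 <= flat k t.
Proof.
by rewrite /flat; case: ifP => // t0; rewrite mulr_ge0 ?exprn_ge0 ?invr_ge0 ?expR_ge0// ltW.
Qed.

Lemma flat0_le1 t : flat 0 t <= 1.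
Proof.
rewrite /flat; case: ifP => // t0.
by rewrite expr0 mul1r -expR0 ler_expR oppr_le0 invr_ge0 ltW.
Qed.

Lemma flat_le0 k t : t <= 0 -> flat k t = 0.
Proof. by move=> t0; rewrite /flat ltNge t0. Qed.

(** The exponential at 1/t exceeds the term of degree k+1 of its series. *)
Lemma flat_le k t : 0 < t -> flat k t <= k.+1`!%:R * t.
Proof.
move=> t0; rewrite /flat t0.
have h : t^-1 ^+ k.+1 / k.+1`!%:R <= expR t^-1.
  have := @expR_ge1Dxn R t^-1 k; rewrite invr_ge0 ltW// => /(_ erefl).
  by apply: le_trans; rewrite lerDr.
have f0 : 0 < (k.+1`!%:R : R) by rewrite ltr0n fact_gt0.
move: h; rewrite ler_pdivrMr// expRN => h.
rewrite ler_pdivrMr ?expR_gt0// mulrAC -ler_pdivrMr//.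
by rewrite mulrC -exprS (mulrC _ (expR _)).
Qed.

(** At 0 the difference quotient is flat k.+1, which tends to 0 by flat_le. *)
Lemma is_derive_flat k t :
  is_derive t (1 : R) (flat k) (flat k.+2 t - k%:R * flat k.+1 t).
Proof.
case: (ltgtP t 0) => [t0|t0|->].
- rewrite !flat_le0 ?ltW// mulr0 subr0.
  apply: (@near_eq_is_derive _ _ _ (cst 0)).
    near=> s; rewrite flat_le0// ltW//; near: s; exact: lt_nbhsl.
- rewrite /flat t0.
  apply: (@near_eq_is_derive R R R (fun s : R => s^-1 ^+ k * expR (- s^-1))).
    near=> s; rewrite /flat ifT//; near: s; exact: lt_nbhsr.
  have tN0 : t != 0 by rewrite gt_eqF.
  have dV : is_derive t (1 : R) (fun s : R => s^-1) (- t^-1 ^+ 2).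
    apply: is_derive_eq; first exact: (is_deriveV tN0 (is_derive_id t (1 : R))).
    by rewrite -[LHS]/(_ * 1) mulr1 exprVn.
  have dE : is_derive t (1 : R) (fun s : R => expR (- s^-1)) (expR (- t^-1) * t^-1 ^+ 2).
    apply: (@is_derive1_comp _ expR (fun s => - s^-1)).
    by apply: is_derive_eq (is_deriveN dV) _; rewrite opprK.
  have kE : (fun s : R => s^-1 ^+ k) = (fun s : R => s^-1) ^+ k.
    by apply/funext => s; rewrite !fctE.
  have dX := is_deriveX k dV; rewrite -kE in dX.
  apply: is_derive_eq (is_deriveM dX dE) _.
  rewrite /GRing.scale/= {dX kE dE}; case: k => [|k] /=; first by ring.
  by rewrite !exprS; ring.
- rewrite !flat_le0// mulr0 subr0.
  apply: (@is_derive_dominated _ _ _ _ _ _ (fun h => k.+2`!%:R * `|h|)).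
    move=> h; rewrite [h *: 1]mulr1 addr0 (flat_le0 _ (lexx 0)) mulr0 !subr0.
    have [h0|h0] := leP h 0; first by rewrite flat_le0// normr0 !mulr_ge0.
    have -> : flat k h = h * flat k.+1 h.
      by rewrite /flat h0 exprS !mulrA divff ?mul1r// gt_eqF.
    rewrite normrM ler_pM2l ?normr_gt0 ?gt_eqF//.
    by rewrite ger0_norm ?flat_ge0// (gtr0_norm h0) flat_le.
  have n0 : `|h| @[h --> (0 : R)] --> (0 : R).
    by have := @norm_continuous _ R 0; rewrite /continuous_at normr0.
  rewrite -[X in _ --> X](mulr0 k.+2`!%:R).
  by apply: cvgM n0; exact: cvg_cst.
Unshelve. all: by end_near. Qed.

End flat_function.

(** * Smooth functions *)

Section smooth_functions.
Context {R : realType} {N : nat}.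
Implicit Types (f g : 'rV[R]_N -> R) (i : 'I_N).

(** A class of differentiable functions that is stable under partial derivatives
contains all the iterated derivatives of its members. *)
Lemma smooth_closed (C : set ('rV[R]_N -> R)) :
  (forall f x, C f -> differentiable f x) ->
  (forall f i, C f -> C (partial i f)) ->
  forall f, C f -> smooth f.
Proof.
move=> dC pC f Cf s x; apply: dC; elim: s => //= i s IH; exact: pC.
Qed.

Lemma smooth_differentiable f x : smooth f -> differentiable f x.
Proof. by move=> sf; exact: (sf [::]). Qed.

Lemma smooth_continuous f : smooth f -> continuous f.
Proof. by move=> sf x; apply/differentiable_continuous/smooth_differentiable. Qed.

Lemma smooth_partial f i : smooth f -> smooth (partial i f).
Proof. by move=> sf s x; have := sf (rcons s i) x; rewrite foldr_rcons. Qed.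

Lemma smooth_is_derive f i x : smooth f ->
  is_derive x (delta_mx ord0 i) f (partial i f x).
Proof.
by move=> sf; apply: DeriveDef => //; exact/diff_derivable/smooth_differentiable.
Qed.

(** A class to which smooth_closed applies. The generators Alg_smooth make it
show that sums and products of smooth functions are smooth; the generators
Alg_flat make it contain the bump functions supported by boxes. *)
Inductive smooth_alg : set ('rV[R]_N -> R) :=
| Alg_smooth f : smooth f -> smooth_alg f
| Alg_cst (c : R) : smooth_alg (fun=> c)
| Alg_add f g : smooth_alg f -> smooth_alg g -> smooth_alg (f \+ g)
| Alg_mul f g : smooth_alg f -> smooth_alg g -> smooth_alg (f \* g)
| Alg_flat k i (a b : R) : smooth_alg (fun x => flat k (a * x ord0 i + b)).

Lemma is_derive_flat_coord k i (a b : R) (x : 'rV[R]_N) j :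
  is_derive x (delta_mx ord0 j) (fun x => flat k (a * x ord0 i + b))
    ((i == j)%:R * a * (flat k.+2 (a * x ord0 i + b) - k%:R * flat k.+1 (a * x ord0 i + b))).
Proof.
have e (h : R) : a * (h *: delta_mx ord0 j + x) ord0 i + b =
    h *: ((i == j)%:R * a) + (a * x ord0 i + b).
  by rewrite !mxE eqxx/= -[_ *: _]/(_ * _); ring.
apply: (@is_derive_reparam _ _ _ _ (flat k) _ (a * x ord0 i + b) ((i == j)%:R * a)).
  by move=> h; rewrite e.
set c := _ * a; set y := _ + b.
have := is_derive_flat k y => -[d1 d2].
apply: DeriveDef; first exact/diff_derivable/derivable1_diffP.
have -> : c = c *: (1 : R) by rewrite -[_ *: _]/(_ * _) mulr1.
have dy : differentiable (flat k) y by exact/derivable1_diffP.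
by rewrite deriveE// linearZ/= -deriveE// d2 -[_ *: _]/(_ * _) -[c *: _]/(_ * _) mulr1.
Qed.

Lemma differentiable_flat_coord k i (a b : R) (x : 'rV[R]_N) :
  differentiable (fun x : 'rV[R]_N => flat k (a * x ord0 i + b)) x.
Proof.
apply: (@differentiable_comp _ _ _ _ (fun x : 'rV[R]_N => a * x ord0 i + b) (flat k)).
  apply: differentiableD => //; apply: differentiableM => //.
  exact: differentiable_coord.
by apply/derivable1_diffP; have [] := is_derive_flat k (a * x ord0 i + b).
Qed.

Lemma smooth_alg_smooth f : smooth_alg f -> smooth f.
Proof.
have dif g x : smooth_alg g -> differentiable g x.
  elim=> {g} [g sg|c|g h _ dg _ dh|g h _ dg _ dh|k i a b].
  - exact: smooth_differentiable.
  - exact: differentiable_cst.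
  - exact: differentiableD.
  - exact: differentiableM.
  - exact: differentiable_flat_coord.
apply: smooth_closed => //.
move=> {}f i; elim=> {f} [g sg|c|g h Cg dg Ch dh|g h Cg dg Ch dh|k j a b].
- exact/Alg_smooth/smooth_partial.
- rewrite (_ : partial i _ = fun=> 0); first exact: Alg_cst.
  by apply/funext => x; exact: derive_cst.
- rewrite (_ : partial i _ = partial i g \+ partial i h); first exact: Alg_add.
  by apply/funext => x; rewrite /partial deriveD//; exact/diff_derivable/dif.
- rewrite (_ : partial i _ = (g \* partial i h) \+ (h \* partial i g)).
    by apply: Alg_add; exact: Alg_mul.
  by apply/funext => x; rewrite /partial deriveM//; exact/diff_derivable/dif.
- rewrite (_ : partial i _ = (fun=> (j == i)%:R * a) \*
     ((fun x => flat k.+2 (a * x ord0 j + b)) \+ ((fun=> - k%:R) \* (fun x => flat k.+1 (a * x ord0 j + b))))).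
    apply: Alg_mul; first exact: Alg_cst.
    apply: Alg_add; first exact: Alg_flat.
    by apply: Alg_mul; [exact: Alg_cst|exact: Alg_flat].
  apply/funext => x; rewrite /partial/=.
  by have [_ ->] := is_derive_flat_coord k j a b x i; rewrite mulNr.
Qed.

Lemma smoothD f g : smooth f -> smooth g -> smooth (f \+ g).
Proof. by move=> sf sg; apply: smooth_alg_smooth; apply: Alg_add; exact: Alg_smooth. Qed.

Lemma smoothM f g : smooth f -> smooth g -> smooth (f \* g).
Proof. by move=> sf sg; apply: smooth_alg_smooth; apply: Alg_mul; exact: Alg_smooth. Qed.

Lemma smooth_cst (c : R) : smooth (fun _ : 'rV[R]_N => c).
Proof. by apply: smooth_alg_smooth; exact: Alg_cst. Qed.

Lemma smoothZ c f : smooth f -> smooth (fun x => c * f x).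
Proof. by move=> sf; apply: smoothM => //; exact: smooth_cst. Qed.

Lemma partialD f g i : smooth f -> smooth g ->
  partial i (f \+ g) = partial i f \+ partial i g.
Proof.
move=> sf sg; apply/funext => x; rewrite /partial deriveD//;
  exact/diff_derivable/smooth_differentiable.
Qed.

Lemma partialZ c f i : smooth f ->
  partial i (fun x => c * f x) = fun x => c * partial i f x.
Proof.
move=> sf; apply/funext => x; rewrite /partial deriveMl//.
exact/diff_derivable/smooth_differentiable.
Qed.

End smooth_functions.

(** * Test functions *)

Section test_functions.
Context {R : realType} {N : nat}.
Implicit Types (Omega : set 'rV[R]_N) (f g phi : 'rV[R]_N -> R) (i : 'I_N).
Local Notation mu := (@lebesgue_measure_rV R N).

Lemma test_smooth Omega phi : test_function Omega phi -> smooth phi.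
Proof. by case. Qed.

Lemma test_continuous Omega phi : test_function Omega phi -> continuous phi.
Proof. by case=> /smooth_continuous. Qed.

Lemma test_function_supp Omega f phi : smooth f -> test_function Omega phi ->
  (forall x, (closure [set x | phi x != 0]) x \/ f x = 0) -> test_function Omega f.
Proof.
move=> sf [sp cK KO] f0.
have sub : closure [set x | f x != 0] `<=` closure [set x | phi x != 0].
  rewrite (closure_id (closure [set x | phi x != 0])).1; last exact: closed_closure.
  apply: closureS => x /= fx; have [//|fx0] := f0 x.
  by rewrite fx0 eqxx in fx.
split => //; last exact: subset_trans sub KO.
by apply: subclosed_compact sub => //; exact: closed_closure.
Qed.

Lemma test_functionD Omega f g : test_function Omega f -> test_function Omega g ->
  test_function Omega (f \+ g).
Proof.
move=> [sf cf fO] [sg cg gO].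
have sub : closure [set x | (f \+ g) x != 0] `<=`
    closure [set x | f x != 0] `|` closure [set x | g x != 0].
  rewrite -closureU; apply: closureS => x /=.
  by have [->|] := eqVneq (f x) 0; [rewrite add0r; right|left].
split; first exact: smoothD.
  apply: subclosed_compact sub; first exact: closed_closure.
  exact: compactU.
by apply: subset_trans sub _; rewrite subUset.
Qed.

Lemma test_functionZ Omega c f : test_function Omega f ->
  test_function Omega (fun x => c * f x).
Proof.
move=> tf; apply: (test_function_supp _ tf); first by apply: smoothZ; case: tf.
move=> x; have [fx|fx] := eqVneq (f x) 0; first by right; rewrite fx mulr0.
by left; exact: subset_closure.
Qed.

(** Off the closed support of f the function is locally 0, hence so is its
derivative. *)
Lemma test_function_partial Omega f i : test_function Omega f ->
  test_function Omega (partial i f).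
Proof.
move=> tf; have [sf cf fO] := tf.
apply: (test_function_supp (smooth_partial i sf) tf) => x.
have [|xK] := pselect (closure [set x | f x != 0] x); [by left|right].
rewrite /partial -(derive_cst (0 : R) x (delta_mx ord0 i)); apply: near_eq_derive.
have : nbhs x (~` closure [set x | f x != 0]).
  by apply: open_nbhs_nbhs; split => //; exact/closed_openC/closed_closure.
by apply: filterS => y yK; apply: contrapT => fy; apply: yK; apply: subset_closure; apply/eqP.
Qed.

Lemma test_function_out Omega f x : test_function Omega f -> ~ Omega x -> f x = 0.
Proof.
move=> [_ _ fO] xO; apply: contrapT => fx; apply: xO; apply: fO.
by apply: subset_closure; apply/eqP.
Qed.

Lemma test_function_bounded Omega f : test_function Omega f ->
  exists2 M : R, 0 <= M & forall x, `|f x| <= M.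
Proof.
move=> tf; have [sf cf fO] := tf.
have /compact_bounded[M [_ hM]] : compact (f @` closure [set x | f x != 0]).
  apply: continuous_compact => //; apply: continuous_subspaceT.
  exact: test_continuous tf.
exists (`|M| + 1); first by rewrite addr_ge0.
move=> x; have [->|fx] := eqVneq (f x) 0; first by rewrite normr0 addr_ge0.
apply: (hM (`|M| + 1)); first by rewrite ltr_pwDr// ler_norm.
by exists x => //; exact: subset_closure.
Qed.

Lemma test_function_box Omega f : test_function Omega f -> exists2 M : R, 0 < M &
  forall x, ~ open_box (const_mx (- M)) (const_mx M) x -> f x = 0.
Proof.
move=> [sf cf fO]; have [M M0 hM] := compact_sub_box cf.
exists M => // x xM; apply: contrapT => fx; apply: xM; apply: hM.
by apply: subset_closure; apply/eqP.
Qed.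

Lemma test_function_measurable Omega f : test_function Omega f -> measurable_fun setT f.
Proof. by move=> /test_continuous; exact: continuous_measurable_rV. Qed.

(** phi is bounded, and vanishes off a compact subset of Omega on which u is
integrable. *)
Lemma integrable_locally_test Omega u phi : open Omega ->
  locally_integrable_on Omega u -> test_function Omega phi ->
  mu.-integrable Omega (EFin \o (fun x => u x * phi x)).
Proof.
move=> oO [mu_ Lu] tp; have [sp cK KO] := tp.
set K := closure _ in cK KO.
have mO := open_measurable_rV oO; have mK := compact_measurable_rV cK.
have [M M0 hM] := test_function_bounded tp.
have iK : mu.-integrable K (EFin \o u).
  apply/integrableP; split; first by apply/measurable_EFinP; exact: measurable_funS mu_.
  exact: Lu.
have mup : measurable_fun Omega (fun x => u x * phi x).
  by apply: measurable_funM => //; apply: measurable_funTS; exact: test_function_measurable tp.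
apply: (@le_integrable _ _ _ _ _ mO _ (EFin \o (fun x => M * (`|u x| * \1_K x)))).
- exact/measurable_EFinP.
- move=> x Ox; rewrite lee_fin normrM.
  have [xK|xK] := pselect (K x).
    rewrite indicE mem_set// mulr1 [leRHS]ger0_norm ?mulr_ge0// mulrC.
    by rewrite ler_wpM2r.
  have -> : phi x = 0.
    by apply: contrapT => fx; apply: xK; apply: subset_closure; apply/eqP.
  by rewrite normr0 mulr0.
- rewrite (_ : EFin \o _ = fun x => (M%:E * ((EFin \o (Num.norm \o u)) \_ K) x)%E).
    apply: integrableZl => //.
    have : mu.-integrable K (EFin \o (Num.norm \o u)) by exact: integrable_norm.
    move=> /(integrable_mkcond _ mK) h; apply: integrableS h => //.
  apply/funext => x /=; rewrite patchE indicE; case: ifPn => xK.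
    by rewrite mulr1 EFinM.
  by rewrite mulr0 mulr0 mule0.
Qed.

End test_functions.

(** * Fundamental lemma of the calculus of variations *)

Section dominated.
Context d (T : measurableType d) (R : realType).
Variables (mu : {measure set T -> \bar R}) (D : set T).

Lemma Rintegral_dominated_cvg (f_ : nat -> T -> R) (f g : T -> R) :
  measurable D -> (forall n, measurable_fun D (f_ n)) -> measurable_fun D f ->
  (forall x, D x -> f_ n x @[n --> \oo] --> f x) ->
  mu.-integrable D (EFin \o g) ->
  (forall n x, D x -> `|f_ n x| <= g x) ->
  mu.-integrable D (EFin \o f) /\
  \int[mu]_(x in D) f_ n x @[n --> \oo] --> \int[mu]_(x in D) f x.
Proof.
move=> mD mf_ mf cf ig fg.
have [|||||h1 _ h3] := @dominated_convergence _ _ _ mu D mD (fun n => EFin \o f_ n) (EFin \o f) (EFin \o g).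
- by move=> n; exact/measurable_EFinP.
- exact/measurable_EFinP.
- by apply: aeW => x Dx; apply/fine_cvgP; split; [exact: nearW|exact: cf].
- exact: ig.
- by apply: aeW => x n Dx; rewrite lee_fin; exact: fg.
split => //; rewrite /Rintegral.
by apply: fine_cvg; rewrite fineK//; exact: integrable_fin_num.
Qed.
End dominated.

Section fundamental_lemma.
Context {R : realType} {N : nat}.
Implicit Types (Omega : set 'rV[R]_N) (a b x : 'rV[R]_N) (g : 'rV[R]_N -> R).
Local Notation mu := (@lebesgue_measure_rV R N).

(** Each factor is flat 0 at n.+1 times the signed distance to a face, and tends
to 1 on the inner side of that face: the bumps tend to the indicator function
of the open box. *)
Definition box_bump a b (n : nat) x : R :=
  \prod_i (flat 0 (n.+1%:R * x ord0 i + - (n.+1%:R * a ord0 i)) *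
           flat 0 (- n.+1%:R * x ord0 i + n.+1%:R * b ord0 i)).

Lemma box_bump_smooth a b n : smooth (box_bump a b n).
Proof.
apply: smooth_alg_smooth; rewrite /box_bump.
elim: (index_enum _) => [|i s IH].
  rewrite (_ : (fun _ => _) = fun=> 1); first exact: Alg_cst.
  by apply/funext => x; rewrite big_nil.
rewrite (_ : (fun _ => _) = ((fun x : 'rV[R]_N => flat 0 (n.+1%:R * x ord0 i + - (n.+1%:R * a ord0 i))) \*
   (fun x : 'rV[R]_N => flat 0 (- n.+1%:R * x ord0 i + n.+1%:R * b ord0 i))) \*
   (fun x => \prod_(i <- s) (flat 0 (n.+1%:R * x ord0 i + - (n.+1%:R * a ord0 i)) *
           flat 0 (- n.+1%:R * x ord0 i + n.+1%:R * b ord0 i)))).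
  by apply: Alg_mul => //; apply: Alg_mul; exact: Alg_flat.
by apply/funext => x; rewrite big_cons.
Qed.

Lemma box_bump_out a b n x : ~ open_box a b x -> box_bump a b n x = 0.
Proof.
move=> xab; have [i hi] : exists i, ~~ (a ord0 i < x ord0 i < b ord0 i).
  apply: contrapT => h; apply: xab => i; apply: contrapT => hi; apply: h.
  by exists i; exact/negP.
rewrite /box_bump (bigD1 i)//= negb_and -!leNgt in hi *.
have n0 : 0 < n.+1%:R :> R by [].
case/orP: hi => hi.
  by rewrite (flat_le0 _ (_ : _ + - _ <= 0)) ?mul0r// -mulrBr pmulr_rle0// subr_le0.
by rewrite (flat_le0 _ (_ : - _ * _ + _ <= 0)) ?mulr0 ?mul0r// mulNr addrC -mulrBr pmulr_rle0// subr_le0.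
Qed.

Lemma box_bump_test Omega a b n : closed_box a b `<=` Omega ->
  test_function Omega (box_bump a b n).
Proof.
move=> abO; have sub : closure [set x | box_bump a b n x != 0] `<=` closed_box a b.
  rewrite (closure_id (closed_box a b)).1; last exact: closed_closed_box.
  apply: closureS => x /= fx; apply: sub_open_closed_box.
  by apply: contrapT => /(box_bump_out n) h; rewrite h eqxx in fx.
split; first exact: box_bump_smooth.
  by apply: subclosed_compact sub; [exact: closed_closure|exact: compact_closed_box].
exact: subset_trans sub abO.
Qed.

Lemma box_bump_ge0_le1 a b n x : 0 <= box_bump a b n x <= 1.
Proof.
apply/andP; split; first by apply: prodr_ge0 => i _; rewrite mulr_ge0// flat_ge0.
by apply: prodr_ile1 => i _; rewrite mulr_ge0 ?flat_ge0//= mulr_ile1 ?flat_ge0 ?flat0_le1.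
Qed.

Lemma flat_cvg1 (c : R) : 0 < c -> flat 0 (n.+1%:R * c) @[n --> \oo] --> (1 : R).
Proof.
move=> c0; rewrite (_ : (fun _ => _) = fun n => expR (- (c^-1 * n.+1%:R^-1))).
  suff : expR (- (c^-1 * n.+1%:R^-1)) @[n --> \oo] --> expR (- (c^-1 * 0)).
    by rewrite mulr0 oppr0 expR0.
  apply: continuous_cvg; first exact: continuous_expR.
  by apply: cvgN; apply: cvgM; [exact: cvg_cst|exact: cvg_harmonic].
apply/funext => n; rewrite /flat ifT ?mulr_gt0// expr0 mul1r invfM.
by rewrite mulrC.
Qed.

Lemma box_bump_cvg a b x : box_bump a b n x @[n --> \oo] --> (\1_(open_box a b) x : R).
Proof.
have [xab|xab] := pselect (open_box a b x); last first.
  rewrite indicE memNset//.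
  by under eq_fun do rewrite box_bump_out//; exact: cvg_cst.
rewrite indicE mem_set// -[X in _ --> X](_ : \prod_(i < N) (1 * 1 : R) = _); last first.
  by rewrite big1// => i _; rewrite mulr1.
apply: cvg_big => [|i _].
  by move=> [s t]; exact: mul_continuous.
have /andP[h1 h2] := xab i.
apply: cvgM.
  by under eq_fun do rewrite -mulrBr; apply: flat_cvg1; rewrite subr_gt0.
by under eq_fun do rewrite mulNr addrC -mulrBr; apply: flat_cvg1; rewrite subr_gt0.
Qed.

(** Dominated convergence along the bumps of the box, which are test functions
because the closed box lies in Omega. *)
Lemma integral_box_eq0 Omega g a b : open Omega -> locally_integrable_on Omega g ->
  (forall phi, test_function Omega phi -> \int[mu]_(x in Omega) (g x * phi x) = 0) ->
  closed_box a b `<=` Omega -> (\int[mu]_(x in open_box a b) (g x)%:E = 0)%E.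
Proof.
move=> oO [mg Lg] g0 abO; have mO := open_measurable_rV oO.
have mC : measurable (closed_box a b) by apply: closed_measurable_rV; exact: closed_closed_box.
have mB : measurable (open_box a b).
  by rewrite measurable_rV_box; apply: sub_sigma_algebra; exists a, b.
have iC : mu.-integrable (closed_box a b) (EFin \o g).
  apply/integrableP; split; first by apply/measurable_EFinP; exact: measurable_funS mg.
  by apply: Lg => //; exact: compact_closed_box.
have [|||||] := @Rintegral_dominated_cvg _ _ _ mu (closed_box a b) (fun n x => g x * box_bump a b n x)
   (fun x => g x * \1_(open_box a b) x) (fun x => `|g x|) mC.
- move=> n; apply: measurable_funM; first exact: measurable_funS mg.
  by apply: measurable_funTS; apply: (@test_function_measurable _ _ Omega); exact: box_bump_test.
- apply: measurable_funM; first exact: measurable_funS mg.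
  exact: measurable_indic.
- by move=> x _; apply: cvgM; [exact: cvg_cst|exact: box_bump_cvg].
- exact: integrable_norm.
- move=> n x _; have /andP[h0 h1] := box_bump_ge0_le1 a b n x.
  by rewrite normrM ler_piMr// ger0_norm.
- move=> i1.
  have -> : (fun n => \int[mu]_(x in closed_box a b) (g x * box_bump a b n x)) = fun=> 0.
    apply/funext => n; rewrite -[RHS](g0 (box_bump a b n)); last exact: box_bump_test.
    rewrite Rintegral_mkcond [RHS]Rintegral_mkcond; apply: eq_Rintegral => x _.
    rewrite !patchE; case: ifPn => xC; first by rewrite (mem_set (abO _ (set_mem xC))).
    rewrite box_bump_out ?mulr0; first by case: ifP.
    by move/sub_open_closed_box => h; rewrite mem_set in xC.
  move=> c0; have E : \int[mu]_(x in closed_box a b) (g x * \1_(open_box a b) x) = 0.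
    exact: cvg_unique c0 (cvg_cst _).
  have <- : (\int[mu]_(x in closed_box a b) (g x * \1_(open_box a b) x)%:E = 0)%E.
    by rewrite -[LHS]fineK ?integrable_fin_num//; move: E; rewrite /Rintegral => ->.
  rewrite [LHS]integral_mkcond [RHS]integral_mkcond; apply: eq_integral => x _.
  rewrite !patchE indicE; case: ifPn => xB; case: ifPn => xC.
  + by rewrite mulr1.
  + by move: xC; rewrite mem_set//; apply: sub_open_closed_box; exact: set_mem.
  + by rewrite mulr0.
  + by [].
Qed.

(** The integral of g vanishes on all sub-boxes, hence, by Dynkin's theorem, on
all measurable subsets of the box. *)
Lemma open_box_ae0 Omega g a b : open Omega -> locally_integrable_on Omega g ->
  (forall phi, test_function Omega phi -> \int[mu]_(x in Omega) (g x * phi x) = 0) ->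
  closed_box a b `<=` Omega -> {ae mu, forall x, open_box a b x -> g x = 0}.
Proof.
move=> oO Lg g0 abO.
have mB c d : measurable (open_box c d : set 'rV[R]_N).
  by rewrite measurable_rV_box; apply: sub_sigma_algebra; exists c, d.
have iB : mu.-integrable (open_box a b) (EFin \o g).
  have [mg lg] := Lg; apply/integrableP; split.
    apply/measurable_EFinP; apply: measurable_funS mg; first exact: open_measurable_rV.
    by apply: subset_trans abO; exact: sub_open_closed_box.
  have := lg _ abO (@compact_closed_box _ _ a b); apply: le_lt_trans.
  apply: ge0_subset_integral => //.
  - by apply: closed_measurable_rV; exact: closed_closed_box.
  - apply/measurable_EFinP; apply: measurableT_comp => //.
    by apply: measurable_funS mg => //; exact: open_measurable_rV.
  - exact: sub_open_closed_box.
have key S : measurable S -> (\int[mu]_(x in S `&` open_box a b) (g x)%:E = 0)%E.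
  rewrite measurable_rV_box.
  apply: (@dynkin_induction _ _ _ (fun S : set 'rV[R]_N =>
    (\int[mu]_(x in S `&` open_box a b) (g x)%:E = 0)%E) measurable_rV_box) => {S}.
  - exact: box_setI.
  - by rewrite setTI; exact: integral_box_eq0 abO.
  - move=> _ [c [d ->]].
    rewrite open_boxI.
    apply: integral_box_eq0 oO Lg g0 _ => x h; apply: abO => i.
    have := h i; rewrite !mxE ge_max le_min => /andP[/andP[? ?]/andP[? ?]]; exact/andP.
  - move=> S mS S0.
    have : (\int[mu]_(x in open_box a b) (g x)%:E = 0)%E by exact: integral_box_eq0 abO.
    rewrite -{1}(setTI (open_box a b)) -(setUv S) setIUl.
    rewrite integral_setU//; first by rewrite S0 add0e.
    + exact: measurableI.
    + by apply: measurableI => //; exact: measurableC.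
    + rewrite -setIUl setUv setTI; exact: measurable_int iB.
    + by apply/disj_setPS => x [[Sx _] [nSx _]].
  - move=> F mF tF F0; rewrite setI_bigcupl integral_bigcup.
    + by apply: eseries0 => i _ _; exact: F0.
    + by apply: trivIset_setIr.
    + by move=> k; exact: measurableI.
    + apply: integrableS iB => //; last by apply: bigcup_sub => k _; exact: subIsetr.
      by apply: bigcup_measurable => k _; exact: measurableI.
have := @integral_ae_eq _ _ _ mu (open_box a b) (mB a b) (cst 0%E) (EFin \o g) iB.
move=> /(_ (measurable_cst _)) h.
have : ae_eq mu (open_box a b) (EFin \o g) (cst 0%E).
  apply: h => E EB mE; rewrite integral0 -(key E mE); congr integral.
  by apply/esym/setIidl.
by apply: filterS => x h' /h' -[].
Qed.

(** Omega is the union of countably many open boxes whose closure it contains. *)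
Lemma fundamental_lemma Omega g : open Omega -> locally_integrable_on Omega g ->
  (forall phi, test_function Omega phi -> \int[mu]_(x in Omega) (g x * phi x) = 0) ->
  {ae mu, forall x, Omega x -> g x = 0}.
Proof.
move=> oO Lg g0.
have key (k : nat) : {ae mu, forall x, forall z, unpickle k = Some z ->
    closed_box (rat_lo z) (rat_hi z) `<=` Omega ->
    open_box (rat_lo z) (rat_hi z) x -> g x = 0}.
  case: (unpickle k) => [z|]; last by apply: aeW.
  have [zO|zO] := pselect (closed_box (@rat_lo R _ z) (rat_hi z) `<=` Omega); last first.
    by apply: aeW => x z' [<-] /zO.
  apply: filterS (open_box_ae0 oO Lg g0 zO) => x h z' [<-] _; exact: h.
have := ae_foralln key; apply: filterS => x h Ox.
have [z zx zO] := open_rational_box oO Ox.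
exact: (h (pickle z) z (pickleK z)).
Qed.
End fundamental_lemma.

(** * Integrable p-th powers *)

Section p_integrable.
Context d (T : measurableType d) (R : realType).
Variables (mu : {measure set T -> \bar R}) (D : set T).
Hypothesis mD : measurable D.
Implicit Types (f g h : T -> R) (p q : R).

Definition p_integrable p f := measurable_fun D f /\
  mu.-integrable D (EFin \o (fun x => `|f x| `^ p)).

(** The p-th power of the L^p norm is used in place of the norm: its quasi
triangle inequality with constant 2^p plays the part of Minkowski's
inequality, and it is a plain real integral. *)
Definition p_energy p f := \int[mu]_(x in D) (`|f x| `^ p).

Lemma p_energy_ge0 p f : 0 <= p_energy p f.
Proof. by apply: Rintegral_ge0 => x _; exact: powR_ge0. Qed.

Lemma measurable_norm_powR p f : measurable_fun D f ->
  measurable_fun D (fun x => `|f x| `^ p).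
Proof.
move=> mf; apply: (measurableT_comp (measurable_powR p)).
exact: measurableT_comp.
Qed.

Lemma integrable_le f g : measurable_fun D f ->
  mu.-integrable D (EFin \o g) -> (forall x, D x -> `|f x| <= g x) ->
  mu.-integrable D (EFin \o f).
Proof.
move=> mf ig fg; apply: (le_integrable mD _ _ ig); first exact/measurable_EFinP.
by move=> x Dx; rewrite lee_fin (le_trans (fg _ Dx))// ler_norm.
Qed.

Lemma integrable_EFinD f g : mu.-integrable D (EFin \o f) ->
  mu.-integrable D (EFin \o g) -> mu.-integrable D (EFin \o (fun x => f x + g x)).
Proof.
move=> iif ig.
rewrite (_ : EFin \o _ = ((EFin \o f) \+ (EFin \o g))%E); last exact/funext.
exact: integrableD.
Qed.

Lemma integrable_EFinZ (c : R) f : mu.-integrable D (EFin \o f) ->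
  mu.-integrable D (EFin \o (fun x => c * f x)).
Proof.
move=> iif.
rewrite (_ : EFin \o _ = fun x => (c%:E * (EFin \o f) x)%E); last exact/funext.
exact: integrableZl.
Qed.

Lemma integrable_cst_fin (c : R) : (mu D < +oo)%E ->
  mu.-integrable D (EFin \o (fun=> c)).
Proof.
move=> muD; apply/integrableP; split; first exact/measurable_EFinP/measurable_cst.
under eq_integral do rewrite /=.
by rewrite integral_cst//= lte_mul_pinfty// lee_fin.
Qed.

Lemma p_integrableD p f g : 0 <= p -> p_integrable p f -> p_integrable p g ->
  p_integrable p (fun x => f x + g x) /\
  p_energy p (fun x => f x + g x) <= 2 `^ p * (p_energy p f + p_energy p g).
Proof.
move=> p0 [mf iif] [mg ig].
have mfg : measurable_fun D (fun x => f x + g x) by exact: measurable_funD.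
have le x : `|f x + g x| `^ p <= 2 `^ p * (`|f x| `^ p + `|g x| `^ p).
  apply: le_trans (powRD_le p0 (normr_ge0 _) (normr_ge0 _)).
  by rewrite ge0_ler_powR// ?nnegrE// ler_normD.
have ir : mu.-integrable D (EFin \o (fun x => 2 `^ p * (`|f x| `^ p + `|g x| `^ p))).
  by apply: integrable_EFinZ; exact: integrable_EFinD.
have il : mu.-integrable D (EFin \o (fun x => `|f x + g x| `^ p)).
  apply: integrable_le ir _; first exact: measurable_norm_powR.
  by move=> x _; rewrite ger0_norm ?powR_ge0.
split => //; rewrite /p_energy -RintegralD// -RintegralZl//; last exact: integrable_EFinD.
by apply: le_Rintegral.
Qed.

Lemma p_integrableZ p c f : p_integrable p f ->
  p_integrable p (fun x => c * f x) /\
  p_energy p (fun x => c * f x) = `|c| `^ p * p_energy p f.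
Proof.
move=> [mf iif]; have e x : `|c * f x| `^ p = `|c| `^ p * `|f x| `^ p.
  by rewrite normrM powRM.
have eE : (fun x => `|c * f x| `^ p) = (fun x => `|c| `^ p * `|f x| `^ p) by exact/funext.
split; last by rewrite /p_energy eE RintegralZl.
by split; [exact: measurable_funM|rewrite eE; exact: integrable_EFinZ].
Qed.

Lemma p_integrableB p f g : 0 <= p -> p_integrable p f -> p_integrable p g ->
  p_integrable p (fun x => f x - g x) /\
  p_energy p (fun x => f x - g x) <= 2 `^ p * (p_energy p f + p_energy p g).
Proof.
move=> p0 hf hg; have [hg' eg] := p_integrableZ (-1) hg.
have [] := p_integrableD p0 hf hg'; rewrite eg normrN1 powR1 mul1r.
by rewrite (_ : (fun x => f x + -1 * g x) = (fun x => f x - g x))//;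
  apply/funext => x; rewrite mulN1r.
Qed.

Lemma p_integrable_bounded p f (M : R) : 0 <= p -> (mu D < +oo)%E -> measurable_fun D f ->
  (forall x, D x -> `|f x| <= M) -> p_integrable p f.
Proof.
move=> p0 muD mf fM; split => //; apply: (@integrable_le _ (fun=> `|M| `^ p)).
- exact: measurable_norm_powR.
- exact: integrable_cst_fin.
- move=> x Dx; rewrite ger0_norm ?powR_ge0// ge0_ler_powR// ?nnegrE//.
  exact: le_trans (fM x Dx) (ler_norm _).
Qed.

Lemma p_integrable_integrable p f : 1 <= p -> (mu D < +oo)%E ->
  p_integrable p f -> mu.-integrable D (EFin \o f).
Proof.
move=> p1 muD [mf iif]; apply: (@integrable_le _ (fun x => 1 + `|f x| `^ p)) => //.
  by apply: integrable_EFinD => //; exact: integrable_cst_fin.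
move=> x Dx; have [h|h] := leP `|f x| 1; first by rewrite (le_trans h)// lerDl powR_ge0.
by rewrite (le_trans (le1r_powR (ltW h) p1))// lerDr.
Qed.

(** This plays the part of Hoelder's inequality: the parameter e lets the first
term be absorbed, and no product of norms appears. *)
Lemma young_integral p q e : 0 < p -> 0 < q -> p^-1 + q^-1 = 1 -> 0 < e ->
  exists2 C, 0 <= C & forall f g, p_integrable p f -> p_integrable q g ->
    mu.-integrable D (EFin \o (fun x => f x * g x)) /\
    `|\int[mu]_(x in D) (f x * g x)| <= e * p_energy p f + C * p_energy q g.
Proof.
move=> p0 q0 pq e0; have [C C0 hC] := young_epsilon p0 q0 pq e0.
exists C => // f g [mf iif] [mg ig].
have mfg : measurable_fun D (fun x => f x * g x) by exact: measurable_funM.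
have le x : `|f x * g x| <= e * `|f x| `^ p + C * `|g x| `^ q.
  by rewrite normrM; exact: hC.
have ir : mu.-integrable D (EFin \o (fun x => e * `|f x| `^ p + C * `|g x| `^ q)).
  by apply: integrable_EFinD; exact: integrable_EFinZ.
have il := integrable_le mfg ir (fun x _ => le x).
split => //; apply: (le_trans (le_normr_Rintegral mD il)).
rewrite /p_energy -!RintegralZl// -RintegralD//; try exact: integrable_EFinZ.
apply: le_Rintegral => //; exact: integrable_norm.
Qed.

Lemma ae_eq_Rintegral f g : measurable_fun D f -> measurable_fun D g ->
  {ae mu, forall x, D x -> f x = g x} -> \int[mu]_(x in D) f x = \int[mu]_(x in D) g x.
Proof.
move=> mf mg fg; rewrite /Rintegral; congr fine; apply: ae_eq_integral => //.
- exact/measurable_EFinP.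
- exact/measurable_EFinP.
- by apply: filterS fg => x h Dx /=; rewrite h.
Qed.

Lemma ae_integrable f g : measurable_fun D g ->
  {ae mu, forall x, D x -> f x = g x} ->
  mu.-integrable D (EFin \o f) -> mu.-integrable D (EFin \o g).
Proof.
move=> mg fg iif; have /measurable_EFinP mf := measurable_int _ iif.
apply/integrableP; split; first exact/measurable_EFinP.
move/integrableP : iif => [_]; apply: le_lt_trans.
rewrite le_eqVlt; apply/orP; left; apply/eqP; apply: ae_eq_integral => //.
- by apply/measurable_EFinP; exact: measurableT_comp.
- by apply/measurable_EFinP; exact: measurableT_comp.
- by apply: filterS fg => x h Dx /=; rewrite h.
Qed.

Lemma ae_p_integrable p f g : measurable_fun D g ->
  {ae mu, forall x, D x -> f x = g x} -> p_integrable p f ->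
  p_integrable p g /\ p_energy p g = p_energy p f.
Proof.
move=> mg fg [mf iif].
have fg' : {ae mu, forall x, D x -> `|f x| `^ p = `|g x| `^ p}.
  by apply: filterS fg => x h Dx; rewrite h.
have mgp := measurable_norm_powR p mg.
split; first by split => //; exact: ae_integrable fg' iif.
by apply/esym/ae_eq_Rintegral => //; exact: measurable_norm_powR.
Qed.

(** Strict upper bounds are compared, rather than values, because they transfer
between the extended real norm and real energies without a case of infinite
norm. *)
Lemma Lnorm_restrict_lt p f e : 0 < p -> 0 < e ->
  ('N[mu]_p%:E [EFin \o (f \_ D)] < e%:E)%E =
  (\int[mu]_(x in D) (`|f x| `^ p)%:E < (e `^ p)%:E)%E.
Proof.
move=> p0 e0.
have E : (\int[mu]_(x in D) (`|f x| `^ p)%:E =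
          'N[mu]_p%:E [EFin \o (f \_ D)] `^ p)%E.
  rewrite (powR_Lnorm _ _ (lt0r_neq0 p0)) [LHS]integral_mkcond.
  apply: eq_integral => x _; rewrite /= !patchE; case: ifP => _; first by [].
  by rewrite -[RHS]/((`|0 : R| `^ p)%:E) normr0 (powR0 (lt0r_neq0 p0)).
rewrite E; have := Lnorm_ge0 mu p%:E (EFin \o (f \_ D)).
move: ('N[mu]__[_])%E => [r| |]//=.
  rewrite lee_fin => r0; rewrite !lte_fin; apply/idP/idP => h.
    by rewrite gt0_ltr_powR// ?nnegrE// ltW.
  rewrite ltNge; apply/negP => er; move: h; rewrite ltNge => /negP; apply.
  by rewrite ge0_ler_powR// ?nnegrE// ltW.
by move=> _; rewrite gt_eqF// ltNge leey// ltNge leey.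
Qed.

Lemma p_integrableP p f : 0 < p -> p_integrable p f <->
  measurable_fun setT (f \_ D) /\ ('N[mu]_p%:E [EFin \o (f \_ D)] < +oo)%E.
Proof.
move=> p0; have -> : ('N[mu]_p%:E [EFin \o (f \_ D)] < +oo)%E <->
    (\int[mu]_(x in D) (`|f x| `^ p)%:E < +oo)%E.
  split => [|].
    have := Lnorm_ge0 mu p%:E (EFin \o (f \_ D)).
    case E : ('N[mu]__[_])%E => [r| |]//= r0 _.
    have r1 : 0 < r + 1 by rewrite ltr_wpDl.
    have : ('N[mu]_p%:E [EFin \o (f \_ D)] < (r + 1)%:E)%E by rewrite E lte_fin ltrDl.
    by rewrite Lnorm_restrict_lt// => /lt_trans; apply; exact: ltry.
  have : (0 <= \int[mu]_(x in D) (`|f x| `^ p)%:E)%E.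
    by apply: integral_ge0 => x _; rewrite lee_fin powR_ge0.
  case E : (\int[mu]_(x in D) _)%E => [r| |]//= r0 _.
  have r1 : 0 < r + 1 by rewrite ltr_wpDl.
  have e0 : 0 < (r + 1) `^ p^-1 by rewrite powR_gt0.
  have : ('N[mu]_p%:E [EFin \o (f \_ D)] < ((r + 1) `^ p^-1)%:E)%E.
    by rewrite Lnorm_restrict_lt// E lte_fin -powRrM mulVf ?gt_eqF// powRr1 ?ltrDl// ltW.
  by move=> /lt_trans; apply; exact: ltry.
rewrite -measurable_restrictT//; split => [[mf /integrableP[_ h]]|[mf h]].
  split => //; apply: le_lt_trans h; apply: ge0_le_integral => //.
  - by apply/measurable_EFinP; exact: measurable_norm_powR.
  - by apply: measurableT_comp => //; apply/measurable_EFinP; exact: measurable_norm_powR.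
  - by move=> x _; rewrite lee_fin ler_norm.
split => //; apply/integrableP; split; first by apply/measurable_EFinP; exact: measurable_norm_powR.
apply: le_lt_trans h; rewrite le_eqVlt; apply/orP; left; apply/eqP.
by apply: eq_integral => x _; rewrite /= ger0_norm ?powR_ge0.
Qed.

Lemma Lnorm_restrict_lt_energy p f e : 0 < p -> 0 < e -> p_integrable p f ->
  ('N[mu]_p%:E [EFin \o (f \_ D)] < e%:E)%E = (p_energy p f < e `^ p).
Proof.
move=> p0 e0 [mf iif]; rewrite Lnorm_restrict_lt//.
by rewrite -[X in (X < _)%E]fineK ?lte_fin//; exact: integrable_fin_num.
Qed.

End p_integrable.

(** * Weak derivatives *)

Section continuous_real.
Context {R : realType} {T : topologicalType}.
Implicit Types f g : T -> R.

Lemma continuous_funD f g : continuous f -> continuous g ->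
  continuous (fun x => f x + g x).
Proof. by move=> cf cg x; apply: cvgD; [exact: cf|exact: cg]. Qed.

Lemma continuous_funM f g : continuous f -> continuous g ->
  continuous (fun x => f x * g x).
Proof. by move=> cf cg x; apply: cvgM; [exact: cf|exact: cg]. Qed.
End continuous_real.

Section weak_derivatives.
Context {R : realType} {N : nat}.
Variable Omega : set 'rV[R]_N.
Hypothesis oO : open Omega.
Implicit Types (u v g h phi : 'rV[R]_N -> R) (i : 'I_N).
Local Notation mu := (@lebesgue_measure_rV R N).

Let mO : measurable Omega. Proof. exact: open_measurable_rV. Qed.

Lemma locally_integrableB u v : locally_integrable_on Omega u ->
  locally_integrable_on Omega v -> locally_integrable_on Omega (u \- v).
Proof.
move=> [m_u iu] [mv iv]; split; first exact: measurable_funB.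
move=> K KO cK; have mK := compact_measurable_rV cK.
have h (w : 'rV[R]_N -> R) : measurable_fun Omega w -> (\int[mu]_(x in K) `|w x|%:E < +oo)%E ->
    mu.-integrable K (EFin \o w).
  move=> mw iw; apply/integrableP; split => //.
  by apply/measurable_EFinP; exact: measurable_funS mw.
have : mu.-integrable K ((EFin \o u) \- (EFin \o v))%E.
  by apply: integrableB => //; apply: h => //; [exact: iu|exact: iv].
by move=> /integrableP[_].
Qed.

Lemma weak_partial_spec i u g : is_weak_partial Omega i u g ->
  is_weak_partial Omega i u (weak_partial Omega i u).
Proof. by move=> h; apply: (@getPex _ (is_weak_partial Omega i u)); exists g. Qed.

Lemma weak_partial_unique i u g h : is_weak_partial Omega i u g ->
  is_weak_partial Omega i u h -> {ae mu, forall x, Omega x -> g x = h x}.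
Proof.
move=> [_ lg gP] [_ lh hP].
have gh0 : {ae mu, forall x, Omega x -> (g \- h) x = 0}.
  apply: (fundamental_lemma oO (locally_integrableB lg lh)) => phi tp.
  have -> : (fun x => (g \- h) x * phi x) = (fun x => g x * phi x - h x * phi x).
    by apply/funext => x /=; rewrite mulrBl.
  rewrite RintegralB//; try exact: integrable_locally_test.
  by have := hP _ tp; rewrite (gP _ tp) => /oppr_inj ->; rewrite subrr.
by apply: filterS gh0 => x H /H /eqP; rewrite subr_eq0 => /eqP.
Qed.

Lemma weak_partial_ae i u g : is_weak_partial Omega i u g ->
  {ae mu, forall x, Omega x -> weak_partial Omega i u x = g x}.
Proof. by move=> ug; exact: weak_partial_unique (weak_partial_spec ug) ug. Qed.

Lemma is_weak_partialB i u v g h : is_weak_partial Omega i u g ->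
  is_weak_partial Omega i v h -> is_weak_partial Omega i (u \- v) (g \- h).
Proof.
move=> [lu lg gP] [lv lh hP]; split; [exact: locally_integrableB..|].
move=> phi tp; have tdp := test_function_partial i tp.
have -> : (fun x => (g \- h) x * phi x) = (fun x => g x * phi x - h x * phi x).
  by apply/funext => x /=; rewrite mulrBl.
have -> : (fun x => (u \- v) x * partial i phi x) = (fun x => u x * partial i phi x - v x * partial i phi x).
  by apply/funext => x /=; rewrite mulrBl.
rewrite !RintegralB//; try exact: integrable_locally_test.
by rewrite gP// hP// opprB opprK addrC.
Qed.

(** The product u v extends by 0 from Omega to the whole space, where the
integral of its partial derivative vanishes. *)
Lemma integration_by_parts_test i u v : test_function Omega u -> test_function Omega v ->
  \int[mu]_(x in Omega) (u x * partial i v x + partial i u x * v x) = 0.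
Proof.
move=> tu tv; have su := test_smooth tu; have sv := test_smooth tv.
have [M M0 hM] := test_function_box tu.
have [M' M'0 hM'] := test_function_box (test_function_partial i tu).
(* A single box outside of which both u and its derivative vanish. *)
pose L := Num.max M M'.
have sub m : m <= L -> open_box (const_mx (- m)) (const_mx m) `<=`
    (open_box (const_mx (- L)) (const_mx L) : set 'rV[R]_N).
  move=> mL x h j; have := h j; rewrite !mxE; move: mL; move: (x ord0 j) => y; lra.
have u0 x : ~ open_box (const_mx (- L)) (const_mx L) x -> u x = 0.
  by move=> h; apply: hM => /(sub M); rewrite le_max lexx => /(_ erefl).
have du0 x : ~ open_box (const_mx (- L)) (const_mx L) x -> partial i u x = 0.
  by move=> h; apply: hM' => /(sub M'); rewrite le_max lexx orbT => /(_ erefl).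
have L0 : 0 < L by rewrite lt_max M0.
have E := @integral_partial_eq0 R N i (u \* v) (fun x => u x * partial i v x + partial i u x * v x) L L0.
rewrite Rintegral_mkcond /Rintegral.
rewrite (_ : \int[mu]_x _ = 0)%E// -[RHS]E.
- apply: eq_integral => x _; rewrite patchE; case: ifPn => // /negP xO.
  have nO : ~ Omega x by move=> Ox; apply: xO; exact: mem_set.
  by rewrite (test_function_out tu nO) (test_function_out tv nO) mul0r mulr0 addr0.
- move=> x; apply: is_derive_eq (is_deriveM (smooth_is_derive i x su) (smooth_is_derive i x sv)) _.
  by rewrite /GRing.scale/= [partial i u x * _]mulrC.
- apply: continuous_funD; apply: continuous_funM; apply: smooth_continuous => //;
    exact: smooth_partial.
- by move=> x xL; rewrite /= (u0 _ xL) mul0r.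
- by move=> x h; rewrite u0// du0// !mul0r addr0.
Qed.

End weak_derivatives.

(** * The closure of the test functions *)

Section small_combinations.
Context {R : realType}.
Implicit Types (k a b e s t x : R).

(** The tolerance e / (k (a + b) + 1) for two errors s and t that enter an
estimate through k (a s + b t); the summand 1 covers k (a + b) = 0. *)
Lemma lincomb_lt k a b e s t : 0 <= k -> 0 <= a -> 0 <= b -> 0 < e ->
  s < e / (k * (a + b) + 1) -> t < e / (k * (a + b) + 1) ->
  k * (a * s + b * t) < e.
Proof.
move=> k0 a0 b0 e0; set c := _ + 1 => sc tc.
have c0 : 0 < c by rewrite ltr_wpDl// mulr_ge0// addr_ge0.
have ce : c * (e / c) = e by rewrite mulrC mulfVK// gt_eqF.
have d0 : 0 < e / c by rewrite divr_gt0.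
move: (e / c) => d in sc tc ce d0 *.
have h1 : a * s <= a * d by rewrite ler_wpM2l// ltW.
have h2 : b * t <= b * d by rewrite ler_wpM2l// ltW.
have : k * (a * s + b * t) <= k * (a * d + b * d) by rewrite ler_wpM2l// lerD.
move=> /le_lt_trans; apply; rewrite -mulrDl mulrA -ce.
by rewrite ltr_pM2r// /c ltrDl.
Qed.

Lemma div_succ_mul_le e x : 0 <= x -> 0 < e -> e / (x + 1) * x <= e.
Proof.
move=> x0 e0; have x1 : 0 < x + 1 by rewrite ltr_wpDl.
by rewrite mulrAC ler_pdivrMr// ler_pM2l// lerDl.
Qed.
End small_combinations.

Section sobolev0.
Context {R : realType} {N : nat}.
Variable Omega : set 'rV[R]_N.
Hypotheses (oO : open Omega) (bO : bounded_set Omega).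
Variable p : R.
Hypothesis p1 : 1 < p.
Implicit Types (u v f phi : 'rV[R]_N -> R) (g h : 'I_N -> 'rV[R]_N -> R) (i : 'I_N).
Local Notation mu := (@lebesgue_measure_rV R N).
Local Notation inLp := (p_integrable mu Omega p).
Local Notation energy := (p_energy mu Omega p).

Let p0 : 0 < p. Proof. exact: lt_trans p1. Qed.
Let mO : measurable Omega. Proof. exact: open_measurable_rV. Qed.
Let muO : (mu Omega < +oo)%E. Proof. exact: bounded_finite_measure. Qed.

Lemma LpP r f : 0 < r -> Lp Omega r f <-> p_integrable mu Omega r f.
Proof.
move=> r0; rewrite p_integrableP// /Lp/=; split.
  by rewrite inE => /andP[]; rewrite !inE.
by move=> [h1 h2]; rewrite inE; apply/andP; rewrite !inE.
Qed.

Lemma test_p_integrable r phi : 0 <= r -> test_function Omega phi -> p_integrable mu Omega r phi.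
Proof.
move=> r0 tp; have [M _ hM] := test_function_bounded tp.
apply: (@p_integrable_bounded _ _ _ _ _ mO _ _ M) => //.
by apply: measurable_funTS; exact: test_function_measurable tp.
Qed.

Lemma Lp_locally_integrable f : inLp f -> locally_integrable_on Omega f.
Proof.
move=> Lf; have iF := p_integrable_integrable mO (ltW p1) muO Lf.
split; first by case: Lf.
move=> K KO cK; have : mu.-integrable K (EFin \o f).
  by apply: integrableS iF => //; exact: compact_measurable_rV.
by move=> /integrableP[].
Qed.

(** The pair (u, g) belongs to the closure of the pairs (phi, gradient of phi)
over test functions phi. Carrying g as data makes linear combinations and
limits immediate, while weak_partial only determines a derivative up to a
null set. *)
Definition sobolev0 u g := [/\ inLp u, forall i, inLp (g i) &
  forall e : R, 0 < e -> exists2 phi, test_function Omega phi &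
    energy (u \- phi) < e /\ forall i, energy (g i \- partial i phi) < e].

Lemma sobolev0_test phi : test_function Omega phi -> sobolev0 phi (partial^~ phi).
Proof.
move=> tp; split => [|i|e e0].
- by apply: test_p_integrable => //; exact: ltW.
- by apply: test_p_integrable; [exact: ltW|exact: test_function_partial].
- have z w : energy (w \- w) < e.
    rewrite (_ : w \- w = fun x => 0 * w x); last first.
      by apply/funext => x /=; rewrite subrr mul0r.
    rewrite /p_energy (_ : (fun _ => _) = fun=> 0) ?Rintegral_cst//; first by rewrite mul0r.
    by apply/funext => x; rewrite mul0r normr0 (powR0 (lt0r_neq0 p0)).
  by exists phi => //; split => [|i]; exact: z.
Qed.

Lemma energyD u v : inLp u -> inLp v -> inLp (u \+ v) /\
  energy (u \+ v) <= 2 `^ p * (energy u + energy v).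
Proof. exact: (p_integrableD mO (ltW p0)). Qed.

Lemma energyB u v : inLp u -> inLp v -> inLp (u \- v) /\
  energy (u \- v) <= 2 `^ p * (energy u + energy v).
Proof. exact: (p_integrableB mO (ltW p0)). Qed.

Lemma sobolev0_lincomb u v g h (a b : R) : sobolev0 u g -> sobolev0 v h ->
  sobolev0 (fun x => a * u x + b * v x) (fun i x => a * g i x + b * h i x).
Proof.
have lin w z : inLp w -> inLp z -> inLp (fun x => a * w x + b * z x) /\
  energy (fun x => a * w x + b * z x) <=
    2 `^ p * (`|a| `^ p * energy w + `|b| `^ p * energy z).
  move=> Lw Lz; have [Lw' Ew] := p_integrableZ mO a Lw; have [Lz' Ez] := p_integrableZ mO b Lz.
  by have [L E] := energyD Lw' Lz'; rewrite -Ew -Ez.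
move=> [Lu Lg ug] [Lv Lh vh]; split => [|i|e e0].
- by have [] := lin _ _ Lu Lv.
- by have [] := lin _ _ (Lg i) (Lh i).
pose c := 2 `^ p * (`|a| `^ p + `|b| `^ p) + 1.
have c0 : 0 < c by rewrite ltr_wpDl// mulr_ge0 ?addr_ge0 ?powR_ge0.
have [phi tp [up gp]] := ug (e / c) (divr_gt0 e0 c0).
have [psi ts [vs hs]] := vh (e / c) (divr_gt0 e0 c0).
have bnd w z s t : inLp w -> inLp z -> inLp s -> inLp t ->
    energy (w \- s) < e / c -> energy (z \- t) < e / c ->
    energy ((fun x => a * w x + b * z x) \- (fun x => a * s x + b * t x)) < e.
  move=> Lw Lz Ls Lt Ews Ezt.
  have [_] := lin _ _ (proj1 (energyB Lw Ls)) (proj1 (energyB Lz Lt)).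
  rewrite (_ : (fun x => a * (w \- s) x + b * (z \- t) x) =
    (fun x => a * w x + b * z x) \- (fun x => a * s x + b * t x)); last first.
    by apply/funext => x /=; ring.
  move=> h'; apply: le_lt_trans h' _.
  exact: lincomb_lt (powR_ge0 _ _) (powR_ge0 _ _) (powR_ge0 _ _) e0 Ews Ezt.
exists ((fun x => a * phi x) \+ (fun x => b * psi x)).
  by apply: test_functionD; exact: test_functionZ.
have Lphi := test_p_integrable (ltW p0) tp; have Lpsi := test_p_integrable (ltW p0) ts.
split => [|i]; first exact: (bnd _ _ _ _ Lu Lv Lphi Lpsi up vs).
have sp := test_smooth tp; have ss := test_smooth ts.
rewrite partialD; [|exact: smoothZ..]; rewrite !partialZ//.
have Ldphi := test_p_integrable (ltW p0) (test_function_partial i tp).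
have Ldpsi := test_p_integrable (ltW p0) (test_function_partial i ts).
exact: (bnd _ _ _ _ (Lg i) (Lh i) Ldphi Ldpsi (gp i) (hs i)).
Qed.

Lemma sobolev0B u v g h : sobolev0 u g -> sobolev0 v h ->
  sobolev0 (u \- v) (fun i => g i \- h i).
Proof.
move=> ug vh; have := sobolev0_lincomb 1 (-1) ug vh.
rewrite (_ : (fun x => 1 * u x + -1 * v x) = u \- v); last first.
  by apply/funext => x; rewrite mul1r mulN1r.
rewrite (_ : (fun i x => 1 * g i x + -1 * h i x) = fun i => g i \- h i)//.
by apply/funext => i; apply/funext => x; rewrite mul1r mulN1r.
Qed.

(** An approximation of an approximation; c accounts for the constant 2^p of the
quasi triangle inequality. *)
Lemma sobolev0_closed u g :
  inLp u -> (forall i, inLp (g i)) ->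
  (forall e, 0 < e -> exists v h, [/\ sobolev0 v h, energy (u \- v) < e &
    forall i, energy (g i \- h i) < e]) ->
  sobolev0 u g.
Proof.
move=> Lu Lg ap; split => // e e0.
pose c : R := 2 `^ p * (1 + 1) + 1.
have c0 : 0 < c by rewrite ltr_wpDl// mulr_ge0 ?powR_ge0.
have [v [h [[Lv Lh vh] Eu Eg]]] := ap (e / c) (divr_gt0 e0 c0).
have [phi tp [vp hp]] := vh (e / c) (divr_gt0 e0 c0).
have bnd w z s : inLp w -> inLp z -> inLp s -> energy (w \- z) < e / c ->
    energy (z \- s) < e / c -> energy (w \- s) < e.
  move=> Lw Lz Ls E1 E2.
  have [_] := energyD (proj1 (energyB Lw Lz)) (proj1 (energyB Lz Ls)).
  rewrite (_ : (w \- z) \+ (z \- s) = w \- s); last first.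
    by apply/funext => x /=; ring.
  move=> h'; apply: le_lt_trans h' _.
  by have := lincomb_lt (powR_ge0 2 p) ler01 ler01 e0 E1 E2; rewrite !mul1r.
exists phi => //; split => [|i].
  by apply: bnd Eu vp => //; exact: test_p_integrable (ltW p0) tp.
apply: bnd (Eg i) (hp i) => //.
by apply: test_p_integrable (ltW p0) _; exact: test_function_partial.
Qed.

(** Integration by parts holds for the approximating test functions w. In the two
error terms, Young's inequality is applied with a weight fixed by the
energies of phi and of its derivative, and then w is chosen according to the
resulting constant. *)
Lemma sobolev0_weak_partial u g i : sobolev0 u g -> is_weak_partial Omega i u (g i).
Proof.
move=> [Lu Lg ug]; split; [exact: Lp_locally_integrable..|] => phi tp.
have tdp := test_function_partial i tp.
pose q := p / (p - 1).
have q0 : 0 < q by rewrite divr_gt0// subr_gt0.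
have qp : q^-1 + p^-1 = 1 by rewrite /q; field; rewrite lt0r_neq0//= subr_eq0 gt_eqF.
set A := \int[mu]_(x in Omega) (partial i phi x * u x).
set B := \int[mu]_(x in Omega) (phi x * g i x).
have -> : \int[mu]_(x in Omega) (u x * partial i phi x) = A.
  by apply: eq_Rintegral => x _; rewrite mulrC.
have -> : \int[mu]_(x in Omega) (g i x * phi x) = B.
  by apply: eq_Rintegral => x _; rewrite mulrC.
have Lq w : test_function Omega w -> p_integrable mu Omega q w.
  by apply: test_p_integrable; exact: ltW.
suff : `|A + B| <= 0 by rewrite normr_le0 addr_eq0 => /eqP.
(* The weight e / 2 / c makes the contribution of these energies at most e / 2. *)
pose c := p_energy mu Omega q (partial i phi) + p_energy mu Omega q phi + 1.
have c0 : 0 < c by rewrite ltr_wpDl// addr_ge0// p_energy_ge0.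
apply/ler_addgt0Pl => e e0; rewrite addr0.
have e2' : 0 < e / 2 by rewrite divr_gt0.
have [C C0 hC] := young_integral mu mO q0 p0 qp (divr_gt0 e2' c0).
have D0 : 0 < C * (1 + 1) + 1 by rewrite ltr_wpDl// mulr_ge0.
have e2 : 0 < e / 2 / (C * (1 + 1) + 1) by rewrite divr_gt0.
have [w tw [uw gw]] := ug _ e2.
have tdw := test_function_partial i tw.
have Lw := test_p_integrable (ltW p0) tw; have Ldw := test_p_integrable (ltW p0) tdw.
have [i1 E1] := hC _ _ (Lq _ tdp) (proj1 (energyB Lu Lw)).
have [i2 E2] := hC _ _ (Lq _ tp) (proj1 (energyB (Lg i) Ldw)).
have [iA _] := hC _ _ (Lq _ tdp) Lu; have [iB _] := hC _ _ (Lq _ tp) (Lg i).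
have [iA' _] := hC _ _ (Lq _ tdp) Lw; have [iB' _] := hC _ _ (Lq _ tp) Ldw.
have P0 := integration_by_parts_test i tp tw.
have -> : A + B = \int[mu]_(x in Omega) (partial i phi x * (u \- w) x) +
                 \int[mu]_(x in Omega) (phi x * (g i \- partial i w) x).
  have -> : \int[mu]_(x in Omega) (partial i phi x * (u \- w) x) =
     A - \int[mu]_(x in Omega) (partial i phi x * w x).
    by rewrite -RintegralB//; apply: eq_Rintegral => x _; rewrite mulrBr.
  have -> : \int[mu]_(x in Omega) (phi x * (g i \- partial i w) x) =
     B - \int[mu]_(x in Omega) (phi x * partial i w x).
    by rewrite -RintegralB//; apply: eq_Rintegral => x _; rewrite mulrBr.
  move: P0; rewrite RintegralD// => P0; rewrite addrACA -opprD.
  by rewrite [X in _ - X]addrC P0 subr0.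
apply: le_trans (ler_normD _ _) _.
apply: le_trans (lerD E1 E2) _.
rewrite addrACA -!mulrDr [leRHS](splitr e); apply: lerD.
  by apply: div_succ_mul_le => //; apply: addr_ge0; exact: p_energy_ge0.
by have := lincomb_lt C0 ler01 ler01 e2' uw (gw i); rewrite !mul1r => /ltW.
Qed.

Lemma sobolev0_W1p u g : sobolev0 u g -> W1p Omega p u.
Proof.
move=> ug; have [Lu Lg _] := ug; split; first exact/LpP.
by move=> i; exists (g i); [exact/LpP|exact: sobolev0_weak_partial].
Qed.

(** W1p_norm is computed from the chosen weak derivatives of u - phi; by
uniqueness they agree almost everywhere with g i - partial i phi, whose
energy is small. *)
Lemma sobolev0_W1p0 u g : sobolev0 u g -> W1p0 Omega p u.
Proof.
move=> ug; have [Lu Lg ap] := ug; split; first exact: sobolev0_W1p ug.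
(* Each of the N + 1 norms gets the share e / 2 / (N + 1); the factor 1/2 makes
the final bound strict. *)
move=> e e0; pose c : R := N.+1%:R.
have c0 : 0 < c by rewrite ltr0n.
have ec : 0 < e / 2 / c by rewrite !divr_gt0.
have ec' : 0 < (e / 2 / c) `^ p by rewrite powR_gt0.
have [phi tp [uphi gphi]] := ap _ ec'; exists phi => //.
have Lphi := test_p_integrable (ltW p0) tp.
have tdphi i := test_function_partial i tp.
have Ldphi i := test_p_integrable (ltW p0) (tdphi i).
have ug' := sobolev0_lincomb 1 (-1) ug (sobolev0_test tp).
have weak i : is_weak_partial Omega i (u \- phi) (g i \- partial i phi).
  exact: is_weak_partialB oO _ _ _ _ _ (sobolev0_weak_partial i ug) (sobolev0_weak_partial i (sobolev0_test tp)).
have wL i : inLp (weak_partial Omega i (u \- phi)) /\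
    energy (weak_partial Omega i (u \- phi)) = energy (g i \- partial i phi).
  apply: ae_p_integrable => //.
  - by have [_ []] := weak_partial_spec (weak i).
  - by apply: filterS (weak_partial_ae oO (weak i)) => x h Ox; rewrite h.
  - exact: (proj1 (energyB (Lg i) (Ldphi i))).
rewrite /W1p_norm.
have n0 : ('N[mu]_p%:E [EFin \o (u \- phi)%R \_ Omega] < (e / 2 / c)%:E)%E.
  by rewrite (Lnorm_restrict_lt_energy mO p0 ec (proj1 (energyB Lu Lphi))).
have ni i : ('N[mu]_p%:E [EFin \o weak_partial Omega i (u \- phi)%R \_ Omega] < (e / 2 / c)%:E)%E.
  have [wL1 wL2] := wL i.
  by rewrite (Lnorm_restrict_lt_energy mO p0 ec wL1) wL2; exact: gphi.
apply: (@le_lt_trans _ _ ((e / 2 / c)%:E + \sum_(i < N) (e / 2 / c)%:E)%E).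
  by apply: leeD; [exact/ltW|apply: lee_sum => i _; exact/ltW].
rewrite sumEFin -EFinD lte_fin sumr_const card_ord -[X in X + _]mulr1n -mulrnDr add1n.
by rewrite -[_ *+ N.+1]mulr_natr -/c (mulfVK (lt0r_neq0 c0)) ltr_pdivrMr// mulr_natr mulr2n ltrDl.
Qed.

Lemma W1p0_sobolev0 u : W1p0 Omega p u -> sobolev0 u (weak_partial Omega ^~ u).
Proof.
move=> [[/(LpP _ p0) Lu wu] ap].
have wP i : is_weak_partial Omega i u (weak_partial Omega i u).
  by have [g _ /weak_partial_spec] := wu i.
have Lw i : inLp (weak_partial Omega i u).
  have [g /(LpP _ p0) Lg ug] := wu i.
  have [_ [mw _] _] := wP i.
  apply: (proj1 (ae_p_integrable mO mw _ Lg)).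
  by apply: filterS (weak_partial_ae oO ug) => x h Ox; rewrite h.
split => // e e0.
have e1 : 0 < e `^ p^-1 by rewrite powR_gt0.
have [phi tp nphi] := ap _ e1; exists phi => //.
have tdphi i := test_function_partial i tp.
have Lphi := test_p_integrable (ltW p0) tp.
have Ldphi i := test_p_integrable (ltW p0) (tdphi i).
have eE : (e `^ p^-1) `^ p = e by rewrite -powRrM mulVf ?gt_eqF// powRr1// ltW.
have weak i : is_weak_partial Omega i (u \- phi) (weak_partial Omega i u \- partial i phi).
  exact: is_weak_partialB oO _ _ _ _ _ (wP i) (sobolev0_weak_partial i (sobolev0_test tp)).
have wL i : inLp (weak_partial Omega i (u \- phi)) /\
    energy (weak_partial Omega i (u \- phi)) = energy (weak_partial Omega i u \- partial i phi).
  apply: ae_p_integrable => //.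
  - by have [_ []] := weak_partial_spec (weak i).
  - by apply: filterS (weak_partial_ae oO (weak i)) => x h Ox; rewrite h.
  - exact: (proj1 (energyB (Lw i) (Ldphi i))).
split => [|i].
  rewrite -[ltRHS]eE -(Lnorm_restrict_lt_energy mO p0 e1).
    apply: le_lt_trans nphi; rewrite leeDl// sume_ge0// => i _; exact: Lnorm_ge0.
  exact: (proj1 (energyB Lu Lphi)).
have [wL1 <-] := wL i.
rewrite -[ltRHS]eE -(Lnorm_restrict_lt_energy mO p0 e1)//.
apply: le_lt_trans nphi; rewrite /W1p_norm (bigD1 i)//= addeCA leeDl// adde_ge0 ?Lnorm_ge0//.
by rewrite sume_ge0// => j _; exact: Lnorm_ge0.
Qed.

Lemma sobolev0_weak_partial_ae u g i : sobolev0 u g ->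
  {ae mu, forall x, Omega x -> weak_partial Omega i u x = g i x}.
Proof.
move=> ug; have H := weak_partial_ae oO (sobolev0_weak_partial i ug).
by apply: filterS H => x h Ox; rewrite h.
Qed.

End sobolev0.

(** * The Poincare inequality *)

Section derivative_norm_powR.
Context {R : realType}.
Implicit Types (p s t x y : R).

Lemma euclid_norm_const1 s : euclid_norm (const_mx s : 'rV[R]_1) = `|s|.
Proof. by rewrite /euclid_norm /dotrV big_ord1 mxE -expr2 sqrtr_sqr. Qed.

(** In dimension 1 the form is |s|^(p-2) s t, so its continuity and its convexity
yield the derivative of |t|^p. *)
Lemma plaplace_form_const1 p s t :
  plaplace_form p (const_mx s : 'rV[R]_1) (const_mx t) = `|s| `^ (p - 2) * (s * t).
Proof. by rewrite /plaplace_form euclid_norm_const1 /dotrV big_ord1 !mxE. Qed.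

Lemma continuous_norm_powR_sub2 p : 1 < p ->
  continuous (fun s : R => `|s| `^ (p - 2) * s).
Proof.
move=> p1 s.
rewrite (_ : (fun s => _) = (fun a => plaplace_form p a (const_mx 1)) \o
    (fun s => const_mx s : 'rV[R]_1)); last first.
  by apply/funext => t /=; rewrite plaplace_form_const1 mulr1.
apply: continuous_comp; last exact: continuous_plaplace_form.
apply/cvg_ballP => e e0; have : nbhs s (ball s e) by exact: nbhsx_ballx.
by apply: filterS => t st; split => // i j; rewrite !mxE.
Qed.

Lemma norm_powR_convex p x y : 1 < p ->
  p * (`|x| `^ (p - 2) * x) * (y - x) <= `|y| `^ p - `|x| `^ p.
Proof.
move=> p1; have := plaplace_form_convex (const_mx x : 'rV[R]_1) (const_mx y) p1.
rewrite (_ : const_mx y - const_mx x = const_mx (y - x)); last by apply/rowP => i; rewrite !mxE.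
by rewrite plaplace_form_const1 !euclid_norm_const1 !mulrA.
Qed.

(** The tangent inequalities at x and at x + h place the first-order remainder
between 0 and p h (d (x + h) - d x), where d t = |t|^(p-2) t is continuous.
This treats all x alike, 0 included. *)
Lemma is_derive_norm_powR p x : 1 < p ->
  is_derive x (1 : R) (fun t => `|t| `^ p) (p * (`|x| `^ (p - 2) * x)).
Proof.
move=> p1; pose d (t : R) := `|t| `^ (p - 2) * t.
apply: (@is_derive_dominated _ _ _ _ _ _ (fun h => p * `|d (h + x) - d x|)).
  move=> h; rewrite [h *: 1]mulr1 -/(d x).
  have h1 := norm_powR_convex x (h + x) p1.
  have h2 := norm_powR_convex (h + x) x p1.
  rewrite -/(d x) addrK in h1; rewrite -/(d _) opprD addrCA subrr addr0 in h2.
  rewrite ger0_norm; last by rewrite subr_ge0 mulrC.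
  apply: (@le_trans _ _ (p * (h * (d (h + x) - d x)))); first by lra.
  rewrite [leRHS]mulrCA ler_pM2l; last lra.
  by rewrite -normrM ler_norm.
have c : d (h + x) @[h --> (0 : R)] --> d x.
  rewrite -[X in _ --> X]/(d x) -[X in d X](add0r x).
  apply: (@continuous_comp _ _ _ (fun h : R => h + x) d).
    by apply: cvgD; [exact: cvg_id|exact: cvg_cst].
  exact: continuous_norm_powR_sub2.
rewrite -[X in _ --> X](mulr0 p) -[X in p * X](@normr0 _ R) -[X in `|X|](subrr (d x)).
apply: cvgM; first exact: cvg_cst.
by apply: cvg_norm; apply: cvgB => //; exact: cvg_cst.
Qed.

Lemma is_derive_comp_real (V : normedModType R) (f : R -> R) (phi : V -> R) (x v : V) (a b : R) :
  is_derive (phi x) (1 : R) f a -> is_derive x v phi b ->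
  is_derive x v (f \o phi) (a * b).
Proof.
move=> df dphi; pose l (h : R) := phi (h *: v + x).
have dl : is_derive (0 : R) (1 : R) l b.
  by apply: is_derive_reparam dphi => h; rewrite /l addr0 [h *: 1]mulr1.
have l0 : l 0 = phi x by rewrite /l scale0r add0r.
rewrite -l0 in df.
apply: (is_derive_reparam _ (is_derive1_comp df dl)) => h.
by rewrite /l /= addr0 [h *: 1]mulr1.
Qed.

End derivative_norm_powR.

Section poincare.
Context {R : realType} {N : nat}.
Variable Omega : set 'rV[R]_N.
Hypotheses (oO : open Omega) (bO : bounded_set Omega).
Variable p : R.
Hypothesis p1 : 1 < p.
Local Notation mu := (@lebesgue_measure_rV R N).
Local Notation energy := (p_energy mu Omega p).

Let p0 : 0 < p. Proof. exact: lt_trans p1. Qed.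
Let mO : measurable Omega. Proof. exact: open_measurable_rV. Qed.

Lemma is_derive_coord (i : 'I_N) (x : 'rV[R]_N) :
  is_derive x (delta_mx ord0 i) (fun y => y ord0 i) (1 : R).
Proof.
apply: (is_derive_reparam _ (is_derive_id (x ord0 i) (1 : R))) => h.
by rewrite !mxE !eqxx.
Qed.

(** The integral of the i-th derivative of x_i |phi|^p vanishes, so the energy of
phi is the opposite of the integral of x_i times the derivative of |phi|^p.
As x_i is bounded on Omega, that integral is at most a multiple of the
integral of |phi|^(p-1) |partial i phi|, and Young's inequality makes it at
most half the energy of phi plus a multiple of that of its derivative. *)
Lemma poincare_test (i : 'I_N) : exists2 C, 0 <= C & forall phi,
  test_function Omega phi -> energy phi <= C * energy (partial i phi).
Proof.
have [M M0 OM] := bounded_sub_box bO.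
pose q := p / (p - 1).
have p10 : 0 < p - 1 by rewrite subr_gt0.
have q0 : 0 < q by rewrite divr_gt0.
have qp : q^-1 + p^-1 = 1 by rewrite /q; field; rewrite lt0r_neq0//= gt_eqF.
have pM0 : 0 < M * p by rewrite mulr_gt0.
have pM20 : 0 < 2^-1 / (M * p) by rewrite divr_gt0// invr_gt0.
have [C C0 hC] := young_epsilon q0 p0 qp pM20.
exists (2 * (M * p * C)); first by rewrite !mulr_ge0// ltW.
move=> phi tp; have sp := test_smooth tp.
have tdp := test_function_partial i tp.
have [_ iphi] := test_p_integrable oO bO (ltW p0) tp.
have [_ idphi] := test_p_integrable oO bO (ltW p0) tdp.
pose d (t : R) := `|t| `^ (p - 2) * t.
pose G (x : 'rV[R]_N) := x ord0 i * (p * d (phi x) * partial i phi x) + `|phi x| `^ p * 1.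
have box0 x : ~ open_box (const_mx (- M)) (const_mx M) x -> phi x = 0.
  by move=> h; apply: test_function_out tp _ => /OM.
have dphi x : is_derive x (delta_mx ord0 i) (fun y => `|phi y| `^ p)
     (p * d (phi x) * partial i phi x).
  exact: is_derive_comp_real (is_derive_norm_powR _ p1) (smooth_is_derive i x sp).
have cG : continuous G.
  apply: continuous_funD; apply: continuous_funM.
  - exact: coord_continuous.
  - apply: continuous_funM; last exact/smooth_continuous/smooth_partial.
    apply: continuous_funM; first exact: cst_continuous.
    move=> x; apply: (@continuous_comp _ _ _ phi d); first exact: smooth_continuous.
    exact: continuous_norm_powR_sub2.
  - move=> x; apply: (@continuous_comp _ _ _ phi (fun t => `|t| `^ p)); first exact: smooth_continuous.
    exact: continuous_norm_powR.
  - exact: cst_continuous.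
have G0 x : phi x = 0 -> G x = 0.
  by move=> fx; rewrite /G fx /d mulr0 mulr0 mul0r mulr0 add0r mulr1 normr0 (powR0 (lt0r_neq0 p0)).
have IG : (\int[mu]_x (G x)%:E = 0)%E.
  apply: (@integral_partial_eq0 R N i (fun x => x ord0 i * `|phi x| `^ p) G M M0) => //.
  - move=> x; exact: is_derive_eq (is_deriveM (is_derive_coord i x) (dphi x)) _.
  - by move=> x /box0 fx; rewrite fx normr0 (powR0 (lt0r_neq0 p0)) mulr0.
  - by move=> x /box0/G0.
have iG : mu.-integrable Omega (EFin \o G).
  have : mu.-integrable setT (EFin \o G).
    by apply: (@integrable_continuous_box _ _ _ M) => // x /box0/G0.
  by apply: integrableS.
have IGO : \int[mu]_(x in Omega) G x = 0.
  rewrite Rintegral_mkcond /Rintegral (_ : \int[mu]_x _ = 0)%E// -[RHS]IG.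
  apply: eq_integral => x _; rewrite patchE; case: ifPn => // /negP xO.
  by rewrite G0// (test_function_out tp)// => Ox; apply: xO; exact: mem_set.
have ptw x : Omega x -> 2^-1 * `|phi x| `^ p <= G x + (M * p * C) * `|partial i phi x| `^ p.
  move=> Ox; have xM : `|x ord0 i| <= M.
    by have := OM _ Ox i; rewrite !mxE -ltr_norml => /ltW.
  have dle : `|d (phi x)| <= `|phi x| `^ (p - 1).
    have := plaplace_form_le (const_mx (phi x) : 'rV[R]_1) (const_mx 1) p1.
    by rewrite plaplace_form_const1 !euclid_norm_const1 normr1 !mulr1.
  have := hC (`|phi x| `^ (p - 1)) `|partial i phi x| (powR_ge0 _ _) (normr_ge0 _).
  rewrite -powRrM /q mulrCA divff ?mulr1 ?gt_eqF// => Y.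
  have h : - (x ord0 i * (p * d (phi x) * partial i phi x)) <=
      M * p * (`|phi x| `^ (p - 1) * `|partial i phi x|).
    apply: le_trans (ler_norm _) _.
    rewrite normrN (normrM (x ord0 i)) (normrM (p * _)) (normrM p) (ger0_norm (ltW p0)).
    rewrite -(mulrA M) -(mulrA p).
    apply: ler_pM => //; first by rewrite !mulr_ge0// ltW.
    by rewrite ler_pM2l// ler_wpM2r.
  have Y' : M * p * (`|phi x| `^ (p - 1) * `|partial i phi x|) <=
     2^-1 * `|phi x| `^ p + M * p * C * `|partial i phi x| `^ p.
    apply: le_trans (_ : _ <= M * p * (2^-1 / (M * p) * `|phi x| `^ p + C * `|partial i phi x| `^ p)) _.
      by rewrite ler_pM2l.
    rewrite mulrDr !mulrA le_eqVlt; apply/orP; left; apply/eqP; congr (_ + _).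
    by congr (_ * _); field; rewrite !gt_eqF.
  rewrite /G mulr1.
  move: h Y'; set a := x ord0 i * _; set b := M * p * (_ * _); set c := M * p * C * _.
  by move: a b c => a b c h Y'; lra.
have iR : mu.-integrable Omega (EFin \o (fun x => G x + (M * p * C) * `|partial i phi x| `^ p)).
  by apply: integrable_EFinD => //; exact: integrable_EFinZ.
have := le_Rintegral mO (integrable_EFinZ mO 2^-1 iphi) iR ptw.
rewrite RintegralZl// RintegralD//; last exact: integrable_EFinZ.
rewrite IGO add0r RintegralZl// -/(energy phi) -/(energy (partial i phi)).
by rewrite -(mulrA 2) ler_pdivrMl.
Qed.

Lemma poincare (i : 'I_N) : exists2 C, 0 <= C & forall u g,
  sobolev0 Omega p u g -> energy u <= C * energy (g i).
Proof.
have [C C0 hC] := poincare_test i; pose k : R := 2 `^ p.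
have k0 : 0 <= k by exact: powR_ge0.
exists (k * (C * k)); first by rewrite !mulr_ge0.
move=> u g [Lu Lg ap]; apply/ler_addgt0Pl => e e0.
pose c := k * (1 + C * k) + 1.
have c0 : 0 < c by rewrite ltr_wpDl// mulr_ge0// addr_ge0// mulr_ge0.
have [phi tp [uphi gphi]] := ap _ (divr_gt0 e0 c0).
have Lphi := test_p_integrable oO bO (ltW p0) tp.
have Ldphi := test_p_integrable oO bO (ltW p0) (test_function_partial i tp).
have [Lud _] := energyB oO p1 Lu Lphi; have [Lgd _] := energyB oO p1 (Lg i) Ldphi.
have [_] := energyD oO p1 Lud Lphi.
rewrite (_ : (u \- phi) \+ phi = u); last by apply/funext => x /=; rewrite subrK.
have [_] := energyB oO p1 (Lg i) Lgd.
rewrite (_ : g i \- (g i \- partial i phi) = partial i phi); last by apply/funext => x /=; ring.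
have := hC _ tp; have := gphi i; move: uphi.
have := lincomb_lt k0 ler01 (mulr_ge0 C0 k0) e0 _ _ => /[apply] /[apply].
rewrite -/k; move: (energy u) (energy phi) (energy (partial i phi)) (energy (g i)) (energy _) (energy _).
move=> U F D G GD UF.
rewrite mul1r => E1 E2 E3 E4.
have E5 : C * D <= C * (k * (G + GD)) by rewrite ler_wpM2l.
have E6 : k * (UF + F) <= k * (UF + C * (k * (G + GD))).
  by rewrite ler_wpM2l// lerD2l (le_trans E2).
apply: le_trans E4 _; apply: le_trans E6 _.
rewrite (_ : k * (UF + C * (k * (G + GD))) = k * (UF + C * k * GD) + k * (C * k) * G); last by ring.
by rewrite lerD2r ltW.
Qed.

End poincare.

(** * Completeness of L^p *)

Section fast_sequences.
Context {R : realType}.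

Lemma cvgn_geometric_steps (w : nat -> R) (M : R) :
  (forall n, `|w n - w n.+1| <= M * (2^-1) ^+ n) -> cvgn w.
Proof.
move=> h; have M0 : 0 <= M by have := h 0%N; rewrite expr0 mulr1; apply: le_trans.
have -> : w = fun n => w 0%N + series (telescope w) n.
  by apply/funext => n; exact: eq_sum_telescope.
apply: is_cvgD; first exact: is_cvg_cst.
apply: normed_cvg; apply: (@series_le_cvg _ _ (geometric M 2^-1)) => //.
- by move=> n; exact: normr_ge0.
- by move=> n; rewrite /geometric/= mulr_ge0// exprn_ge0.
- by move=> n; rewrite /= distrC; exact: h.
- by apply: is_cvg_geometric_series; rewrite ger0_norm//; lra.
Qed.

Lemma cvg_norm_powR (p : R) (w : nat -> R) (l : R) : 0 < p ->
  w n @[n --> \oo] --> l -> `|w n| `^ p @[n --> \oo] --> `|l| `^ p.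
Proof.
move=> p0 wl; apply: (@cvg_comp _ _ _ w (fun t => `|t| `^ p) _ (nbhs l)) => //.
exact: continuous_norm_powR.
Qed.

(** The rate at which (2^n)^p fast_rate p n = 2^-n is summable. *)
Definition fast_rate (p : R) (n : nat) : R := ((2 ^+ n) `^ p * 2 ^+ n)^-1.

Lemma fast_rate_gt0 p n : 0 < fast_rate p n.
Proof. by rewrite invr_gt0 mulr_gt0 ?powR_gt0 ?exprn_gt0. Qed.

Lemma fast_rateE p n : (2 ^+ n) `^ p * fast_rate p n = 2^-1 ^+ n.
Proof.
by rewrite /fast_rate invfM mulrA divff ?mul1r ?exprVn//.
Qed.

Lemma fast_rate_cvg0 p : 0 <= p -> fast_rate p n @[n --> \oo] --> (0 : R).
Proof.
move=> p0; apply: (@squeeze_cvgr _ _ _ _ (fun=> 0) (fun n => 2^-1 ^+ n)).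
- apply: nearW => n; rewrite ltW ?fast_rate_gt0//= -(fast_rateE p).
  apply: ler_peMl; first exact/ltW/fast_rate_gt0.
  rewrite -[leLHS](powRr0 (2 ^+ n)) ler_powR//.
  by rewrite exprn_ege1//; lra.
- exact: cvg_cst.
- by apply: cvg_expr; rewrite ger0_norm//; lra.
Qed.
End fast_sequences.

Section p_complete.
Context d (T : measurableType d) (R : realType).
Variables (mu : {measure set T -> \bar R}) (D : set T).
Hypothesis mD : measurable D.
Variables (p : R) (p0 : 0 < p) (w : nat -> T -> R).
Hypothesis Lw : forall n, p_integrable mu D p (w n).
Hypothesis Cw : forall n k, (n <= k)%N ->
  p_energy mu D p (w n \- w k) <= fast_rate p n.

Let Lww n k : p_integrable mu D p (w n \- w k).
Proof. exact: (proj1 (p_integrableB mD (ltW p0) (Lw n) (Lw k))). Qed.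

(** The sum of the (2^n |w_n - w_(n+1)|)^p has a finite integral, so it is finite
almost everywhere; at such a point |w_n - w_(n+1)| = O(2^-n). *)
Lemma fast_ae_cvg : {ae mu, forall x, D x -> cvgn (w^~ x)}.
Proof.
pose a n x : \bar R := ((2 ^+ n) `^ p * `|(w n \- w n.+1) x| `^ p)%:E.
have a0 n x : (0 <= a n x)%E by rewrite lee_fin mulr_ge0 ?powR_ge0.
have ia n : mu.-integrable D (a n).
  by have [_ h] := Lww n n.+1; exact: (integrable_EFinZ mD _ h).
have ma n : measurable_fun D (a n) by exact: measurable_int (ia n).
pose s x := (\sum_(0 <= n <oo) a n x)%E.
have Is : (\int[mu]_(x in D) s x < +oo)%E.
  rewrite /s integral_nneseries//.
  apply: (@le_lt_trans _ _ (\sum_(0 <= n <oo) (2 / (2 ^ (n + 1))%:R)%:E)%E).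
    apply: lee_nneseries => n _; first by move=> _; apply: integral_ge0 => x _; exact: a0.
    have [_ h] := Lww n n.+1.
    have -> : (\int[mu]_(x in D) a n x = ((2 ^+ n) `^ p * p_energy mu D p (w n \- w n.+1))%:E)%E.
      rewrite EFinM /p_energy /Rintegral fineK ?integrable_fin_num//.
      by rewrite -integralZl//; apply: eq_integral => x _; rewrite -EFinM.
    rewrite lee_fin; apply: (@le_trans _ _ ((2 ^+ n) `^ p * fast_rate p n)).
      by rewrite ler_wpM2l ?powR_ge0//; exact: Cw.
    rewrite fast_rateE addn1 expnS natrM natrX invfM mulrA divff// mul1r exprVn.
    exact: lexx.
  have := @cvg_geometric_eseries_half R 2 0; move/cvg_lim => -> //; exact: ltry.
have is_ : mu.-integrable D s.
  apply/integrableP; split.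
    by apply: ge0_emeasurable_sum => // n x Dx _; exact: a0.
  under eq_integral do rewrite gee0_abs ?nneseries_ge0//.
  exact: Is.
have := integrable_ae mD is_; apply: filterS => x sx Dx.
have {}sx := sx Dx.
pose M := fine (s x).
have M0 : 0 <= M by rewrite fine_ge0// nneseries_ge0.
apply: (@cvgn_geometric_steps _ _ (M `^ p^-1)) => n.
have aM : (2 ^+ n) `^ p * `|w n x - w n.+1 x| `^ p <= M.
  rewrite -lee_fin /M fineK//; apply: le_trans (nneseries_lim_ge n.+1 _); last by move=> *; exact: a0.
  rewrite big_nat_recr//= leeDr// sume_ge0// => k _; exact: a0.
have n0 : 0 < (2 ^+ n : R) by rewrite exprn_gt0.
rewrite -powRM ?(ltW n0)// in aM.
have : ((2 ^+ n * `|w n x - w n.+1 x|) `^ p) `^ p^-1 <= M `^ p^-1.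
  by rewrite ge0_ler_powR// ?nnegrE ?powR_ge0// invr_ge0 ltW.
rewrite -powRrM divff ?gt_eqF// powRr1; last by rewrite mulr_ge0// ltW.
by rewrite mulrC -ler_pdivlMr// exprVn.
Qed.

(** The pointwise limit is a limit for the energy by Fatou's lemma, which also
transmits the rate. *)
Lemma p_complete : exists u, [/\ p_integrable mu D p u,
  {ae mu, forall x, D x -> w n x @[n --> \oo] --> u x} &
  forall n, p_energy mu D p (w n \- u) <= fast_rate p n].
Proof.
have [A [mA A0 subA]] := fast_ae_cvg.
(* A null set A contains the points of divergence; w' vanishes on A, so that it
converges everywhere on D. *)
pose w' n x := if x \in A then 0 else w n x.
have w'w n : {ae mu, forall x, D x -> w n x = w' n x}.
  exists A; split => // x /= xA; apply: contrapT => nxA; apply: xA => _.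
  by rewrite /w' memNset.
have cw' x : D x -> cvgn (w'^~ x).
  move=> Dx; have [xA|xA] := boolP (x \in A).
    rewrite (_ : w'^~ x = fun=> 0); first exact: is_cvg_cst.
    by apply/funext => n; rewrite /w' xA.
  rewrite (_ : w'^~ x = w^~ x); last by apply/funext => n; rewrite /w' (negbTE xA).
  apply: contrapT => h; move: xA => /negP; apply; apply/mem_set/subA => /= h'.
  by apply: h; exact: h'.
have mw n : measurable_fun D (w n) by case: (Lw n).
have mw' n : measurable_fun D (w' n).
  rewrite (_ : w' n = fun x => if (x \in A) then cst 0 x else w n x)//.
  apply: measurable_fun_if => //.
  - apply: (measurable_fun_bool true).
    rewrite (_ : _ @^-1` _ = A); first exact: measurableI.
    by apply/seteqP; split => x /=; [move/set_mem|move/mem_set].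
  - by apply: measurable_funS (mw n) => // x [].
pose u x := limn (w'^~ x).
have cu x : D x -> w' n x @[n --> \oo] --> u x by move=> /cw'.
have mu_ : measurable_fun D u by apply: (measurable_fun_cvg mw').
have Ew' n k : (n <= k)%N -> (\int[mu]_(x in D) (`|w' n x - w' k x| `^ p)%:E <= (fast_rate p n)%:E)%E.
  move=> nk; have [_ h] := Lww n k.
  have ae : {ae mu, forall x, D x -> (w n \- w k) x = (w' n \- w' k) x}.
    by apply: filterS2 (w'w n) (w'w k) => x h1 h2 Dx /=; rewrite h1// h2.
  have [[_ h'] e'] := ae_p_integrable mD (measurable_funB (mw' n) (mw' k)) ae (Lww n k).
  have -> : (\int[mu]_(x in D) (`|w' n x - w' k x| `^ p)%:E = (p_energy mu D p (w' n \- w' k))%:E)%E.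
    by rewrite /p_energy /Rintegral fineK//; exact: (integrable_fin_num mD h').
  by rewrite lee_fin e'; exact: Cw.
have Eu n : (\int[mu]_(x in D) (`|w' n x - u x| `^ p)%:E <= (fast_rate p n)%:E)%E.
  have mk k : measurable_fun D (fun x => (`|w' n x - w' k x| `^ p)%:E).
    by apply/measurable_EFinP; apply: measurable_norm_powR; exact: measurable_funB.
  have := fatou mu mD mk (fun k x _ => powR_ge0 _ _).
  have -> : (\int[mu]_(x in D) limn_einf (fun k => (`|w' n x - w' k x| `^ p)%:E) =
     \int[mu]_(x in D) (`|w' n x - u x| `^ p)%:E)%E.
    apply: eq_integral => x /set_mem Dx.
    have c : (`|w' n x - w' k x| `^ p)%:E @[k --> \oo] --> (`|w' n x - u x| `^ p)%:E.
      have c0 : w' n x - w' k x @[k --> \oo] --> w' n x - u x.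
        by apply: cvgB; [exact: cvg_cst|exact: cu].
      have c1 : `|w' n x - w' k x| `^ p @[k --> \oo] --> `|w' n x - u x| `^ p.
        exact: (cvg_norm_powR p0 c0).
      by apply/fine_cvgP; split; first exact: nearW.
    by rewrite limn_einf_lim; apply: cvg_lim => //; exact: cvg_einfs.
  move=> /le_trans; apply; rewrite limn_einf_lim; apply: lime_le; first exact: is_cvg_einfs.
  apply: nearW => k; apply: (@le_trans _ _ (\int[mu]_(x in D) (`|w' n x - w' (maxn n k) x| `^ p)%:E)%E).
    apply: ereal_inf_lbound; exists (maxn n k) => //=; exact: leq_maxr.
  by apply: Ew'; exact: leq_maxl.
have Lw' n : p_integrable mu D p (w' n).
  exact: (proj1 (ae_p_integrable mD (mw' n) (w'w n) (Lw n))).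
have Lu' n : p_integrable mu D p (w' n \- u).
  have md : measurable_fun D (w' n \- u) by exact: measurable_funB.
  split => //; apply/integrableP; split.
    by apply/measurable_EFinP; exact: measurable_norm_powR.
  apply: le_lt_trans (le_lt_trans (Eu n) (ltry _)).
  rewrite le_eqVlt; apply/orP; left; apply/eqP; apply: eq_integral => x _.
  by rewrite /= ger0_norm ?powR_ge0.
have Lu : p_integrable mu D p u.
  have := proj1 (p_integrableB mD (ltW p0) (Lw' 0%N) (Lu' 0%N)).
  by rewrite (_ : (fun x => _) = u)//; apply/funext => x /=; ring.
exists u; split => // [|n].
  exists A; split => // x /= h; apply: contrapT => xA; apply: h => Dx.
  by have := cu _ Dx; rewrite /w' memNset.
have ae : {ae mu, forall x, D x -> (w' n \- u) x = (w n \- u) x}.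
  by apply: filterS (w'w n) => x h Dx /=; rewrite h.
have [_ ->] := ae_p_integrable mD (measurable_funB (mw n) mu_) ae (Lu' n).
have [_ h] := Lu' n.
by rewrite -lee_fin /p_energy /Rintegral fineK; [exact: Eu|exact: (integrable_fin_num mD h)].
Qed.
End p_complete.

(** * The p-energy of vector fields *)

(** The conjugate exponent q = p / (p - 1) satisfies (|a|^(p-1))^q = |a|^p. *)
Lemma plaplace_form_young (R : realType) (N : nat) (p e : R) : 1 < p -> 0 < e ->
  exists2 C, 0 <= C & forall a b : 'rV[R]_N,
  `|plaplace_form p a b| <= e * euclid_norm a `^ p + C * euclid_norm b `^ p.
Proof.
move=> p1 e0; have p0 : 0 < p by exact: lt_trans p1.
pose q := p / (p - 1).
have q0 : 0 < q by rewrite divr_gt0// subr_gt0.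
have qp : q^-1 + p^-1 = 1 by rewrite /q; field; rewrite lt0r_neq0//= subr_eq0 gt_eqF.
have [C C0 hC] := young_epsilon q0 p0 qp e0; exists C => // a b.
apply: le_trans (plaplace_form_le a b p1) _.
apply: le_trans (hC _ _ (powR_ge0 _ _) (euclid_norm_ge0 _)) _.
by rewrite -powRrM /q mulrCA divff ?mulr1// subr_eq0 gt_eqF.
Qed.

Section vector_fields.
Context d (T : measurableType d) (R : realType) (N : nat).
Variables (mu : {measure set T -> \bar R}) (D : set T).
Hypothesis mD : measurable D.
Variable p : R.
Hypothesis p1 : 1 < p.
Implicit Types (g h : 'I_N -> T -> R) (i : 'I_N).

Let p0 : 0 < p. Proof. exact: lt_trans p1. Qed.

Definition field g (x : T) : 'rV[R]_N := \row_i g i x.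

Definition field_energy g := \int[mu]_(x in D) (euclid_norm (field g x) `^ p).

Lemma field_lincomb (a b : R) g h x :
  field (fun i x => a * g i x + b * h i x) x = a *: field g x + b *: field h x.
Proof. by apply/rowP => i; rewrite !mxE. Qed.

Lemma measurable_dotrV g h : (forall i, measurable_fun D (g i)) ->
  (forall i, measurable_fun D (h i)) ->
  measurable_fun D (fun x => dotrV (field g x) (field h x)).
Proof.
move=> mg mh.
rewrite (_ : (fun x => _) = fun x => \sum_(i < N) g i x * h i x); last first.
  by apply/funext => x; apply: eq_bigr => i _; rewrite !mxE.
by apply: measurable_sum => i; exact: measurable_funM.
Qed.

Lemma measurable_euclid_norm g : (forall i, measurable_fun D (g i)) ->
  measurable_fun D (fun x => euclid_norm (field g x)).
Proof.
move=> mg; have ms : measurable_fun setT (@Num.sqrt R).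
  by apply: continuous_measurable_fun; exact: sqrt_continuous.
exact: (measurableT_comp ms (measurable_dotrV mg mg)).
Qed.

Lemma measurable_euclid_norm_powR r g : (forall i, measurable_fun D (g i)) ->
  measurable_fun D (fun x => euclid_norm (field g x) `^ r).
Proof.
by move=> mg; apply: (measurableT_comp (measurable_powR r)); exact: measurable_euclid_norm.
Qed.

Lemma measurable_plaplace g h : (forall i, measurable_fun D (g i)) ->
  (forall i, measurable_fun D (h i)) ->
  measurable_fun D (fun x => plaplace_form p (field g x) (field h x)).
Proof.
move=> mg mh; apply: measurable_funM; last exact: measurable_dotrV.
exact: measurable_euclid_norm_powR.
Qed.

(** Each coordinate is at most S^(1/p), so the norm is at most N S^(1/p). *)
Lemma euclid_norm_powR_le_sum (a : 'rV[R]_N) :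
  euclid_norm a `^ p <= N%:R `^ p * \sum_(i < N) `|a ord0 i| `^ p.
Proof.
set S := \sum_(i < N) _; have S0 : 0 <= S by apply: sumr_ge0 => i _; exact: powR_ge0.
have SE : (S `^ p^-1) `^ p = S by rewrite -powRrM mulVf ?powRr1// gt_eqF.
have aS i : `|a ord0 i| <= S `^ p^-1.
  rewrite -[leLHS](powRr1 (normr_ge0 _)) -(divff (lt0r_neq0 p0)) powRrM.
  rewrite ge0_ler_powR ?invr_ge0 ?(ltW p0)// ?nnegrE ?powR_ge0//.
  rewrite /S (bigD1 i)//= lerDl; apply: sumr_ge0 => j _; exact: powR_ge0.
have aN : euclid_norm a <= N%:R * S `^ p^-1.
  rewrite -(@ler_pXn2r _ 2)// ?nnegrE ?euclid_norm_ge0 ?mulr_ge0 ?powR_ge0//.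
  rewrite euclid_norm_sqr /dotrV.
  apply: (@le_trans _ _ (\sum_(i < N) (S `^ p^-1) ^+ 2)).
    apply: ler_sum => i _; rewrite -expr2 -[leLHS]real_normK ?num_real//.
    by rewrite ler_pXn2r// ?nnegrE ?powR_ge0.
  rewrite sumr_const card_ord -[leLHS]mulr_natl exprMn.
  apply: ler_wpM2r; first exact: sqr_ge0.
  by rewrite -natrX ler_nat -{1}(expn1 N); case: (N) => // n; rewrite leq_pexp2l.
rewrite -[in leRHS]SE -powRM ?powR_ge0//.
by rewrite ge0_ler_powR ?(ltW p0)// ?nnegrE ?euclid_norm_ge0 ?mulr_ge0 ?powR_ge0.
Qed.

Lemma integrable_sum_EFin (F : 'I_N -> T -> R) :
  (forall i, mu.-integrable D (EFin \o F i)) ->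
  mu.-integrable D (EFin \o (fun x => \sum_(i < N) F i x)) /\
  \int[mu]_(x in D) (\sum_(i < N) F i x) = \sum_(i < N) \int[mu]_(x in D) F i x.
Proof.
move=> iF; elim: (index_enum 'I_N) => [|i s [IH1 IH2]].
  rewrite big_nil (_ : (fun x => _) = fun=> 0); last first.
    by apply/funext => x; rewrite big_nil.
  by split; [exact: integrable0|rewrite Rintegral_cst// mul0r].
rewrite big_cons (_ : (fun x => _) = fun x => F i x + \sum_(j <- s) F j x); last first.
  by apply/funext => x; rewrite big_cons.
split; first exact: integrable_EFinD.
by rewrite RintegralD// IH2.
Qed.

Lemma field_integrable g : (forall i, p_integrable mu D p (g i)) ->
  mu.-integrable D (EFin \o (fun x => euclid_norm (field g x) `^ p)) /\
  field_energy g <= N%:R `^ p * \sum_(i < N) p_energy mu D p (g i).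
Proof.
move=> Lg; have [iS ES] := integrable_sum_EFin (fun i => proj2 (Lg i)).
have le x : euclid_norm (field g x) `^ p <= N%:R `^ p * \sum_(i < N) `|g i x| `^ p.
  apply: le_trans (euclid_norm_powR_le_sum _) _.
  by rewrite le_eqVlt; apply/orP; left; apply/eqP; congr (_ * _); apply: eq_bigr => i _; rewrite mxE.
have iR := integrable_EFinZ mD (N%:R `^ p) iS.
have il : mu.-integrable D (EFin \o (fun x => euclid_norm (field g x) `^ p)).
  apply: (integrable_le mD _ iR).
    by apply: measurable_euclid_norm_powR => i; case: (Lg i).
  by move=> x _; rewrite ger0_norm ?powR_ge0.
split => //; rewrite /field_energy -ES -RintegralZl//.
by apply: le_Rintegral.
Qed.

Lemma p_energy_le_field g i : (forall i, p_integrable mu D p (g i)) ->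
  p_energy mu D p (g i) <= field_energy g.
Proof.
move=> Lg; have [iF _] := field_integrable Lg; have [_ ig] := Lg i.
apply: le_Rintegral => // x _; rewrite ge0_ler_powR ?(ltW p0)// ?nnegrE ?euclid_norm_ge0//.
by have := le_coord_euclid_norm (field g x) i; rewrite mxE.
Qed.

Lemma field_energy_ge0 g : 0 <= field_energy g.
Proof. by apply: Rintegral_ge0 => x _; exact: powR_ge0. Qed.

Lemma integrableZD (a b : R) (F G : T -> R) : mu.-integrable D (EFin \o F) ->
  mu.-integrable D (EFin \o G) -> mu.-integrable D (EFin \o (fun x => a * F x + b * G x)).
Proof. by move=> iF iG; exact: (integrable_EFinD mD (integrable_EFinZ mD a iF) (integrable_EFinZ mD b iG)). Qed.

Lemma RintegralZD (a b : R) (F G : T -> R) : mu.-integrable D (EFin \o F) ->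
  mu.-integrable D (EFin \o G) ->
  \int[mu]_(x in D) (a * F x + b * G x) =
  a * \int[mu]_(x in D) F x + b * \int[mu]_(x in D) G x.
Proof.
move=> iF iG; rewrite RintegralD//; [|exact: integrable_EFinZ..].
by rewrite !RintegralZl.
Qed.

Lemma young_plaplace e : 0 < e -> exists2 C, 0 <= C & forall g h,
  (forall i, p_integrable mu D p (g i)) -> (forall i, p_integrable mu D p (h i)) ->
  mu.-integrable D (EFin \o (fun x => plaplace_form p (field g x) (field h x))) /\
  `|\int[mu]_(x in D) plaplace_form p (field g x) (field h x)| <=
     e * field_energy g + C * field_energy h.
Proof.
move=> e0; have [C C0 hC] := @plaplace_form_young R N p e p1 e0; exists C => // g h Lg Lh.
have [ig _] := field_integrable Lg; have [ih _] := field_integrable Lh.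
have le x : `|plaplace_form p (field g x) (field h x)| <=
    e * euclid_norm (field g x) `^ p + C * euclid_norm (field h x) `^ p.
  exact: hC.
have iR : mu.-integrable D (EFin \o (fun x => e * euclid_norm (field g x) `^ p + C * euclid_norm (field h x) `^ p)).
  exact: (integrableZD e C ig ih).
have iF : mu.-integrable D (EFin \o (fun x => plaplace_form p (field g x) (field h x))).
  apply: (integrable_le mD _ iR (fun x _ => le x)).
  by apply: measurable_plaplace => i; [case: (Lg i)|case: (Lh i)].
split; first exact: iF.
apply: le_trans (le_normr_Rintegral mD iF) _.
rewrite -(RintegralZD e C ig ih).
exact: (le_Rintegral mD (integrable_norm iF) iR (fun x _ => le x)).
Qed.

Lemma ae_field_eq g h : (forall i, {ae mu, forall x, D x -> g i x = h i x}) ->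
  {ae mu, forall x, D x -> field g x = field h x}.
Proof.
move=> gh; have : {ae mu, forall x, forall i, D x -> g i x = h i x}.
  (* The index i is embedded into nat, as a countable conjunction of almost
  everywhere properties holds almost everywhere. *)
  have ae (k : nat) : {ae mu, forall x, forall i, (i = k :> nat) -> D x -> g i x = h i x}.
    have [kN|kN] := ltnP k N; last first.
      by apply: aeW => x i ik; move: kN; rewrite -ik leqNgt ltn_ord.
    apply: filterS (gh (Ordinal kN)) => x H i ik.
    by have -> : i = Ordinal kN by exact/val_inj.
  by have := ae_foralln ae; apply: filterS => x H i; exact: (H i i erefl).
by apply: filterS => x H Dx; apply/rowP => i; rewrite !mxE H.
Qed.

Lemma ae_field_energy g h : (forall i, measurable_fun D (g i)) ->
  (forall i, measurable_fun D (h i)) ->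
  (forall i, {ae mu, forall x, D x -> g i x = h i x}) ->
  field_energy g = field_energy h.
Proof.
move=> mg mh gh; apply: ae_eq_Rintegral => //; try exact: measurable_euclid_norm_powR.
by apply: filterS (ae_field_eq gh) => x H Dx; rewrite H.
Qed.

Lemma p_integrable_lincomb (a b : R) g h i : (forall i, p_integrable mu D p (g i)) ->
  (forall i, p_integrable mu D p (h i)) ->
  p_integrable mu D p (fun x => a * g i x + b * h i x).
Proof.
move=> Lg Lh; have [Lag _] := p_integrableZ mD a (Lg i).
have [Lbh _] := p_integrableZ mD b (Lh i).
exact: (proj1 (p_integrableD mD (ltW p0) Lag Lbh)).
Qed.

Lemma fieldB g h x : field (fun i => g i \- h i) x = field g x - field h x.
Proof. by apply/rowP => i; rewrite !mxE. Qed.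

Lemma p_integrable_sub g h i : (forall i, p_integrable mu D p (g i)) ->
  (forall i, p_integrable mu D p (h i)) -> p_integrable mu D p (g i \- h i).
Proof. by move=> Lg Lh; exact: (proj1 (p_integrableB mD (ltW p0) (Lg i) (Lh i))). Qed.

Lemma field_uniform_convexity e : 0 < e -> exists2 C, 0 <= C & forall g h,
  (forall i, p_integrable mu D p (g i)) -> (forall i, p_integrable mu D p (h i)) ->
  field_energy (fun i => g i \- h i) <= e * (field_energy g + field_energy h) +
    C * ((field_energy g + field_energy h) / 2 -
         field_energy (fun i x => 2^-1 * g i x + 2^-1 * h i x)).
Proof.
move=> e0; have [C C0 hC] := @uniform_convexity R N p e p1 e0.
exists C => // g h Lg Lh.
pose m := fun i x => 2^-1 * g i x + 2^-1 * h i x.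
have [ig _] := field_integrable Lg; have [ih _] := field_integrable Lh.
have [im _] := @field_integrable m (fun i => p_integrable_lincomb 2^-1 2^-1 i Lg Lh).
have [id _] := @field_integrable (fun i => g i \- h i) (fun i => p_integrable_sub i Lg Lh).
pose s x := 1 * euclid_norm (field g x) `^ p + 1 * euclid_norm (field h x) `^ p.
have is_ : mu.-integrable D (EFin \o s).
  exact: (integrableZD 1 1 ig ih).
have Es : \int[mu]_(x in D) s x = 1 * field_energy g + 1 * field_energy h := RintegralZD 1 1 ig ih.
pose r x := (e + C / 2) * s x + (- C) * euclid_norm (field m x) `^ p.
have ir : mu.-integrable D (EFin \o r).
  exact: (integrableZD _ _ is_ im).
have Er : \int[mu]_(x in D) r x = (e + C / 2) * \int[mu]_(x in D) s x + (- C) * field_energy m :=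
  RintegralZD (e + C / 2) (- C) is_ im.
have {}Er : e * (field_energy g + field_energy h) + C * ((field_energy g + field_energy h) / 2 -
    field_energy m) = \int[mu]_(x in D) r x.
  rewrite Er Es; move: (field_energy g) (field_energy h) (field_energy m) => x y z; ring.
rewrite -/m Er; apply: (le_Rintegral mD id ir) => x Dx.
have := hC (field g x) (field h x); rewrite fieldB.
have <- : field m x = 2^-1 *: (field g x + field h x).
  by apply/rowP => i; rewrite !mxE mulrDr.
move/le_trans; apply; rewrite le_eqVlt; apply/orP; left; apply/eqP; rewrite /r /s.
move: (_ `^ p) (_ `^ p) (_ `^ p) => a b c; ring.
Qed.

Lemma plaplace_integrable g h :
  (forall i, p_integrable mu D p (g i)) -> (forall i, p_integrable mu D p (h i)) ->
  mu.-integrable D (EFin \o (fun x => plaplace_form p (field g x) (field h x))).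
Proof. by move=> Lg Lh; have [C _ hC] := young_plaplace ltr01; have [] := hC g h Lg Lh. Qed.

Lemma field_energy_convex g h :
  (forall i, p_integrable mu D p (g i)) -> (forall i, p_integrable mu D p (h i)) ->
  p * \int[mu]_(x in D) plaplace_form p (field g x) (field (fun i => h i \- g i) x) <=
  field_energy h - field_energy g.
Proof.
move=> Lg Lh; have [ig _] := field_integrable Lg; have [ih _] := field_integrable Lh.
have iF : mu.-integrable D (EFin \o (fun x => plaplace_form p (field g x) (field (fun i => h i \- g i) x))).
  by apply: plaplace_integrable => // i; exact: p_integrable_sub.
rewrite -(RintegralZl p mD iF) -(RintegralB mD ih ig).
apply: (le_Rintegral mD (integrable_EFinZ mD p iF) (integrableB mD ih ig)) => x _.
by rewrite fieldB; exact: plaplace_form_convex.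
Qed.

End vector_fields.

(** * Minimization over the obstacle set *)

Section scalar_estimates.
Context {R : realType}.
Implicit Types a b c d e m r s t x y z : R.

Lemma add_le_double a b c : a <= c -> b <= c -> a + b <= 2 * c.
Proof. by lra. Qed.

Lemma half_sum_le a b e m x : a < m + e -> b < m + e -> m <= x -> (a + b) / 2 - x <= e.
Proof. by lra. Qed.

Lemma add_le_of_lt e m a c x : e <= 1 -> a < m + e -> m <= x -> a + c <= x + 1 + c.
Proof. by lra. Qed.

(** The real arithmetic of functional_lsc: a and b are the energies of h and g
divided by p, t and r the source terms of v and u, z the integral of the form
at g, c and d the energies of g and f, and x and y those of the differences. *)
Lemma lsc_scalar e C K a b c d r t x y z : 0 <= C -> 0 <= K -> 0 <= x -> 0 <= y ->
  - (e * c + C * x) <= z -> z <= a - b -> t - r <= e * d + K * y ->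
  b - r <= a - t + (e * (c + d) + (C + K) * (x + y)).
Proof.
move=> C0 K0 x0 y0; have := mulr_ge0 C0 y0; have := mulr_ge0 K0 x0.
by rewrite !mulrDl !mulrDr; lra.
Qed.

Lemma lsc_rate e C a b c d m r s t : 0 <= C -> d <= e -> a <= s * r -> b <= r -> c <= m + t ->
  c + (d + C * (a + b)) <= (m + e) + (t + C * (s + 1) * r).
Proof.
move=> C0 de ar br ct; have := ler_wpM2l C0 (lerD ar br).
have -> : C * (s * r + r) = C * (s + 1) * r by ring.
by lra.
Qed.

(** The real arithmetic of minimizer_variational_inequality, where a first-order
expansion is divided by the step t: x and y are the energies at u and at
(1 - t) u + t v, b and c are the source terms of u and v, and a is the form
tested against the difference of the gradients. *)
Lemma tangent_scalar p t x y a b c : 0 < p -> 0 < t ->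
  p * (- t * a) <= x - y -> 
  p^-1 * x - b <= p^-1 * y - ((1 - t) * b + t * c) -> c - b <= a.
Proof.
move=> p0 t0 h1 h2; have := ler_wpM2l (ltW (divr_gt0 ltr01 p0)) h1.
rewrite !mul1r mulKf ?lt0r_neq0// mulrBr => h3.
by rewrite -(ler_pM2l t0) mulrBr; lra.
Qed.
End scalar_estimates.

Lemma cvg_plaplace_segment (R : realType) (N : nat) (p : R) (a b c : 'rV[R]_N) : 1 < p ->
  plaplace_form p ((1 - n.+1%:R^-1) *: a + n.+1%:R^-1 *: b) c @[n --> \oo] -->
  plaplace_form p a c.
Proof.
move=> p1.
have h0 : ((1 - harmonic n) *: a + harmonic n *: b : 'rV[R]_N) @[n --> \oo] -->
    (1 - 0) *: a + 0 *: b.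
  apply: cvgD; apply: cvgZr_tmp; last exact: cvg_harmonic.
  by apply: cvgB; [exact: cvg_cst|exact: cvg_harmonic].
rewrite subr0 scale1r scale0r addr0 in h0.
apply: (@cvg_comp _ _ _ (fun n => (1 - harmonic n) *: a + harmonic n *: b)
  (fun z => plaplace_form p z c) _ (nbhs a)); first exact: h0.
exact: continuous_plaplace_form.
Qed.

Section obstacle_problem.
Context {R : realType} {N : nat}.
Variable Omega : set 'rV[R]_N.
Hypotheses (oO : open Omega) (bO : bounded_set Omega).
Variables p p' : R.
Hypotheses (p1 : 1 < p) (pp' : p^-1 + p'^-1 = 1).
Variable i0 : 'I_N.
Variables psi f : 'rV[R]_N -> R.
Local Notation mu := (@lebesgue_measure_rV R N).
Local Notation inLp := (p_integrable mu Omega p).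
Local Notation energy := (p_energy mu Omega p).
Local Notation Energy := (field_energy mu Omega p).
Hypothesis Lf : p_integrable mu Omega p' f.
Implicit Types (u v : 'rV[R]_N -> R) (g h : 'I_N -> 'rV[R]_N -> R).

Let p0 : 0 < p. Proof. exact: lt_trans p1. Qed.
Let p'0 : 0 < p'.
Proof.
have : p^-1 < 1 by rewrite invf_lt1.
by rewrite -invr_gt0; move: pp'; lra.
Qed.
Let mO : measurable Omega. Proof. exact: open_measurable_rV. Qed.

(** A function of the pair (v, g); obstacle_energy is its value when g is the
chosen weak gradient of v. *)
Definition functional v g := p^-1 * Energy g - \int[mu]_(x in Omega) (f x * v x).

Definition admissible v g :=
  sobolev0 Omega p v g /\ {ae mu, forall x, Omega x -> psi x <= v x}.

Lemma source_integrable v : inLp v -> mu.-integrable Omega (EFin \o (fun x => f x * v x)).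
Proof.
move=> Lv; have pp : p'^-1 + p^-1 = 1 by rewrite addrC.
by have [C _ hC] := young_integral mu mO p'0 p0 pp ltr01; have [] := hC f v Lf Lv.
Qed.

Lemma source_lincomb (a b : R) u v : inLp u -> inLp v ->
  \int[mu]_(x in Omega) (f x * (a * u x + b * v x)) =
  a * \int[mu]_(x in Omega) (f x * u x) + b * \int[mu]_(x in Omega) (f x * v x).
Proof.
move=> Lu Lv; rewrite -(RintegralZD mO a b (source_integrable Lu) (source_integrable Lv)).
by congr Rintegral; apply/funext => x; ring.
Qed.

Lemma poincare_field : exists2 C, 0 <= C & forall u g, sobolev0 Omega p u g ->
  energy u <= C * Energy g.
Proof.
have [C C0 hC] := poincare oO bO p1 i0; exists C => // u g ug.
apply: le_trans (hC u g ug) _; apply: ler_wpM2l => //.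
by have [_ Lg _] := ug; exact: p_energy_le_field.
Qed.

(** Young's inequality with a small weight on the energy of u, which the Poincare
inequality then bounds by the energy of the gradient. *)
Lemma source_le d : 0 < d -> exists2 C, 0 <= C & forall u g, sobolev0 Omega p u g ->
  `|\int[mu]_(x in Omega) (f x * u x)| <= d * Energy g + C.
Proof.
move=> d0; have [C C0 hC] := poincare_field.
have e0 : 0 < d / (C + 1) by rewrite divr_gt0// ltr_wpDl.
have [K K0 hK] := young_integral mu mO p0 p'0 pp' e0.
exists (K * p_energy mu Omega p' f); first by rewrite mulr_ge0// p_energy_ge0.
move=> u g ug; have [Lu _ _] := ug; have [_] := hK u f Lu Lf.
have -> : (fun x => u x * f x) = (fun x => f x * u x) by apply/funext => x; rewrite mulrC.
move/le_trans; apply; rewrite lerD2r.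
apply: (@le_trans _ _ (d / (C + 1) * (C * Energy g))).
  by apply: ler_wpM2l; [exact: ltW|exact: hC].
rewrite mulrA; apply: ler_wpM2r; first exact: field_energy_ge0.
exact: div_succ_mul_le.
Qed.

(** By source_le with weight 1/(2p), the source term consumes at most half of
the energy. *)
Lemma coercive : exists2 C, 0 <= C & forall v g, sobolev0 Omega p v g ->
  Energy g <= 2 * p * (functional v g + C).
Proof.
have d0 : 0 < (2 * p)^-1 by rewrite invr_gt0 mulr_gt0.
have [C C0 hC] := source_le d0; exists C => // v g vg.
have := le_trans (ler_norm _) (hC v g vg); rewrite /functional.
move: (\int[mu]_(x in Omega) (f x * v x)) (Energy g) => s E hs.
have -> : E = 2 * p * ((2 * p)^-1 * E) by rewrite mulVKf// lt0r_neq0// mulr_gt0.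
rewrite ler_pM2l ?mulr_gt0//.
have -> : p^-1 * (2 * p * ((2 * p)^-1 * E)) = 2 * ((2 * p)^-1 * E).
  by field; rewrite lt0r_neq0.
move: ((2 * p)^-1 * E) hs => z; lra.
Qed.

Lemma admissible_convex t u v g h : 0 <= t <= 1 -> admissible u g -> admissible v h ->
  admissible (fun x => (1 - t) * u x + t * v x) (fun i x => (1 - t) * g i x + t * h i x).
Proof.
move=> /andP[t0 t1] [ug pu] [vh pv]; split; first exact: sobolev0_lincomb.
apply: filterS2 pu pv => x hu hv Ox; have {}hu := hu Ox; have {}hv := hv Ox.
have -> : psi x = (1 - t) * psi x + t * psi x by ring.
by apply: lerD; apply: ler_wpM2l; rewrite ?subr_ge0.
Qed.

(** The source term is linear, so it does not contribute to the midpoint gap. *)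
Lemma functional_midpoint u v g h : sobolev0 Omega p u g -> sobolev0 Omega p v h ->
  (Energy g + Energy h) / 2 - Energy (fun i x => 2^-1 * g i x + 2^-1 * h i x) =
  p * ((functional u g + functional v h) / 2 -
       functional (fun x => 2^-1 * u x + 2^-1 * v x) (fun i x => 2^-1 * g i x + 2^-1 * h i x)).
Proof.
move=> [Lu _ _] [Lv _ _]; rewrite /functional source_lincomb//.
move: (Energy _) (Energy _) (Energy _) (Rintegral _ _ _) (Rintegral _ _ _) => a b c s t.
by field; rewrite lt0r_neq0.
Qed.

(** The midpoint of the two pairs is admissible, so its functional is at least m
and the midpoint gap of the energy is at most p e. Uniform convexity turns
this into a bound on the difference of the gradients; the energies that it
multiplies by a small factor are bounded by coercivity. *)
Lemma almost_minimizers_close m d : (forall v g, admissible v g -> m <= functional v g) ->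
  0 < d -> exists2 e, 0 < e & forall u v g h, admissible u g -> admissible v h ->
    functional u g < m + e -> functional v h < m + e -> Energy (fun i => g i \- h i) <= d.
Proof.
move=> hm d0; have [C C0 hC] := coercive.
have [B B0 hB] : exists2 B, 0 <= B & forall w k e, sobolev0 Omega p w k ->
    e <= 1 -> functional w k < m + e -> Energy k <= B.
  exists (2 * p * (`|m| + 1 + C)); first by rewrite !mulr_ge0 ?addr_ge0 ?(ltW p0).
  move=> w k e wk e1 hw; apply: le_trans (hC w k wk) _; apply: ler_wpM2l.
    by rewrite mulr_ge0// ltW.
  exact: add_le_of_lt e1 hw (ler_norm m).
have a0 : 0 < d / 2 / (2 * B + 1) by rewrite !divr_gt0// ltr_wpDl// mulr_ge0.
have [K K0 hK] := field_uniform_convexity N mu mO p1 a0.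
have b0 : 0 < d / 2 / (K * p + 1) by rewrite !divr_gt0// ltr_wpDl// mulr_ge0// ltW.
exists (Num.min 1 (d / 2 / (K * p + 1))); first by rewrite lt_min ltr01.
move=> u v g h ug vh fu fv; have [su _] := ug; have [sv _] := vh.
have [_ Lg _] := su; have [_ Lh _] := sv.
have min1 : Num.min 1 (d / 2 / (K * p + 1)) <= 1 by rewrite ge_min lexx.
have minb : Num.min 1 (d / 2 / (K * p + 1)) <= d / 2 / (K * p + 1) by rewrite ge_min lexx orbT.
move: (Num.min _ _) min1 minb fu fv => e e1 eb fu fv.
apply: le_trans (hK g h Lg Lh) _; rewrite (functional_midpoint su sv).
have := hm _ _ (@admissible_convex 2^-1 _ _ _ _ _ ug vh).
have half : 1 - 2^-1 = 2^-1 :> R by lra.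
rewrite half; have h01 : 0 <= (2^-1 : R) <= 1 by lra.
move=> /(_ h01); set M := functional (fun x => _) _ => mM.
have gB := hB _ _ _ su e1 fu; have {}hB := hB _ _ _ sv e1 fv.
have d20 : 0 < d / 2 by rewrite divr_gt0.
rewrite [leRHS]splitr; apply: lerD.
  have B20 : 0 <= 2 * B by rewrite mulr_ge0.
  apply: le_trans (div_succ_mul_le B20 d20).
  exact: (ler_wpM2l (ltW a0) (add_le_double gB hB)).
have Kp0 : 0 <= K * p by rewrite mulr_ge0// ltW.
apply: le_trans (div_succ_mul_le Kp0 d20).
rewrite mulrA mulrC; apply: ler_wpM2r => //.
exact: le_trans (half_sum_le fu fv mM) eb.
Qed.

Lemma functional_infimum : (exists v g, admissible v g) -> exists m,
  (forall v g, admissible v g -> m <= functional v g) /\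
  (forall e, 0 < e -> exists v g, admissible v g /\ functional v g < m + e).
Proof.
move=> [v0 [g0 vg0]]; have [C C0 hC] := coercive.
pose S := [set x | exists v g, admissible v g /\ x = functional v g].
have lbS : has_inf S.
  split; first by exists (functional v0 g0), v0, g0.
  exists (- C) => x [v [g [[vg _] ->]]].
  have : 0 <= 2 * p * (functional v g + C).
    by apply: le_trans (hC v g vg); exact: field_energy_ge0.
  by rewrite pmulr_rge0 ?mulr_gt0//; lra.
exists (inf S); split => [v g vg|e e0].
  by apply: ge_inf; [case: lbS|exists v, g].
have [x [v [g [vg ->]]] xe] := inf_adherent e0 lbS.
by exists v, g.
Qed.

(** The n-th term is almost minimal for the tolerances e k of all steps k <= n at
once, hence the distance between the n-th and the k-th terms is governed by
the smaller of n and k. Closeness of the functions follows from that of the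
gradients by the Poincare inequality. *)
Lemma minimizing_sequence m : (forall v g, admissible v g -> m <= functional v g) ->
  (forall e, 0 < e -> exists v g, admissible v g /\ functional v g < m + e) ->
  exists (v : nat -> 'rV[R]_N -> R) (g : nat -> 'I_N -> 'rV[R]_N -> R),
  [/\ forall n, admissible (v n) (g n),
      forall n k, (n <= k)%N -> energy (v n \- v k) <= fast_rate p n,
      forall i n k, (n <= k)%N -> energy (g n i \- g k i) <= fast_rate p n &
      forall n, functional (v n) (g n) < m + n.+1%:R^-1].
Proof.
move=> hm hinf; have [C C0 hC] := poincare_field.
have d0 n : 0 < fast_rate p n / (C + 1).
  by rewrite divr_gt0 ?fast_rate_gt0// ltr_wpDl.
have /choice[e he] : forall n, exists e, 0 < e /\ forall u v g h,
    admissible u g -> admissible v h -> functional u g < m + e ->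
    functional v h < m + e -> Energy (fun i => g i \- h i) <= fast_rate p n / (C + 1).
  by move=> n; have [e e0 H] := almost_minimizers_close hm (d0 n); exists e.
have e0 n : 0 < e n by case: (he n).
(* t n is a positive lower bound of 1/(n+1) and of e 0, ..., e n. *)
have /choice[t ht] : forall n, exists t, [/\ 0 < t, t <= n.+1%:R^-1 &
    forall k, (k <= n)%N -> t <= e k].
  elim=> [|n [t [t0 _ tn]]].
    exists (Num.min 1 (e 0%N)); split; first by rewrite lt_min ltr01 e0.
    - by rewrite invr1 ge_min lexx.
    - by move=> k; rewrite leqn0 => /eqP ->; rewrite ge_min lexx orbT.
  exists (Num.min n.+2%:R^-1 (Num.min t (e n.+1))); split.
  - by rewrite !lt_min invr_gt0 ltr0n t0 e0.
  - by rewrite ge_min lexx.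
  - move=> k; rewrite leq_eqVlt => /orP[/eqP ->|kn]; first by rewrite !ge_min lexx !orbT.
    by apply: le_trans (tn k kn); rewrite !ge_min lexx orbT.
have /choice[w hw] : forall n, exists w : ('rV[R]_N -> R) * ('I_N -> 'rV[R]_N -> R),
    admissible w.1 w.2 /\ functional w.1 w.2 < m + t n.
  by move=> n; have [t0 _ _] := ht n; have [v [g vg]] := hinf _ t0; exists (v, g).
have close n k : (n <= k)%N ->
    Energy (fun i => (w n).2 i \- (w k).2 i) <= fast_rate p n / (C + 1).
  move=> nk; have [_ H] := he n; have [an fn] := hw n; have [ak fk] := hw k.
  have [_ _ tn] := ht n; have [_ _ tk] := ht k.
  apply: (H _ _ _ _ an ak).
    by apply: lt_le_trans fn _; rewrite lerD2l; exact: tn.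
  by apply: lt_le_trans fk _; rewrite lerD2l; exact: tk.
have sobB n k : sobolev0 Omega p ((w n).1 \- (w k).1) (fun i => (w n).2 i \- (w k).2 i).
  have [[sn _] _] := hw n; have [[sk _] _] := hw k.
  exact: sobolev0B.
exists (fun n => (w n).1), (fun n => (w n).2); split => [n|n k nk|i n k nk|n].
- by case: (hw n).
- apply: le_trans (hC _ _ (sobB n k)) _.
  apply: (@le_trans _ _ (fast_rate p n / (C + 1) * C)).
    by rewrite mulrC; apply: ler_wpM2r => //; exact: close.
  exact: div_succ_mul_le (fast_rate_gt0 p n).
- have [_ L _] := sobB n k.
  apply: le_trans (p_energy_le_field mO p1 i L) _.
  apply: le_trans (close n k nk) _.
  rewrite ler_pdivrMr ?ltr_wpDl//; apply: ler_peMr; first exact/ltW/fast_rate_gt0.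
  by rewrite lerDr.
- have [_ fn] := hw n; have [_ tn _] := ht n.
  by apply: lt_le_trans fn _; rewrite lerD2l.
Qed.

(** The tangent inequality at g bounds the energy of g by that of h minus p times
the form at g tested against h - g, which Young's inequality makes small when
h is close to g in energy. *)
Lemma functional_lsc e : 0 < e -> exists2 C, 0 <= C & forall u v g h,
  sobolev0 Omega p u g -> sobolev0 Omega p v h ->
  functional u g <= functional v h +
    (e * (Energy g + p_energy mu Omega p' f) +
     C * (Energy (fun i => h i \- g i) + energy (v \- u))).
Proof.
move=> e0; have [C C0 hC] := young_plaplace N mu mO p1 e0.
have pp : p'^-1 + p^-1 = 1 by rewrite addrC.
have [K K0 hK] := young_integral mu mO p'0 p0 pp e0.
exists (C + K); first exact: addr_ge0.
move=> u v g h ug vh; have [Lu Lg _] := ug; have [Lv Lh _] := vh.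
have [Lvu Lhg _] := sobolev0B oO bO p1 vh ug.
have [_ h1] := hC _ _ Lg Lhg; have [_ h2] := hK _ _ Lf Lvu.
have h3 := field_energy_convex mO p1 Lg Lh.
have h4 : \int[mu]_(x in Omega) (f x * (v \- u) x) =
    \int[mu]_(x in Omega) (f x * v x) - \int[mu]_(x in Omega) (f x * u x).
  have := source_lincomb 1 (-1) Lv Lu; rewrite mul1r mulN1r => <-.
  by congr Rintegral; apply/funext => x /=; rewrite mul1r mulN1r.
rewrite h4 in h2; rewrite /functional.
have E1 := field_energy_ge0 mu Omega p (fun i => h i \- g i).
have E2 := p_energy_ge0 mu Omega p (v \- u).
move: h1 h2; rewrite !ler_norml => /andP[h1 _] /andP[_ h2].
have V0 : 0 <= p^-1 by rewrite invr_ge0 ltW.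
have {}h3 := ler_wpM2l V0 h3; rewrite mulKf ?lt0r_neq0// mulrBr in h3.
exact: lsc_scalar C0 K0 E1 E2 h1 h3 h2.
Qed.

Lemma admissible_limit (v : nat -> 'rV[R]_N -> R) (g : nat -> 'I_N -> 'rV[R]_N -> R) u G :
  (forall n, admissible (v n) (g n)) -> inLp u -> (forall i, inLp (G i)) ->
  {ae mu, forall x, Omega x -> v n x @[n --> \oo] --> u x} ->
  (forall n, energy (v n \- u) <= fast_rate p n) ->
  (forall i n, energy (g n i \- G i) <= fast_rate p n) ->
  admissible u G.
Proof.
move=> adm Lu LG vu Ev Eg; split.
  apply: (sobolev0_closed oO bO p1 Lu LG) => e e0.
  have sym a b : energy (a \- b) = energy (b \- a).
    by rewrite /p_energy; congr Rintegral; apply/funext => x /=; rewrite distrC.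
  have [n _ /(_ n (leqnn n)) /= ne] : \forall n \near \oo, fast_rate p n < e.
    have /cvgr0_norm_lt H := fast_rate_cvg0 (ltW p0).
    apply: filterS (H _ e0) => n; exact: le_lt_trans (ler_norm _).
  exists (v n), (g n); split; first by case: (adm n).
    by rewrite sym; exact: le_lt_trans (Ev n) ne.
  by move=> i; rewrite sym; exact: le_lt_trans (Eg i n) ne.
have : {ae mu, forall x, forall n, Omega x -> psi x <= v n x}.
  by apply: ae_foralln => n; case: (adm n).
apply: filterS2 vu => x hx h Ox; apply: (cvgr_to_ge (hx Ox)).
by apply: nearW => n; exact: h.
Qed.

(** The errors of functional_lsc along the minimizing sequence are a fixed small
multiple of energies of the limit, plus a term that tends to 0. *)
Lemma minimizer_exists : (exists v g, admissible v g) ->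
  exists u G, admissible u G /\ forall v h, admissible v h -> functional u G <= functional v h.
Proof.
move=> /functional_infimum[m [hm hinf]].
have [v [g [adm cv cg fm]]] := minimizing_sequence hm hinf.
have Lv n : inLp (v n) by case: (adm n) => -[].
have Lg i n : inLp (g n i) by case: (adm n) => -[].
have [u [Lu vu Ev]] := p_complete mO p0 Lv cv.
have /choice[G hG] : forall i, exists G, inLp G /\
    forall n, energy (g n i \- G) <= fast_rate p n.
  move=> i; have [G [LG _ EG]] := p_complete mO p0 (Lg i) (cg i).
  by exists G.
have LG i : inLp (G i) by case: (hG i).
have EG i n : energy (g n i \- G i) <= fast_rate p n by case: (hG i).
have uG := admissible_limit adm Lu LG vu Ev EG.
exists u, G; split => // w h wh; apply: le_trans (hm w h wh).
have [su _] := uG.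
apply/ler_addgt0Pl => e e0.
pose A := Energy G + p_energy mu Omega p' f.
have A0 : 0 <= A by rewrite addr_ge0 ?field_energy_ge0 ?p_energy_ge0.
have eA : 0 < e / (A + 1) by rewrite divr_gt0// ltr_wpDl.
have [C C0 hC] := functional_lsc eA.
pose K := C * (N%:R `^ p * N%:R + 1).
have bound n : functional u G <= (m + e) + (harmonic n + K * fast_rate p n).
  have [sn _] := adm n; apply: le_trans (hC _ _ _ _ su sn) _.
  have h1 : e / (A + 1) * (Energy G + p_energy mu Omega p' f) <= e by exact: div_succ_mul_le.
  have h2 : Energy (fun i => g n i \- G i) <= N%:R `^ p * N%:R * fast_rate p n.
    have [_] := field_integrable mO p1 (fun i => p_integrable_sub mO p1 i (Lg^~ n) LG).
    move/le_trans; apply; rewrite -mulrA; apply: ler_wpM2l; first exact: powR_ge0.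
    apply: (@le_trans _ _ (\sum_(i < N) fast_rate p n)); first by apply: ler_sum => i _; exact: EG.
    by rewrite sumr_const card_ord -[leLHS]mulr_natl.
  exact: (lsc_rate C0 h1 h2 (Ev n) (ltW (fm n))).
have K0 : K * fast_rate p n @[n --> \oo] --> K * 0.
  by apply: cvgM; [exact: cvg_cst|exact: fast_rate_cvg0 (ltW p0)].
have cvg : (m + e) + (harmonic n + K * fast_rate p n) @[n --> \oo] --> (m + e) + (0 + K * 0).
  by apply: cvgD; [exact: cvg_cst|apply: cvgD; [exact: cvg_harmonic|exact: K0]].
rewrite mulr0 !addr0 in cvg; rewrite addrC.
apply: (cvgr_to_ge cvg); exact: nearW.
Qed.

(** The tangent inequality is applied at the perturbed gradient (1 - t) g + t h,
not at g: minimality then yields directly the desired inequality with the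
form taken at the perturbed gradient. As t = 1/(n+1) tends to 0, the form
converges by continuity, dominated through Young's inequality. *)
Lemma minimizer_variational_inequality u g : admissible u g ->
  (forall v h, admissible v h -> functional u g <= functional v h) ->
  forall v h, admissible v h ->
  \int[mu]_(x in Omega) (f x * (v x - u x)) <=
  \int[mu]_(x in Omega) plaplace_form p (field g x) (field (fun i => h i \- g i) x).
Proof.
move=> ug umin v h vh; have [su _] := ug; have [sv _] := vh.
have [Lu Lg _] := su; have [Lv Lh _] := sv.
pose t n : R := n.+1%:R^-1.
have t01 n : 0 < t n <= 1 by rewrite invr_gt0 ltr0n/= invf_le1 ?ler1n ?ltr0n.
pose gt n i x := (1 - t n) * g i x + t n * h i x.
pose K := fun i => h i \- g i.
have LK i : inLp (K i) by exact: (p_integrable_sub mO p1).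
have Lgt n i : inLp (gt n i) by exact: (p_integrable_lincomb mO p1 _ _ _ Lg Lh).
have gtE n x : field (gt n) x = (1 - t n) *: field g x + t n *: field h x.
  exact: field_lincomb.
have step n : \int[mu]_(x in Omega) (f x * (v x - u x)) <=
    \int[mu]_(x in Omega) plaplace_form p (field (gt n) x) (field K x).
  have /andP[t0 t1] := t01 n.
  have tt : 0 <= t n <= 1 by rewrite ltW.
  have := umin _ _ (admissible_convex tt ug vh); rewrite /functional -/(gt n).
  rewrite (source_lincomb _ _ Lu Lv).
  have := field_energy_convex mO p1 (Lgt n) Lg.
  have -> : (fun x => plaplace_form p (field (gt n) x) (field (fun i => g i \- gt n i) x)) =
            (fun x => - t n * plaplace_form p (field (gt n) x) (field K x)).
    apply/funext => x; rewrite -plaplace_formZr; congr plaplace_form.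
    by apply/rowP => i; rewrite !mxE /gt /K /=; ring.
  rewrite RintegralZl//; last exact: plaplace_integrable.
  have -> : \int[mu]_(x in Omega) (f x * (v x - u x)) =
      \int[mu]_(x in Omega) (f x * v x) - \int[mu]_(x in Omega) (f x * u x).
    have := source_lincomb 1 (-1) Lv Lu; rewrite mul1r mulN1r => <-.
    by congr Rintegral; apply/funext => x /=; rewrite mul1r mulN1r.
  exact: tangent_scalar.
have [C C0 hC] := @plaplace_form_young R N p 1 p1 ltr01.
have [ig _] := field_integrable mO p1 Lg; have [ih _] := field_integrable mO p1 Lh.
have [iK _] := field_integrable mO p1 LK.
have igh := integrableZD mO 1 1 ig ih.
have ibd := integrableZD mO (2 `^ p) C igh iK.
have [|||| _ lim] := @Rintegral_dominated_cvg _ _ _ mu Omega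
  (fun n x => plaplace_form p (field (gt n) x) (field K x))
  (fun x => plaplace_form p (field g x) (field K x)) _ mO _ _ _ ibd.
- move=> n; apply: measurable_plaplace => i; [by case: (Lgt n i)|by case: (LK i)].
- by apply: measurable_plaplace => i; [case: (Lg i)|case: (LK i)].
- by move=> x _; under eq_fun do rewrite gtE; exact: cvg_plaplace_segment.
- move=> n x _; apply: le_trans (hC _ _) _; rewrite mul1r lerD2r gtE !mul1r.
  have /andP[t0 t1] := t01 n.
  apply: le_trans (powRD_le (ltW p0) (euclid_norm_ge0 _) (euclid_norm_ge0 _)).
  rewrite ge0_ler_powR ?(ltW p0)// ?nnegrE ?euclid_norm_ge0 ?addr_ge0 ?euclid_norm_ge0//.
  apply: le_trans (euclid_normD _ _) _; rewrite !euclid_normZ.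
  rewrite !ger0_norm ?subr_ge0 ?(ltW t0)//.
  by apply: lerD; apply: ler_piMl; rewrite ?euclid_norm_ge0// gerBl ltW.
by apply: (cvgr_to_ge lim); exact: nearW.
Qed.

End obstacle_problem.

Theorem proposition2 (R : realType) (N : nat) (hN : (2 <= N)%N)
    (Omega : set 'rV[R]_N)
    (Omega_open : open Omega) (Omega_connected : connected Omega)
    (Omega_nonempty : Omega !=set0) (Omega_bounded : bounded_set Omega)
    (Omega_boundary : piecewise_C1_boundary Omega)
    (p p' : R) (hp : 1 < p) (hp' : p^-1 + p'^-1 = 1)
    (psi f : 'rV[R]_N -> R)
    (hpsi : W1p0 Omega p psi) (hf : Lp Omega p' f) :
  exists u : 'rV[R]_N -> R,
    solves_obstacle_inequality Omega p psi f u /\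
    minimizes_on (obstacle_set Omega p psi) (obstacle_energy Omega p f) u.
Proof.
have p0 : 0 < p by exact: lt_trans hp.
have p'0 : 0 < p'.
  have : p^-1 < 1 by rewrite invf_lt1.
  by rewrite -invr_gt0; move: hp'; lra.
have mO := open_measurable_rV Omega_open.
have Lf := (LpP Omega_open f p'0).1 hf.
pose dw v := fun i => weak_partial Omega i v.
have W v : W1p0 Omega p v -> sobolev0 Omega p v (dw v).
  exact: W1p0_sobolev0.
have adm v : obstacle_set Omega p psi v -> admissible Omega p psi v (dw v).
  by move=> [/W vW pv].
have [|u [G [uG umin]]] := minimizer_exists Omega_open Omega_bounded hp hp'
  (Ordinal (ltnW hN)) (psi := psi) Lf.
  by exists psi, (dw psi); split; [exact: W|apply: aeW => x _].
have [su pu] := uG.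
have Wu : W1p0 Omega p u by exact: sobolev0_W1p0 su.
have Ku : obstacle_set Omega p psi u by [].
have [_ LG _] := su; have [_ Lu _] := W u Wu.
(* The chosen weak gradient of u equals G almost everywhere, so paired with it u
still minimizes the functional. *)
have EuG : field_energy lebesgue_measure_rV Omega p (dw u) = field_energy lebesgue_measure_rV Omega p G.
  apply: (ae_field_energy mO) => i; [by case: (Lu i)|by case: (LG i)|].
  exact: (sobolev0_weak_partial_ae Omega_open Omega_bounded hp i su).
have min v : obstacle_set Omega p psi v ->
    functional Omega p f u (dw u) <= functional Omega p f v (dw v).
  by move=> Kv; rewrite {1}/functional EuG; exact: (umin v (dw v) (adm v Kv)).
exists u; split; last first.
  by split; [exact: Ku|exact: min].
split; first exact: Ku.
move=> v Kv.
have umin' w h : admissible Omega p psi w h ->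
    functional Omega p f u (dw u) <= functional Omega p f w h.
  by move=> wh; rewrite {1}/functional EuG; exact: (umin w h wh).
have [sv _] := adm v Kv.
have [_ LB _] := sobolev0B Omega_open Omega_bounded hp sv (W u Wu).
(* The chosen weak gradient of v - u equals almost everywhere the difference of
the chosen weak gradients of v and u. *)
have sB := sobolev0B Omega_open Omega_bounded hp sv (W u Wu).
have [_ LW _] := W _ (sobolev0_W1p0 Omega_open Omega_bounded hp sB).
apply: le_trans (minimizer_variational_inequality Omega_open Omega_bounded hp hp' Lf (adm u Ku) umin' (adm v Kv)) _.
rewrite le_eqVlt; apply/orP; left; apply/eqP.
apply: (ae_eq_Rintegral mO).
- by apply: measurable_plaplace => i; [case: (Lu i)|case: (LB i)].
- have /measurable_EFinP h := measurable_int _ (plaplace_integrable mO hp Lu LW).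
  exact: h.
have ae i := sobolev0_weak_partial_ae Omega_open Omega_bounded hp i sB.
apply: filterS (ae_field_eq ae) => x h Ox; rewrite -h//.
Qed.
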